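(* For every $\tau$ in the interior $\widetilde{\mathbb{D}}^\circ$ of $\widetilde{\mathbb{D}}$, $$\vartheta_{00}(\tau)^4+\omega\,\vartheta_{10}(\tau)^4=F\bigl(\tfrac16,\tfrac12,1;\nu(\tau)\bigr)^2 .$$ Moreover, this extends to an equality on the whole upper half-plane $\mathbb{H}$, where the right-hand side is understood as the analytic continuation to $\mathbb{H}$ of the function $\tau\mapsto F(\frac16,\frac12,1;\nu(\tau))^2$ on $\widetilde{\mathbb{D}}^\circ$.
   Context: $i=\sqrt{-1}$, $\omega=\frac{-1+\sqrt3\, i}{2}$, $\mathbb{H}$ is the upper half-plane. Theta constants: for $p,q\in\{0,1\}$ and $\tau\in\mathbb{H}$, $\vartheta_{pq}(\tau)=\sum_{n\in\mathbb{Z}}\exp\bigl(\pi i(n+\frac p2)^2\tau+2\pi i(n+\frac p2)\frac q2\bigr)$. Hypergeometric function: $F(a,b,c;z)=\sum_{n\ge0}\frac{(a,n)(b,n)}{(c,n)(1,n)}z^n$ for $|z|<1$, with $(a,n)=a(a+1)\cdots(a+n-1)$; the same symbol denotes its single-valued holomorphic continuation to $\mathbb{C}-[1,\infty)$. $$\nu(\tau)=3\sqrt{3}\,i\,\frac{\vartheta_{00}(\tau)^4\,\vartheta_{01}(\tau)^4\,\vartheta_{10}(\tau)^4}{\bigl(\vartheta_{00}(\tau)^4+\omega\,\vartheta_{10}(\tau)^4\bigr)^3}.$$ $$\widetilde{\mathbb{D}}=\{\tau\in\mathbb{H}\mid -\tfrac32<\mathrm{Re}(\tau)\le\tfrac12,\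 |\tau|\ge1,\ |\tau+1|>1\}.$$ *)

(* Defs.v *)
(* Stdlib reals with Coquelicot's complex numbers. *)
From Stdlib Require Import Reals ZArith ClassicalEpsilon.
From Coquelicot Require Import Coquelicot.

Open Scope R_scope.

Definition Cexp (z : C) : C :=
  (exp (Re z) * (cos (Im z) + Ci * sin (Im z)))%C.

(* Coquelicot's [Series] is real-valued; a complex series converges iff its
   real and imaginary parts do, and is then summed componentwise. *)
Definition CSeries (u : nat -> C) : C :=
  (Series (fun n => Re (u n)), Series (fun n => Im (u n))).

(* Sum over Z as the sum over n >= 0 plus the sum over n = -1 - k <= -1; every
   bilateral series it is applied to below converges absolutely. *)
Definition ZSeries (u : Z -> C) : C :=
  (CSeries (fun k => u (Z.of_nat k)) +
   CSeries (fun k => u (- 1 - Z.of_nat k)%Z))%C.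

Definition upper_half_plane (tau : C) : Prop := 0 < Im tau.

Definition theta (p q : nat) (tau : C) : C :=
  ZSeries (fun n =>
    let m : R := IZR n + INR p / 2 in
    Cexp (PI * Ci * m ^ 2 * tau + 2 * PI * Ci * m * (INR q / 2)%R)%C).

Definition omega : C := ((- (1) + sqrt 3 * Ci) / 2)%C.

Definition weight2 (tau : C) : C :=
  (theta 0 0 tau ^ 4 + omega * theta 1 0 tau ^ 4)%C.

(* Inversion is total on [C]; [weight2] has no zero in the interior of
   [Dtilde], where [nu] is used. *)
Definition nu (tau : C) : C :=
  (3 * sqrt 3 * Ci *
     (theta 0 0 tau ^ 4 * theta 0 1 tau ^ 4 * theta 1 0 tau ^ 4) /
   weight2 tau ^ 3)%C.

Definition Dtilde (tau : C) : Prop :=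
  upper_half_plane tau /\
  - (3 / 2) < Re tau <= 1 / 2 /\ 1 <= Cmod tau /\ 1 < Cmod (tau + 1)%C.

Definition Cinterior (D : C -> Prop) (z : C) : Prop := locally z D.

(* Complex differentiability at every point of [U], which is open in each use. *)
Definition holomorphic_on (U : C -> Prop) (f : C -> C) : Prop :=
  forall z : C, U z -> @ex_derive C_AbsRing C_NormedModule f z.

(* [g] is an analytic continuation to [V] of [f] given on [U]. *)
Definition analytic_continuation (U V : C -> Prop) (f g : C -> C) : Prop :=
  (forall z, U z -> V z) /\
  holomorphic_on V g /\ (forall z, U z -> g z = f z).

Fixpoint poch (a : C) (n : nat) : C :=
  match n with
  | O => RtoC 1
  | S k => (poch a k * (a + INR k))%C
  end.

Definition hypergeom_series (a b c z : C) : C :=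
  CSeries (fun n =>
    (poch a n * poch b n / (poch c n * poch (RtoC 1) n) * z ^ n)%C).

Definition unit_disc (z : C) : Prop := Cmod z < 1.

(* The plane cut along the real half-line [1, +oo). *)
Definition cut_plane (z : C) : Prop := ~ (Im z = 0 /\ 1 <= Re z).

(* The continuation to the cut plane, unique there by the identity theorem;
   values on the cut are unspecified. *)
Definition hypergeom (a b c : C) : C -> C :=
  epsilon (inhabits (fun _ : C => RtoC 0))
    (analytic_continuation unit_disc cut_plane (hypergeom_series a b c)).

(* Main.v *)
(** Put [l = theta10^4 / theta00^4], so that [weight2 = theta00^4 (1 + omega l)]
    and [nu = 3 sqrt 3 i l (1 - l) / (1 + omega l)^3].

    Near the cusp, [theta00^2 = F(1/2, 1/2, 1; l)]: by Landen's transformation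
    and the duplication formulas, [F(1/2, 1/2, 1; l) / theta00^2] is unchanged
    under [tau -> 4 tau] and tends to 1.  A cubic transformation, checked on the
    differential equations, turns [F(1/2, 1/2, 1; l)] into
    [(1 + omega l)^(-1/2) F(1/6, 1/2, 1; nu)].

    The identity theorem carries this over to the interior of [Dtilde], provided
    that [nu] avoids [[1, +oo)] there.  Since
    [1 - nu = ((1 + omega^2 l) / (1 + omega l))^3], it is enough to know that
    [|l| < 1] and [|l| < |1 - l|].  The boundary case
    [|theta10| = |theta01|] on [|tau| = 1] is the inversion formula, and
    [|theta10 / theta01|] decreases along vertical lines.

    A 1-periodic entire function with vanishing Fourier coefficients is zero.
    This single fact, resting on Goursat's theorem, gives the duplication and
    inversion formulas (both sides have the same quasi-periods) and, applied to
    circles, the identity theorem. *)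

Require Import Defs.
From Stdlib Require Import Reals Lra Lia Psatz ZArith ClassicalEpsilon Classical.
From Coquelicot Require Import Coquelicot.
Open Scope R_scope.

(** * Complex derivatives *)

(** The quadratic transformation [F(a, a, 1; w^2) = (1 + w)^(-2a) F(a, 1/2, 1; 4 w / (1 + w)^2)]
    serves twice: [a = 1/2] is Landen's transformation, and [a = 1/6] continues the right-hand side
    to the cut plane. The second use cannot be avoided: [hypergeom] is chosen by [epsilon], so
    nothing is known about it until some continuation has been built.

    No branch has to be followed: theta constants are functions of the nome [q], with [q^(1/4)]
    split off from theta10, complex powers are binomial series near 0, and the final identity
    contains only squares.

    Two margins carry the modulus estimates. On the domain [|q| <= exp(- pi sqrt 3 / 2) < 1/12],
    which keeps the theta series close to their first terms. When [q] shrinks to [t q], the factor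
    [q^(1/4)] loses at least [(1 - t) / 4] of its modulus, more than the relative changes of the
    remaining factors can make up. The translation [tau -> tau + 1] exchanges theta00 and theta01
    and so reduces the left half of the domain to the right half. *)

Definition ccont (f : C -> C) (z : C) : Prop :=
  forall eps, 0 < eps -> exists d, 0 < d /\
    forall w, Cmod (w - z)%C < d -> Cmod (f w - f z)%C < eps.

(* Caratheodory's form of complex differentiability: the difference quotient
   extends continuously to [z]. *)
Definition cderiv (f : C -> C) (z l : C) : Prop :=
  exists phi : C -> C,
    (forall w, f w = (f z + phi w * (w - z))%C) /\ phi z = l /\ ccont phi z.

Lemma Cminus_diag (z : C) : (z - z)%C = RtoC 0.
Proof. ring. Qed.

Lemma Cmod_minus_sym (a b : C) : Cmod (a - b)%C = Cmod (b - a)%C.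
Proof. replace (a - b)%C with (- (b - a))%C by ring. apply Cmod_opp. Qed.

Lemma Cminus_eq_0 (a b : C) : (a - b)%C = RtoC 0 -> a = b.
Proof. intros H. replace a with (a - b + b)%C by ring. rewrite H. ring. Qed.

Lemma Cmod_triangle_inv (a b : C) : Cmod a - Cmod b <= Cmod (a + b)%C.
Proof.
  assert (H := Cmod_triangle (a + b)%C (- b)%C).
  replace (a + b + - b)%C with a in H by ring. rewrite Cmod_opp in H. lra.
Qed.

Lemma Cmod_minus_le (a b : C) : Cmod (a - b)%C <= Cmod a + Cmod b.
Proof. unfold Cminus. rewrite <- (Cmod_opp b). apply Cmod_triangle. Qed.

Lemma ccont_const (c z : C) : ccont (fun _ => c) z.
Proof.
  intros e He. exists 1. split; [lra|]. intros w _. rewrite Cminus_diag, Cmod_0. exact He.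
Qed.

Lemma ccont_id (z : C) : ccont (fun w => w) z.
Proof. intros e He. exists e. split; [lra|]. intros w Hw. exact Hw. Qed.

Lemma ccont_plus (f g : C -> C) (z : C) :
  ccont f z -> ccont g z -> ccont (fun w => f w + g w)%C z.
Proof.
  intros Hf Hg e He.
  destruct (Hf (e / 2)) as [d1 [D1 K1]]; [lra|].
  destruct (Hg (e / 2)) as [d2 [D2 K2]]; [lra|].
  exists (Rmin d1 d2). split; [now apply Rmin_pos|]. intros w Hw.
  specialize (K1 w (Rlt_le_trans _ _ _ Hw (Rmin_l _ _))).
  specialize (K2 w (Rlt_le_trans _ _ _ Hw (Rmin_r _ _))).
  replace (f w + g w - (f z + g z))%C with ((f w - f z) + (g w - g z))%C by ring.
  eapply Rle_lt_trans; [apply Cmod_triangle|]. lra.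
Qed.

Lemma ccont_mult (f g : C -> C) (z : C) :
  ccont f z -> ccont g z -> ccont (fun w => f w * g w)%C z.
Proof.
  intros Hf Hg e He.
  set (A := Cmod (f z)). set (B := Cmod (g z)).
  assert (HA : 0 <= A) by apply Cmod_ge_0.
  assert (HB : 0 <= B) by apply Cmod_ge_0.
  (* The three error terms are at most [e1 * e1 + e1 * B + A * e1]; as [e1 <= 1], this is at most
     [e1 * (A + B + 1) <= e / 2]. *)
  set (e1 := Rmin 1 (e / (2 * (A + B + 1)))).
  assert (He1 : 0 < e1).
  { apply Rmin_pos; [lra|]. apply Rdiv_lt_0_compat; lra. }
  assert (He2 : e1 * (A + B + 1) <= e / 2).
  { apply Rle_trans with (e / (2 * (A + B + 1)) * (A + B + 1)).
    - apply Rmult_le_compat_r; [lra|apply Rmin_r].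
    - right. field. lra. }
  assert (He3 : e1 <= 1) by apply Rmin_l.
  destruct (Hf e1 He1) as [d1 [D1 K1]].
  destruct (Hg e1 He1) as [d2 [D2 K2]].
  exists (Rmin d1 d2). split; [now apply Rmin_pos|]. intros w Hw.
  specialize (K1 w (Rlt_le_trans _ _ _ Hw (Rmin_l _ _))).
  specialize (K2 w (Rlt_le_trans _ _ _ Hw (Rmin_r _ _))).
  replace (f w * g w - f z * g z)%C
    with ((f w - f z) * (g w - g z) + ((f w - f z) * g z + f z * (g w - g z)))%C by ring.
  eapply Rle_lt_trans; [apply Cmod_triangle|].
  eapply Rle_lt_trans; [apply Rplus_le_compat_l, Cmod_triangle|].
  rewrite !Cmod_mult. fold A B.
  pose proof (Cmod_ge_0 (f w - f z)%C). pose proof (Cmod_ge_0 (g w - g z)%C).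
  nra.
Qed.

Lemma ccont_comp (f g : C -> C) (z : C) :
  ccont g z -> ccont f (g z) -> ccont (fun w => f (g w)) z.
Proof.
  intros Hg Hf e He. destruct (Hf e He) as [d [D K]].
  destruct (Hg d D) as [d' [D' K']]. exists d'. split; [exact D'|].
  intros w Hw. apply K, K', Hw.
Qed.

Lemma ccont_ext (f g : C -> C) (z : C) :
  (forall w, f w = g w) -> ccont f z -> ccont g z.
Proof.
  intros E H e He. destruct (H e He) as [d [D K]]. exists d. split; [exact D|].
  intros w Hw. rewrite <- !E. apply K, Hw.
Qed.

Lemma ccont_nonzero (f : C -> C) (z : C) :
  ccont f z -> f z <> RtoC 0 ->
  exists d, 0 < d /\ forall w, Cmod (w - z)%C < d -> Cmod (f z) / 2 < Cmod (f w).
Proof.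
  intros H Hn. assert (P : 0 < Cmod (f z)) by now apply Cmod_gt_0.
  destruct (H (Cmod (f z) / 2)) as [d [D K]]; [lra|].
  exists d. split; [exact D|]. intros w Hw. specialize (K w Hw).
  assert (T := Cmod_triangle_inv (f z) (f w - f z)%C).
  replace (f z + (f w - f z))%C with (f w) in T by ring. lra.
Qed.

Lemma ccont_inv (f : C -> C) (z : C) :
  ccont f z -> f z <> RtoC 0 -> ccont (fun w => / f w)%C z.
Proof.
  intros H Hn e He. assert (P : 0 < Cmod (f z)) by now apply Cmod_gt_0.
  destruct (ccont_nonzero f z H Hn) as [d1 [D1 K1]].
  (* The difference of the inverses is [|f w - f z| / (|f w| |f z|)], and [d1] keeps [|f w|] above
     [|f z| / 2]. *)
  destruct (H (e * (Cmod (f z) * Cmod (f z) / 2))) as [d2 [D2 K2]].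
  { apply Rmult_lt_0_compat; [exact He|nra]. }
  exists (Rmin d1 d2). split; [now apply Rmin_pos|]. intros w Hw.
  specialize (K1 w (Rlt_le_trans _ _ _ Hw (Rmin_l _ _))).
  specialize (K2 w (Rlt_le_trans _ _ _ Hw (Rmin_r _ _))).
  assert (Hw0 : f w <> RtoC 0).
  { apply Cmod_gt_0. lra. }
  replace (/ f w - / f z)%C with ((f z - f w) * (/ f w * / f z))%C by (field; now split).
  rewrite !Cmod_mult, !Cmod_inv by assumption.
  rewrite Cmod_minus_sym.
  assert (Q : 0 < / Cmod (f w) * / Cmod (f z)).
  { apply Rmult_lt_0_compat; apply Rinv_0_lt_compat; lra. }
  apply Rlt_le_trans with (e * (Cmod (f z) * Cmod (f z) / 2) * (/ Cmod (f w) * / Cmod (f z))).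
  - apply Rmult_lt_compat_r; lra.
  - apply Rle_trans with (e * ((Cmod (f z) / 2) / Cmod (f w))).
    + right. field. lra.
    + rewrite <- (Rmult_1_r e) at 2. apply Rmult_le_compat_l; [lra|].
      apply Rmult_le_reg_r with (Cmod (f w)); [lra|].
      replace (Cmod (f z) / 2 / Cmod (f w) * Cmod (f w)) with (Cmod (f z) / 2) by (field; lra).
      lra.
Qed.

Lemma cderiv_ccont (f : C -> C) (z l : C) : cderiv f z l -> ccont f z.
Proof.
  intros [phi [E [_ H]]].
  apply ccont_ext with (fun w => f z + phi w * (w - z))%C; [intros w; now rewrite <- E|].
  apply ccont_plus; [apply ccont_const|]. apply ccont_mult; [exact H|].
  apply ccont_plus; [apply ccont_id|apply ccont_const].
Qed.

Lemma cderiv_const (c z : C) : cderiv (fun _ => c) z (RtoC 0).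
Proof.
  exists (fun _ => RtoC 0). split; [intros; ring|]. split; [reflexivity|apply ccont_const].
Qed.

Lemma cderiv_id (z : C) : cderiv (fun w => w) z (RtoC 1).
Proof.
  exists (fun _ => RtoC 1). split; [intros; ring|]. split; [reflexivity|apply ccont_const].
Qed.

Lemma cderiv_eq (f : C -> C) (z l l' : C) : cderiv f z l -> l = l' -> cderiv f z l'.
Proof. intros H <-. exact H. Qed.

Lemma cderiv_ext (f g : C -> C) (z l : C) :
  (forall w, f w = g w) -> cderiv f z l -> cderiv g z l.
Proof.
  intros E [phi [H1 [H2 H3]]]. exists phi. split; [|now split].
  intros w. rewrite <- !E. apply H1.
Qed.

Lemma cderiv_plus (f g : C -> C) (z lf lg : C) :
  cderiv f z lf -> cderiv g z lg -> cderiv (fun w => f w + g w)%C z (lf + lg)%C.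
Proof.
  intros [p [E1 [F1 H1]]] [q [E2 [F2 H2]]].
  exists (fun w => p w + q w)%C. split; [|split].
  - intros w. rewrite (E1 w), (E2 w). ring.
  - now rewrite F1, F2.
  - now apply ccont_plus.
Qed.

Lemma cderiv_mult (f g : C -> C) (z lf lg : C) :
  cderiv f z lf -> cderiv g z lg ->
  cderiv (fun w => f w * g w)%C z (lf * g z + f z * lg)%C.
Proof.
  intros Hf Hg. pose proof (cderiv_ccont _ _ _ Hg) as Cg.
  destruct Hf as [p [E1 [F1 H1]]]. destruct Hg as [q [E2 [F2 H2]]].
  exists (fun w => p w * g w + f z * q w)%C. split; [|split].
  - intros w. rewrite (E1 w). replace (g z) with (g w - q w * (w - z))%C; [ring|].
    rewrite (E2 w) at 1. ring.
  - now rewrite F1, F2.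
  - apply ccont_plus; apply ccont_mult; try assumption. apply ccont_const.
Qed.

Lemma cderiv_comp (f g : C -> C) (z lf lg : C) :
  cderiv g z lg -> cderiv f (g z) lf -> cderiv (fun w => f (g w)) z (lf * lg)%C.
Proof.
  intros Hg Hf. pose proof (cderiv_ccont _ _ _ Hg) as Cg.
  destruct Hf as [p [E1 [F1 H1]]]. destruct Hg as [q [E2 [F2 H2]]].
  exists (fun w => p (g w) * q w)%C. split; [|split].
  - intros w. rewrite (E1 (g w)). replace (g w - g z)%C with (q w * (w - z))%C; [ring|].
    rewrite (E2 w). ring.
  - now rewrite F1, F2.
  - apply ccont_mult; [|assumption]. now apply ccont_comp.
Qed.

Lemma cderiv_of_quotient (f : C -> C) (z l : C) :
  (forall eps, 0 < eps -> exists d, 0 < d /\ forall w, Cmod (w - z)%C < d ->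
     Cmod (f w - f z - l * (w - z))%C <= eps * Cmod (w - z)%C) ->
  cderiv f z l.
Proof.
  intros H.
  exists (fun w => if Ceq_dec w z then l else ((f w - f z) / (w - z))%C).
  assert (N : forall w, w <> z -> (w - z)%C <> RtoC 0).
  { intros w Hw E. apply Hw. now apply Cminus_eq_0. }
  split; [|split].
  - intros w. destruct (Ceq_dec w z) as [->|Hw]; [ring|]. field. auto.
  - destruct (Ceq_dec z z); [reflexivity|congruence].
  - intros e He. destruct (H (e / 2)) as [d [D K]]; [lra|].
    exists d. split; [exact D|]. intros w Hw.
    destruct (Ceq_dec z z) as [_|]; [|congruence].
    destruct (Ceq_dec w z) as [->|Hwz].
    + rewrite Cminus_diag, Cmod_0. exact He.
    + specialize (K w Hw). specialize (N w Hwz).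
      assert (P : 0 < Cmod (w - z)%C) by now apply Cmod_gt_0.
      replace ((f w - f z) / (w - z) - l)%C
        with ((f w - f z - l * (w - z)) / (w - z))%C by (field; exact N).
      rewrite Cmod_div by exact N.
      apply Rmult_lt_reg_r with (Cmod (w - z)%C); [exact P|].
      unfold Rdiv. rewrite Rmult_assoc, Rinv_l, Rmult_1_r by lra. nra.
Qed.

Lemma cderiv_quotient (f : C -> C) (z l : C) :
  cderiv f z l ->
  forall eps, 0 < eps -> exists d, 0 < d /\ forall w, Cmod (w - z)%C < d ->
     Cmod (f w - f z - l * (w - z))%C <= eps * Cmod (w - z)%C.
Proof.
  intros [p [E [F H]]] e He. destruct (H e He) as [d [D K]].
  exists d. split; [exact D|]. intros w Hw. specialize (K w Hw).
  replace (f w - f z - l * (w - z))%C with ((p w - p z) * (w - z))%C.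
  - rewrite Cmod_mult. apply Rmult_le_compat_r; [apply Cmod_ge_0|lra].
  - rewrite (E w), F. ring.
Qed.

Lemma cderiv_ext_loc (f g : C -> C) (z l : C) (r : R) :
  0 < r -> (forall w, Cmod (w - z)%C < r -> f w = g w) -> cderiv f z l -> cderiv g z l.
Proof.
  intros Hr E H. apply cderiv_of_quotient. intros e He.
  destruct (cderiv_quotient f z l H e He) as [d [D K]].
  exists (Rmin d r). split; [now apply Rmin_pos|]. intros w Hw.
  rewrite <- (E w), <- (E z).
  - apply K. eapply Rlt_le_trans; [exact Hw|apply Rmin_l].
  - rewrite Cminus_diag, Cmod_0. exact Hr.
  - eapply Rlt_le_trans; [exact Hw|apply Rmin_r].
Qed.

(** [cderiv] asks for a factorization valid at every point, but the one for [1 / f] breaks down at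
    zeros of [f]. So a function that has the factorization by construction is differentiated, and it
    agrees with [1 / f] near [z]. *)
Lemma cderiv_inv (f : C -> C) (z l : C) :
  cderiv f z l -> f z <> RtoC 0 -> cderiv (fun w => / f w)%C z (- l / (f z * f z))%C.
Proof.
  intros H Hn. pose proof (cderiv_ccont _ _ _ H) as Cf.
  destruct (ccont_nonzero f z Cf Hn) as [d [D K]].
  assert (P : 0 < Cmod (f z)) by now apply Cmod_gt_0.
  destruct H as [p [E [F H]]].
  assert (W : cderiv (fun w => / f z + - p w * / f w * / f z * (w - z))%C z
                (- l / (f z * f z))%C).
  { exists (fun w => - p w * / f w * / f z)%C. split; [|split].
    - intros w. rewrite Cminus_diag. ring.
    - rewrite F. field. exact Hn.
    - apply ccont_mult; [|apply ccont_const]. apply ccont_mult; [|now apply ccont_inv].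
      apply ccont_ext with (fun w => RtoC (-1) * p w)%C; [intros; ring|].
      apply ccont_mult; [apply ccont_const|exact H]. }
  apply cderiv_ext_loc with (f := (fun w => / f z + - p w * / f w * / f z * (w - z))%C) (r := d);
    [exact D| |exact W].
  intros w Hw. specialize (K w Hw).
  assert (Hw0 : f w <> RtoC 0) by (apply Cmod_gt_0; lra).
  replace (/ f w)%C with (/ f z + (f z - f w) * / f w * / f z)%C at 2 by (field; now split).
  rewrite (E w) at 2. ring.
Qed.

Lemma cderiv_scal (c : C) (f : C -> C) (z l : C) :
  cderiv f z l -> cderiv (fun w => c * f w)%C z (c * l)%C.
Proof.
  intros H. eapply cderiv_eq; [apply cderiv_mult; [apply cderiv_const|exact H]|].
  simpl. ring.
Qed.

Lemma cderiv_opp (f : C -> C) (z l : C) :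
  cderiv f z l -> cderiv (fun w => - f w)%C z (- l)%C.
Proof.
  intros H. apply cderiv_ext with (fun w => RtoC (-1) * f w)%C; [intros; ring|].
  eapply cderiv_eq; [apply cderiv_scal, H|ring].
Qed.

Lemma cderiv_minus (f g : C -> C) (z lf lg : C) :
  cderiv f z lf -> cderiv g z lg -> cderiv (fun w => f w - g w)%C z (lf - lg)%C.
Proof. intros Hf Hg. unfold Cminus. apply cderiv_plus; [exact Hf|now apply cderiv_opp]. Qed.

Lemma cderiv_div (f g : C -> C) (z lf lg : C) :
  cderiv f z lf -> cderiv g z lg -> g z <> RtoC 0 ->
  cderiv (fun w => f w / g w)%C z ((lf * g z - f z * lg) / (g z * g z))%C.
Proof.
  intros Hf Hg Hn. eapply cderiv_eq.
  - apply (cderiv_mult f (fun w => / g w)%C); [exact Hf|]. apply cderiv_inv; [exact Hg|exact Hn].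
  - simpl. field. exact Hn.
Qed.

Lemma cderiv_pow (f : C -> C) (z l : C) (n : nat) :
  cderiv f z l -> cderiv (fun w => f w ^ n)%C z (INR n * f z ^ (Nat.pred n) * l)%C.
Proof.
  intros H. induction n as [|n IH].
  - simpl. eapply cderiv_eq; [apply cderiv_const|ring].
  - apply cderiv_ext with (fun w => f w * f w ^ n)%C; [intros; reflexivity|].
    eapply cderiv_eq; [apply cderiv_mult; [exact H|exact IH]|].
    rewrite S_INR, RtoC_plus. destruct n; simpl Nat.pred; [simpl; ring|].
    rewrite Cpow_S. ring.
Qed.

(** Connects [cderiv] with the derivative in [holomorphic_on]. The library notion speaks of every
    limit [x] of the neighbourhood filter of [z]; uniqueness of limits leaves only [x = z]. *)
Lemma cderiv_is_derive (f : C -> C) (z l : C) :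
  cderiv f z l <-> @is_derive C_AbsRing C_NormedModule f z l.
Proof.
  split.
  - intros H. split; [apply is_linear_scal_l|].
    intros x Hx e.
    assert (E : x = z).
    { symmetry. apply (@is_filter_lim_locally_unique _ (AbsRing_NormedModule C_AbsRing)). exact Hx. }
    subst x.
    destruct (cderiv_quotient f z l H e (cond_pos e)) as [d [D K]].
    exists (mkposreal d D). intros w Hw.
    change (Cmod ((f w - f z) - (w - z) * l)%C <= e * Cmod (w - z)%C).
    replace (f w - f z - (w - z) * l)%C with (f w - f z - l * (w - z))%C by ring.
    apply K. exact Hw.
  - intros [_ H]. apply cderiv_of_quotient. intros e He.
    specialize (H z (fun P HP => HP) (mkposreal e He)). destruct H as [d H].
    exists d. split; [apply cond_pos|]. intros w Hw. specialize (H w Hw).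
    change (Cmod ((f w - f z) - (w - z) * l)%C <= e * Cmod (w - z)%C) in H.
    replace (f w - f z - l * (w - z))%C with (f w - f z - (w - z) * l)%C by ring.
    exact H.
Qed.

Lemma holomorphic_onE (U : C -> Prop) (f : C -> C) :
  holomorphic_on U f <-> forall z, U z -> exists l, cderiv f z l.
Proof.
  split; intros H z Hz; destruct (H z Hz) as [l Hl]; exists l; now apply cderiv_is_derive.
Qed.

(** * The complex exponential *)

Lemma Cexp_plus (a b : C) : Cexp (a + b)%C = (Cexp a * Cexp b)%C.
Proof.
  destruct a as [a1 a2], b as [b1 b2].
  unfold Cexp, Cmult, Cplus, RtoC, Ci; simpl. rewrite exp_plus, cos_plus, sin_plus.
  apply injective_projections; simpl; ring.
Qed.

Lemma Cexp_0 : Cexp (RtoC 0) = RtoC 1.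
Proof.
  unfold Cexp, RtoC; simpl. rewrite exp_0, cos_0, sin_0.
  apply injective_projections; simpl; ring.
Qed.

Lemma Cmod_cis (t : R) : Cmod (cos t + Ci * sin t)%C = 1.
Proof.
  pose proof (sin2_cos2 t) as H. unfold Rsqr in H.
  unfold Cmod. rewrite <- sqrt_1, <- H. f_equal. simpl. ring.
Qed.

Lemma Cmod_Cexp (z : C) : Cmod (Cexp z) = exp (Re z).
Proof.
  unfold Cexp. rewrite Cmod_mult, Cmod_cis, Cmod_R, Rabs_pos_eq; [ring|].
  left; apply exp_pos.
Qed.

Lemma Cexp_nz (z : C) : Cexp z <> RtoC 0.
Proof. apply Cmod_gt_0. rewrite Cmod_Cexp. apply exp_pos. Qed.

Lemma Cexp_opp (z : C) : Cexp (- z)%C = (/ Cexp z)%C.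
Proof.
  assert (H : (Cexp (- z) * Cexp z)%C = RtoC 1).
  { rewrite <- Cexp_plus, <- Cexp_0. apply f_equal; ring. }
  rewrite <- (Cmult_1_r (Cexp (- z))), <- (Cinv_r (Cexp z)) by apply Cexp_nz.
  rewrite Cmult_assoc, H. ring.
Qed.

Lemma Cexp_mult_nat (n : nat) (z : C) : Cexp (INR n * z)%C = (Cexp z ^ n)%C.
Proof.
  induction n as [|n IH].
  - simpl. rewrite <- Cexp_0. apply f_equal; ring.
  - rewrite S_INR, RtoC_plus, Cpow_S, <- IH, <- Cexp_plus. apply f_equal; ring.
Qed.

Lemma is_derive_quotient_0 (f : R -> R) (l : R) :
  is_derive f 0 l -> forall eps, 0 < eps -> exists d, 0 < d /\
    forall x, Rabs x < d -> Rabs (f x - f 0 - l * x) <= eps * Rabs x.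
Proof.
  intros [_ H] e He. specialize (H 0 (fun P HP => HP) (mkposreal e He)).
  destruct H as [d H]. exists d. split; [apply cond_pos|]. intros x Hx.
  assert (B : ball 0 d x).
  { change (Rabs (x - 0) < d). rewrite Rminus_0_r. exact Hx. }
  specialize (H x B).
  change (Rabs (f x - f 0 - (x - 0) * l) <= e * Rabs (x - 0)) in H.
  rewrite Rminus_0_r in H.
  replace (f x - f 0 - l * x) with (f x - f 0 - x * l) by ring. exact H.
Qed.

Lemma Cmod_le_abs (z : C) : Cmod z <= Rabs (Re z) + Rabs (Im z).
Proof.
  replace z with (RtoC (Re z) + Ci * Im z)%C at 1.
  - eapply Rle_trans; [apply Cmod_triangle|].
    rewrite Cmod_mult, Cmod_Ci, !Cmod_R. lra.
  - destruct z as [x y]. apply injective_projections; simpl; ring.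
Qed.

Lemma im_le_Cmod (z : C) : Rabs (Im z) <= Cmod z.
Proof. eapply Rle_trans; [apply Rmax_r|apply Rmax_Cmod]. Qed.

Lemma cderiv_Cexp_0 : cderiv Cexp (RtoC 0) (RtoC 1).
Proof.
  apply cderiv_of_quotient. intros e He.
  assert (De : is_derive exp 0 1) by (auto_derive; [exact I|rewrite exp_0; ring]).
  assert (Dc : is_derive cos 0 0) by (auto_derive; [exact I|rewrite sin_0; ring]).
  assert (Ds : is_derive sin 0 1) by (auto_derive; [exact I|rewrite cos_0; ring]).
  (* The remainder has real part [exp x * E2 + E1] and imaginary part
     [exp x * E3 + (exp x - 1) * y], together at most [6 * (k * m)]. The radius [k / 2] chosen below
     keeps [|exp x - 1|] within [k]. *)
  set (k := Rmin 1 (e / 10)).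
  assert (K0 : 0 < k) by (apply Rmin_pos; lra).
  assert (K1 : k <= 1) by apply Rmin_l.
  assert (K2 : k <= e / 10) by apply Rmin_r.
  destruct (is_derive_quotient_0 exp 1 De k K0) as [d1 [D1 H1]].
  destruct (is_derive_quotient_0 cos 0 Dc k K0) as [d2 [D2 H2]].
  destruct (is_derive_quotient_0 sin 1 Ds k K0) as [d3 [D3 H3]].
  set (d := Rmin (Rmin d1 d2) (Rmin d3 (k / 2))).
  assert (Dd : 0 < d) by (repeat apply Rmin_pos; lra).
  exists d. split; [exact Dd|]. intros w Hw.
  assert (L1 : d <= d1) by (eapply Rle_trans; [apply Rmin_l|apply Rmin_l]).
  assert (L2 : d <= d2) by (eapply Rle_trans; [apply Rmin_l|apply Rmin_r]).
  assert (L3 : d <= d3) by (eapply Rle_trans; [apply Rmin_r|apply Rmin_l]).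
  assert (L4 : d <= k / 2) by (eapply Rle_trans; [apply Rmin_r|apply Rmin_r]).
  rewrite Cexp_0. replace (w - 0)%C with w in * by ring.
  destruct w as [x y].
  assert (Bx : Rabs x <= Cmod (x, y)) by apply (re_le_Cmod (x, y)).
  assert (By : Rabs y <= Cmod (x, y)) by apply (im_le_Cmod (x, y)).
  specialize (H1 x ltac:(lra)). specialize (H2 y ltac:(lra)). specialize (H3 y ltac:(lra)).
  rewrite exp_0 in H1. rewrite cos_0 in H2. rewrite sin_0 in H3.
  set (m := Cmod (x, y)) in *. assert (M0 : 0 <= m) by apply Cmod_ge_0.
  eapply Rle_trans; [apply Cmod_le_abs|]. simpl.
  set (E1 := exp x - 1 - 1 * x) in *.
  set (E2 := cos y - 1 - 0 * y) in *.
  set (E3 := sin y - 0 - 1 * y) in *.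
  assert (Q1 : Rabs E1 <= k * m) by (eapply Rle_trans; [exact H1|nra]).
  assert (Q2 : Rabs E2 <= k * m) by (eapply Rle_trans; [exact H2|nra]).
  assert (Q3 : Rabs E3 <= k * m) by (eapply Rle_trans; [exact H3|nra]).
  assert (Ex : exp x = 1 + x + E1) by (unfold E1; ring).
  assert (Ec : cos y = 1 + E2) by (unfold E2; ring).
  assert (Es : sin y = y + E3) by (unfold E3; ring).
  assert (X1 : Rabs (exp x - 1) <= k).
  { rewrite Ex. replace (1 + x + E1 - 1) with (x + E1) by ring.
    eapply Rle_trans; [apply Rabs_triang|]. nra. }
  assert (X2 : Rabs (exp x) <= 2).
  { replace (exp x) with (1 + (exp x - 1)) by ring.
    eapply Rle_trans; [apply Rabs_triang|]. rewrite Rabs_R1. lra. }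
  match goal with |- Rabs ?a + Rabs ?b <= _ =>
    replace a with (exp x * E2 + E1) by (rewrite Ec, Ex; ring);
    replace b with (exp x * E3 + (exp x - 1) * y) by (rewrite Es, Ex; ring)
  end.
  pose proof (Rabs_triang (exp x * E2) E1) as T1. rewrite Rabs_mult in T1.
  pose proof (Rabs_triang (exp x * E3) ((exp x - 1) * y)) as T2. rewrite !Rabs_mult in T2.
  pose proof (Rabs_pos (exp x)). pose proof (Rabs_pos E2). pose proof (Rabs_pos E3).
  pose proof (Rabs_pos (exp x - 1)). pose proof (Rabs_pos y).
  assert (Y1 : Rabs (exp x) * Rabs E2 <= 2 * (k * m)) by (apply Rmult_le_compat; assumption).
  assert (Y2 : Rabs (exp x) * Rabs E3 <= 2 * (k * m)) by (apply Rmult_le_compat; assumption).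
  assert (Y3 : Rabs (exp x - 1) * Rabs y <= k * m) by (apply Rmult_le_compat; assumption).
  assert (Y4 : 6 * (k * m) <= e * m) by nra.
  lra.
Qed.

Lemma cderiv_Cexp (z : C) : cderiv Cexp z (Cexp z).
Proof.
  apply cderiv_ext with (fun w => Cexp z * Cexp (w - z))%C.
  - intros w. rewrite <- Cexp_plus. apply f_equal; ring.
  - eapply cderiv_eq.
    + apply cderiv_scal. apply cderiv_comp.
      * apply cderiv_minus; [apply cderiv_id|apply cderiv_const].
      * rewrite Cminus_diag. apply cderiv_Cexp_0.
    + simpl. ring.
Qed.

(** * Complex power series *)

Definition abs_summable (u : nat -> C) : Prop := ex_series (fun n => Cmod (u n)).

Lemma abs_summable_le (u : nat -> C) (v : nat -> R) :
  (forall n, Cmod (u n) <= v n) -> ex_series v -> abs_summable u.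
Proof.
  intros H Hv. apply (ex_series_le (fun n => Cmod (u n)) v); [|exact Hv].
  intros n. change (Rabs (Cmod (u n)) <= v n). rewrite Rabs_pos_eq by apply Cmod_ge_0. apply H.
Qed.

Lemma ex_series_Re (u : nat -> C) : abs_summable u -> ex_series (fun n => Re (u n)).
Proof.
  intros H. apply (ex_series_le (fun n => Re (u n)) (fun n => Cmod (u n))); [|exact H].
  intros n. apply re_le_Cmod.
Qed.

Lemma ex_series_Im (u : nat -> C) : abs_summable u -> ex_series (fun n => Im (u n)).
Proof.
  intros H. apply (ex_series_le (fun n => Im (u n)) (fun n => Cmod (u n))); [|exact H].
  intros n. apply im_le_Cmod.
Qed.

Lemma abs_summable_plus (u v : nat -> C) :
  abs_summable u -> abs_summable v -> abs_summable (fun n => u n + v n)%C.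
Proof.
  intros Hu Hv. apply abs_summable_le with (fun n => Cmod (u n) + Cmod (v n)).
  - intros n. apply Cmod_triangle.
  - exact (ex_series_plus _ _ Hu Hv).
Qed.

Lemma abs_summable_scal (c : C) (u : nat -> C) :
  abs_summable u -> abs_summable (fun n => c * u n)%C.
Proof.
  intros Hu. apply abs_summable_le with (fun n => Cmod c * Cmod (u n)).
  - intros n. rewrite Cmod_mult. apply Rle_refl.
  - exact (ex_series_scal (Cmod c) _ Hu).
Qed.

Lemma abs_summable_ext (u v : nat -> C) :
  (forall n, u n = v n) -> abs_summable u -> abs_summable v.
Proof. intros E. apply ex_series_ext. intros n. now rewrite E. Qed.

Lemma abs_summable_incr (u : nat -> C) :
  abs_summable (fun n => u (S n)) <-> abs_summable u.
Proof.
  unfold abs_summable. symmetry. apply (ex_series_incr_1 (fun n => Cmod (u n))).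
Qed.

Lemma CSeries_ext (u v : nat -> C) : (forall n, u n = v n) -> CSeries u = CSeries v.
Proof.
  intros E. unfold CSeries. f_equal; apply Series_ext; intros n; now rewrite E.
Qed.

Lemma CSeries_plus (u v : nat -> C) :
  abs_summable u -> abs_summable v ->
  CSeries (fun n => u n + v n)%C = (CSeries u + CSeries v)%C.
Proof.
  intros Hu Hv. unfold CSeries, Cplus; simpl. f_equal.
  - rewrite <- Series_plus by now apply ex_series_Re. apply Series_ext. reflexivity.
  - rewrite <- Series_plus by now apply ex_series_Im. apply Series_ext. reflexivity.
Qed.

Lemma CSeries_scal (c : C) (u : nat -> C) :
  abs_summable u -> CSeries (fun n => c * u n)%C = (c * CSeries u)%C.
Proof.
  intros Hu. pose proof (ex_series_Re u Hu) as H1. pose proof (ex_series_Im u Hu) as H2.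
  unfold CSeries, Cmult; simpl. f_equal.
  - rewrite <- !Series_scal_l, <- Series_minus.
    + apply Series_ext. reflexivity.
    + exact (ex_series_scal (fst c) _ H1).
    + exact (ex_series_scal (snd c) _ H2).
  - rewrite <- !Series_scal_l, <- Series_plus.
    + apply Series_ext. reflexivity.
    + exact (ex_series_scal (fst c) _ H2).
    + exact (ex_series_scal (snd c) _ H1).
Qed.

Lemma CSeries_minus (u v : nat -> C) :
  abs_summable u -> abs_summable v ->
  CSeries (fun n => u n - v n)%C = (CSeries u - CSeries v)%C.
Proof.
  intros Hu Hv.
  rewrite (CSeries_ext _ (fun n => u n + RtoC (-1) * v n)%C) by (intros; ring).
  rewrite CSeries_plus, CSeries_scal; auto using abs_summable_scal. ring.
Qed.

Lemma CSeries_incr (u : nat -> C) :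
  abs_summable u -> CSeries u = (u 0%nat + CSeries (fun n => u (S n)))%C.
Proof.
  intros Hu. unfold CSeries, Cplus; simpl. f_equal.
  - rewrite Series_incr_1 by now apply ex_series_Re. reflexivity.
  - rewrite Series_incr_1 by now apply ex_series_Im. reflexivity.
Qed.

Lemma CSeries_0 (u : nat -> C) : (forall n, u n = RtoC 0) -> CSeries u = RtoC 0.
Proof.
  intros H. unfold CSeries, RtoC. f_equal.
  - rewrite <- (Series_ext (fun _ => 0)); [|intros n; now rewrite H].
    apply is_series_unique. apply filterlim_ext with (fun _ => 0); [|apply filterlim_const].
    intros n. rewrite sum_n_const. ring.
  - rewrite <- (Series_ext (fun _ => 0)); [|intros n; now rewrite H].
    apply is_series_unique. apply filterlim_ext with (fun _ => 0); [|apply filterlim_const].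
    intros n. rewrite sum_n_const. ring.
Qed.

(* Rotating the sum onto the positive real axis reduces the triangle inequality
   to a termwise comparison of real series. *)
Lemma Cmod_CSeries (u : nat -> C) :
  abs_summable u -> Cmod (CSeries u) <= Series (fun n => Cmod (u n)).
Proof.
  intros Hu. destruct (Ceq_dec (CSeries u) (RtoC 0)) as [E|N].
  - rewrite E, Cmod_0. apply Rle_trans with (Series (fun _ => 0)).
    + right. symmetry. apply is_series_unique.
      apply filterlim_ext with (fun _ => 0); [|apply filterlim_const].
      intros n. rewrite sum_n_const. ring.
    + apply Series_le; [|exact Hu]. intros n. split; [lra|apply Cmod_ge_0].
  - set (S := CSeries u) in *. assert (P : 0 < Cmod S) by now apply Cmod_gt_0.
    set (c := (Cconj S * / Cmod S)%C).
    assert (NS : RtoC (Cmod S) <> RtoC 0).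
    { intros E. apply RtoC_inj in E. lra. }
    assert (Hc : (c * S)%C = RtoC (Cmod S)).
    { unfold c. replace (Cconj S * / Cmod S * S)%C with (S * Cconj S * / Cmod S)%C by ring.
      rewrite <- Cmod2_conj, RtoC_pow. field. exact NS. }
    assert (H1 : Cmod c = 1).
    { apply Rmult_eq_reg_r with (Cmod S); [|lra].
      rewrite <- Cmod_mult, Hc, Cmod_R, Rabs_pos_eq; lra. }
    replace (Cmod S) with (Re (c * S)%C) by now rewrite Hc.
    unfold S. rewrite <- CSeries_scal by exact Hu. unfold CSeries; simpl.
    eapply Rle_trans; [apply Rle_abs|].
    assert (B : forall n, Rabs (Re (c * u n)%C) <= Cmod (u n)).
    { intros n. eapply Rle_trans; [apply re_le_Cmod|]. rewrite Cmod_mult, H1. lra. }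
    eapply Rle_trans; [apply Series_Rabs|].
    + apply (ex_series_le (fun n => Rabs (Re (c * u n)%C)) (fun n => Cmod (u n))); [|exact Hu].
      intros n. change (Rabs (Rabs (Re (c * u n)%C)) <= Cmod (u n)). rewrite Rabs_Rabsolu. apply B.
    + apply Series_le; [|exact Hu]. intros n. split; [apply Rabs_pos|apply B].
Qed.

Lemma Cmod_CSeries_le (u : nat -> C) (v : nat -> R) :
  (forall n, Cmod (u n) <= v n) -> ex_series v -> Cmod (CSeries u) <= Series v.
Proof.
  intros H Hv. eapply Rle_trans; [apply Cmod_CSeries|].
  - now apply abs_summable_le with v.
  - apply Series_le; [|exact Hv]. intros n. split; [apply Cmod_ge_0|apply H].
Qed.

Lemma ex_series_geom_scal (M s : R) : 0 <= s < 1 -> ex_series (fun n => M * s ^ n).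
Proof.
  intros H. apply (ex_series_scal M (fun n => s ^ n)). apply ex_series_geom.
  rewrite Rabs_pos_eq; lra.
Qed.

Lemma Series_geom_scal (M s : R) : 0 <= s < 1 -> Series (fun n => M * s ^ n) = M / (1 - s).
Proof.
  intros H. rewrite Series_scal_l, Series_geom; [reflexivity|]. rewrite Rabs_pos_eq; lra.
Qed.

Lemma CSeries_even_odd (u : nat -> C) :
  abs_summable (fun n => u (2 * n)%nat) -> abs_summable (fun n => u (2 * n + 1)%nat) ->
  CSeries u = (CSeries (fun n => u (2 * n)%nat) + CSeries (fun n => u (2 * n + 1)%nat))%C.
Proof.
  assert (K : forall a : nat -> R,
    ex_series (fun n => a (2 * n)%nat) -> ex_series (fun n => a (2 * n + 1)%nat) ->
    Series a = Series (fun n => a (2 * n)%nat) + Series (fun n => a (2 * n + 1)%nat)).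
  { intros a H1 H2. apply Series_correct in H1. apply Series_correct in H2.
    apply is_series_unique.
    (* At the point 1 a power series is the series of its coefficients, so splitting power series by
       parity applies. *)
    assert (P : forall (b : nat -> R) (l : R), is_series b l -> is_pseries b 1 l).
    { intros b l. apply is_series_ext. intros n. rewrite pow_n_pow, pow1.
      change (b n = 1 * b n). ring. }
    assert (Q : forall (b : nat -> R) (l : R), is_pseries b 1 l -> is_series b l).
    { intros b l. apply is_series_ext. intros n. rewrite pow_n_pow, pow1.
      change (1 * b n = b n). ring. }
    apply Q.
    replace (Series (fun n => a (2 * n + 1)%nat)) with (1 * Series (fun n => a (2 * n + 1)%nat)) by ring.
    apply is_pseries_odd_even; rewrite pow1; now apply P. }
  intros H1 H2. unfold CSeries, Cplus; simpl. f_equal; apply K.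
  - exact (ex_series_Re _ H1).
  - exact (ex_series_Re _ H2).
  - exact (ex_series_Im _ H1).
  - exact (ex_series_Im _ H2).
Qed.

(** Bernoulli's inequality for [(1 / t)^k = (1 + x)^k] gives [k * t^k <= 1 / x]. *)
Lemma nat_geom_bounded (t : R) : 0 < t < 1 -> exists B, 0 < B /\ forall k, (1 + INR k) * t ^ k <= B.
Proof.
  intros Ht. set (x := / t - 1).
  assert (T : 1 < / t) by (rewrite <- Rinv_1; apply Rinv_lt_contravar; lra).
  assert (Hx : 0 < x) by (unfold x; lra).
  exists (1 + / x). assert (Px : 0 < / x) by now apply Rinv_0_lt_compat.
  split; [lra|]. intros k.
  assert (H := poly k x Hx).
  assert (E : (1 + x) ^ k = / t ^ k) by (unfold x; rewrite <- pow_inv; f_equal; ring).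
  rewrite E in H. assert (P : 0 < t ^ k) by (apply pow_lt; lra).
  assert (H2 : (1 + INR k * x) * t ^ k <= 1).
  { apply Rle_trans with (/ t ^ k * t ^ k); [apply Rmult_le_compat_r; lra|].
    right. field. lra. }
  assert (P1 : t ^ k <= 1).
  { rewrite <- (pow1 k). apply pow_incr. lra. }
  assert (H3 : INR k * t ^ k <= / x).
  { apply Rmult_le_reg_r with x; [exact Hx|]. rewrite Rinv_l by lra. nra. }
  lra.
Qed.

(* Series [sum a n z^(k n)] whose terms are bounded on every disc of radius
   below [r]; [k n = n] gives power series and [k n = n^2] theta series. *)
Definition lac_bounded (a : nat -> C) (k : nat -> nat) (r : R) : Prop :=
  forall s, 0 <= s < r -> exists M, forall n, Cmod (a n) * s ^ k n <= M.

(** The factor [(1 + k n)^2] pays for two differentiations. An intermediate radius [r1] leaves the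
    ratio [t = rho / r1 <= s^3]: two of the factors [s^m] absorb the square of [1 + m], and the
    third becomes geometric in [n] through [n <= k n + 2]. *)
Lemma lac_dominated (a : nat -> C) (k : nat -> nat) (r rho : R) :
  lac_bounded a k r -> (forall n, (n <= k n + 2)%nat) -> 0 <= rho < r ->
  exists M s, 0 <= M /\ 0 < s < 1 /\
    forall n, Cmod (a n) * (1 + INR (k n)) ^ 2 * rho ^ k n <= M * s ^ n.
Proof.
  intros Hb Hk Hr. set (r1 := (rho + r) / 2).
  destruct (Hb r1) as [M HM]; [unfold r1; lra|].
  set (t := rho / r1).
  assert (R1 : 0 < r1) by (unfold r1; lra).
  assert (Ht : 0 <= t < 1).
  { unfold t. split.
    - apply Rdiv_le_0_compat; lra.
    - apply Rmult_lt_reg_r with r1; [lra|]. unfold Rdiv. rewrite Rmult_assoc, Rinv_l by lra.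
      unfold r1; lra. }
  (* With [u = (1 - t) / 3], this makes [s^3 = (1 - u)^3 >= 1 - 3 u = t]. *)
  set (s := 1 - (1 - t) / 3).
  assert (Hs : 0 < s < 1) by (unfold s; lra).
  assert (Hts : t <= s ^ 3).
  { unfold s. set (u := (1 - t) / 3). replace t with (1 - 3 * u) by (unfold u; field).
    assert (0 <= u <= 1) by (unfold u; lra).
    replace ((1 - u) ^ 3) with (1 - 3 * u + u ^ 2 * (3 - u)) by ring.
    pose proof (pow2_ge_0 u). nra. }
  destruct (nat_geom_bounded s Hs) as [B [PB HB]].
  assert (PM : 0 <= M).
  { eapply Rle_trans; [|apply (HM 0%nat)]. apply Rmult_le_pos; [apply Cmod_ge_0|apply pow_le; lra]. }
  exists (M * (B * B) * (/ s ^ 2)), s. split; [|split; [exact Hs|]].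
  - repeat apply Rmult_le_pos; try lra. left. apply Rinv_0_lt_compat, pow_lt; lra.
  - intros n. set (m := k n).
    assert (E : rho ^ m = t ^ m * r1 ^ m).
    { rewrite <- Rpow_mult_distr. f_equal. unfold t. field. lra. }
    assert (Hm : t ^ m <= s ^ m * s ^ m * s ^ m).
    { apply Rle_trans with ((s ^ 3) ^ m); [apply pow_incr; lra|].
      right. rewrite <- !Rpow_mult_distr. f_equal. ring. }
    specialize (HM n). fold m in HM. specialize (HB m).
    assert (P0 : 0 <= Cmod (a n) * r1 ^ m).
    { apply Rmult_le_pos; [apply Cmod_ge_0|apply pow_le; lra]. }
    assert (Q0 : 0 <= (1 + INR m) * s ^ m).
    { apply Rmult_le_pos; [pose proof (pos_INR m); lra|apply pow_le; lra]. }
    assert (Z : s ^ m <= / s ^ 2 * s ^ n).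
    { apply Rmult_le_reg_l with (s ^ 2); [apply pow_lt; lra|].
      rewrite <- Rmult_assoc, Rinv_r, Rmult_1_l by (apply pow_nonzero; lra).
      rewrite <- pow_add.
      assert (G : forall i j, (i <= j)%nat -> s ^ j <= s ^ i).
      { intros i j Hij. replace j with (i + (j - i))%nat by lia. rewrite pow_add.
        rewrite <- (Rmult_1_r (s ^ i)) at 2. apply Rmult_le_compat_l; [apply pow_le; lra|].
        rewrite <- (pow1 (j - i)). apply pow_incr. lra. }
      apply G. specialize (Hk n). fold m in Hk. lia. }
    rewrite E.
    apply Rle_trans with ((Cmod (a n) * r1 ^ m) * (((1 + INR m) * s ^ m) * ((1 + INR m) * s ^ m)) * s ^ m).
    + replace (Cmod (a n) * (1 + INR m) ^ 2 * (t ^ m * r1 ^ m))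
        with ((Cmod (a n) * r1 ^ m) * (1 + INR m) ^ 2 * t ^ m) by ring.
      replace ((Cmod (a n) * r1 ^ m) * (((1 + INR m) * s ^ m) * ((1 + INR m) * s ^ m)) * s ^ m)
        with ((Cmod (a n) * r1 ^ m) * (1 + INR m) ^ 2 * (s ^ m * s ^ m * s ^ m)) by ring.
      apply Rmult_le_compat_l; [|exact Hm].
      apply Rmult_le_pos; [exact P0|apply pow2_ge_0].
    + replace (M * (B * B) * / s ^ 2 * s ^ n) with (M * (B * B) * (/ s ^ 2 * s ^ n)) by ring.
      apply Rmult_le_compat; [|apply pow_le; lra| |exact Z].
      * apply Rmult_le_pos; [exact P0|now apply Rmult_le_pos].
      * apply Rmult_le_compat; [exact P0|now apply Rmult_le_pos|exact HM|].
        apply Rmult_le_compat; assumption.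
Qed.

Lemma lac_summable (a : nat -> C) (k : nat -> nat) (r : R) (z : C) :
  lac_bounded a k r -> (forall n, (n <= k n + 2)%nat) -> Cmod z < r ->
  abs_summable (fun n => a n * z ^ k n)%C.
Proof.
  intros Hb Hk Hz.
  destruct (lac_dominated a k r (Cmod z) Hb Hk) as [M [s [PM [Hs H]]]].
  { split; [apply Cmod_ge_0|exact Hz]. }
  apply abs_summable_le with (fun n => M * s ^ n).
  - intros n. rewrite Cmod_mult, Cmod_pow. eapply Rle_trans; [|apply (H n)].
    apply Rmult_le_compat_r; [apply pow_le, Cmod_ge_0|].
    rewrite <- (Rmult_1_r (Cmod (a n))) at 1. apply Rmult_le_compat_l; [apply Cmod_ge_0|].
    pose proof (pos_INR (k n)). nra.
  - apply ex_series_geom_scal; lra.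
Qed.

(** The second order Taylor bound [n^2 rho^(n-2) |z - w|^2], multiplied by [rho^2] so that small [n]
    need no truncated exponent. The induction rests on [E_(n+1) = z E_n + n w^(n-1) (z - w)^2] for
    the remainders. *)
Lemma pow_taylor_bound (z w : C) (rho : R) (n : nat) :
  Cmod z <= rho -> Cmod w <= rho ->
  Cmod (z ^ n - w ^ n - INR n * w ^ Nat.pred n * (z - w))%C * rho ^ 2
    <= INR n ^ 2 * rho ^ n * Cmod (z - w)%C ^ 2.
Proof.
  intros Hz Hw. assert (R0 : 0 <= rho) by (eapply Rle_trans; [apply Cmod_ge_0|exact Hz]).
  set (d := Cmod (z - w)%C). assert (D0 : 0 <= d) by apply Cmod_ge_0.
  induction n as [|n IH].
  - simpl. replace (1 - 1 - 0 * 1 * (z - w))%C with (RtoC 0) by ring. rewrite Cmod_0. lra.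
  - set (E := (z ^ n - w ^ n - INR n * w ^ Nat.pred n * (z - w))%C) in *.
    replace (z ^ S n - w ^ S n - INR (S n) * w ^ Nat.pred (S n) * (z - w))%C
      with (z * E + INR n * w ^ Nat.pred n * ((z - w) * (z - w)))%C.
    2:{ unfold E. rewrite S_INR, RtoC_plus, !Cpow_S. simpl Nat.pred.
        destruct n as [|n]; [simpl; ring|]. simpl Nat.pred. rewrite !Cpow_S. ring. }
    assert (T : Cmod (z * E + INR n * w ^ Nat.pred n * ((z - w) * (z - w)))%C
                <= rho * Cmod E + INR n * Cmod w ^ Nat.pred n * (d * d)).
    { eapply Rle_trans; [apply Cmod_triangle|].
      rewrite !Cmod_mult, Cmod_R, Cmod_pow, (Rabs_pos_eq (INR n)) by apply pos_INR. fold d.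
      apply Rplus_le_compat_r. apply Rmult_le_compat_r; [apply Cmod_ge_0|exact Hz]. }
    assert (W : INR n * Cmod w ^ Nat.pred n * rho ^ 2 <= INR n * rho ^ S n).
    { destruct n as [|n]; [simpl; lra|]. simpl Nat.pred.
      rewrite Rmult_assoc. apply Rmult_le_compat_l; [apply pos_INR|].
      replace (rho ^ S (S n)) with (rho ^ n * rho ^ 2) by (simpl; ring).
      apply Rmult_le_compat_r; [apply pow2_ge_0|].
      apply pow_incr. split; [apply Cmod_ge_0|exact Hw]. }
    apply Rle_trans with ((rho * Cmod E + INR n * Cmod w ^ Nat.pred n * (d * d)) * rho ^ 2).
    + apply Rmult_le_compat_r; [apply pow2_ge_0|exact T].
    + replace ((rho * Cmod E + INR n * Cmod w ^ Nat.pred n * (d * d)) * rho ^ 2)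
        with (rho * (Cmod E * rho ^ 2) + (INR n * Cmod w ^ Nat.pred n * rho ^ 2) * (d * d)) by ring.
      apply Rle_trans with (rho * (INR n ^ 2 * rho ^ n * d ^ 2) + INR n * rho ^ S n * (d * d)).
      * apply Rplus_le_compat.
        -- apply Rmult_le_compat_l; assumption.
        -- apply Rmult_le_compat_r; [nra|exact W].
      * rewrite S_INR. replace (rho * (INR n ^ 2 * rho ^ n * d ^ 2) + INR n * rho ^ S n * (d * d))
          with ((INR n ^ 2 + INR n) * (rho ^ S n * d ^ 2)) by (simpl; ring).
        replace ((INR n + 1) ^ 2 * rho ^ S n * d ^ 2) with ((INR n + 1) ^ 2 * (rho ^ S n * d ^ 2)) by ring.
        apply Rmult_le_compat_r.
        -- apply Rmult_le_pos; [now apply pow_le|now apply pow_le].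
        -- pose proof (pos_INR n). nra.
Qed.

(** Termwise differentiation: the Taylor remainders of the terms add up to at most [K * |z - w|^2],
    which is below [e * |z - w|] as soon as [|z - w| < e / (K + 1)]. *)
Lemma lac_cderiv (a : nat -> C) (k : nat -> nat) (r : R) (w : C) :
  lac_bounded a k r -> (forall n, (n <= k n + 2)%nat) -> Cmod w < r ->
  abs_summable (fun n => a n * INR (k n) * w ^ Nat.pred (k n))%C /\
  cderiv (fun z => CSeries (fun n => a n * z ^ k n)%C) w
         (CSeries (fun n => a n * INR (k n) * w ^ Nat.pred (k n))%C).
Proof.
  intros Hb Hk Hw. set (rho := (Cmod w + r) / 2).
  pose proof (Cmod_ge_0 w) as W0.
  assert (R0 : 0 < rho) by (unfold rho; lra).
  destruct (lac_dominated a k r rho Hb Hk) as [M [s [PM [Hs H]]]]; [unfold rho; lra|].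
  assert (Sd : abs_summable (fun n => a n * INR (k n) * w ^ Nat.pred (k n))%C).
  { apply abs_summable_le with (fun n => (M / rho) * s ^ n).
    - intros n. rewrite !Cmod_mult, Cmod_pow, Cmod_R, (Rabs_pos_eq (INR (k n))) by apply pos_INR.
      apply Rmult_le_reg_r with rho; [exact R0|].
      replace (M / rho * s ^ n * rho) with (M * s ^ n) by (field; lra).
      eapply Rle_trans; [|apply (H n)].
      rewrite !Rmult_assoc. apply Rmult_le_compat_l; [apply Cmod_ge_0|].
      destruct (k n) as [|m]; [simpl; nra|]. simpl Nat.pred.
      apply Rmult_le_compat; [apply pos_INR| | |].
      + apply Rmult_le_pos; [now apply pow_le|lra].
      + pose proof (pos_INR (S m)). nra.
      + simpl. rewrite (Rmult_comm rho). apply Rmult_le_compat_r; [lra|].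
        apply pow_incr. unfold rho. lra.
    - apply ex_series_geom_scal; lra. }
  split; [exact Sd|].
  apply cderiv_of_quotient. intros e He.
  set (K := M / rho ^ 2 / (1 - s)).
  assert (P2 : 0 < rho ^ 2) by (apply pow_lt; lra).
  assert (K0 : 0 <= K).
  { unfold K. apply Rdiv_le_0_compat; [apply Rdiv_le_0_compat|]; lra. }
  exists (Rmin (rho - Cmod w) (e / (K + 1))). split.
  { apply Rmin_pos; [unfold rho; lra|apply Rdiv_lt_0_compat; lra]. }
  intros z Hz. set (d := Cmod (z - w)%C) in *. assert (D0 : 0 <= d) by apply Cmod_ge_0.
  assert (Hz1 : d < rho - Cmod w) by (eapply Rlt_le_trans; [exact Hz|apply Rmin_l]).
  assert (Hz2 : d < e / (K + 1)) by (eapply Rlt_le_trans; [exact Hz|apply Rmin_r]).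
  assert (Zr : Cmod z <= rho).
  { replace z with (w + (z - w))%C by ring. eapply Rle_trans; [apply Cmod_triangle|]. fold d. lra. }
  assert (rr : rho < r) by (unfold rho; lra).
  rewrite <- CSeries_minus by (apply (lac_summable a k r); auto; lra).
  rewrite Cmult_comm, <- CSeries_scal by exact Sd.
  rewrite <- CSeries_minus.
  2:{ apply abs_summable_ext with (fun n => a n * z ^ k n + RtoC (-1) * (a n * w ^ k n))%C;
        [intros; ring|].
      apply abs_summable_plus; [|apply abs_summable_scal]; apply (lac_summable a k r); auto; lra. }
  2:{ now apply abs_summable_scal. }
  apply Rle_trans with (Series (fun n => (M / rho ^ 2 * d ^ 2) * s ^ n)).
  - apply Cmod_CSeries_le; [|apply ex_series_geom_scal; lra].
    intros n.
    replace (a n * z ^ k n - a n * w ^ k n - (z - w) * (a n * INR (k n) * w ^ Nat.pred (k n)))%C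
      with (a n * (z ^ k n - w ^ k n - INR (k n) * w ^ Nat.pred (k n) * (z - w)))%C by ring.
    rewrite Cmod_mult. apply Rmult_le_reg_r with (rho ^ 2); [exact P2|].
    rewrite Rmult_assoc.
    apply Rle_trans with (Cmod (a n) * (INR (k n) ^ 2 * rho ^ k n * d ^ 2)).
    + apply Rmult_le_compat_l; [apply Cmod_ge_0|]. apply pow_taylor_bound; lra.
    + replace (M / rho ^ 2 * d ^ 2 * s ^ n * rho ^ 2) with (M * s ^ n * d ^ 2) by (field; lra).
      replace (Cmod (a n) * (INR (k n) ^ 2 * rho ^ k n * d ^ 2))
        with (Cmod (a n) * INR (k n) ^ 2 * rho ^ k n * d ^ 2) by ring.
      apply Rmult_le_compat_r; [apply pow2_ge_0|]. eapply Rle_trans; [|apply (H n)].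
      apply Rmult_le_compat_r; [apply pow_le; lra|].
      apply Rmult_le_compat_l; [apply Cmod_ge_0|]. pose proof (pos_INR (k n)). nra.
  - rewrite Series_geom_scal by lra.
    replace (M / rho ^ 2 * d ^ 2 / (1 - s)) with (K * d * d) by (unfold K; field; lra).
    apply Rmult_le_compat_r; [exact D0|].
    apply Rle_trans with ((K + 1) * (e / (K + 1))).
    + apply Rmult_le_compat; lra.
    + right. field. lra.
Qed.

(** * Power series and their derivatives *)

Definition PS (a : nat -> C) (z : C) : C := CSeries (fun n => a n * z ^ n)%C.

Definition rad (a : nat -> C) (r : R) : Prop := lac_bounded a (fun n => n) r.

Definition dcoef (a : nat -> C) (n : nat) : C := (INR (S n) * a (S n))%C.

Lemma PS_summable (a : nat -> C) (r : R) (z : C) :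
  rad a r -> Cmod z < r -> abs_summable (fun n => a n * z ^ n)%C.
Proof. intros H Hz. apply (lac_summable a (fun n => n) r); auto; lia. Qed.

Lemma PS_cderiv (a : nat -> C) (r : R) (z : C) :
  rad a r -> Cmod z < r -> cderiv (PS a) z (PS (dcoef a) z).
Proof.
  intros H Hz.
  destruct (lac_cderiv a (fun n => n) r z H ltac:(intros; lia) Hz) as [S D].
  eapply cderiv_eq; [exact D|]. rewrite CSeries_incr by exact S. simpl Nat.pred. simpl INR at 1.
  replace (PS (dcoef a) z) with (RtoC 0 + PS (dcoef a) z)%C by ring.
  apply f_equal2; [ring|]. apply CSeries_ext. intros n. unfold dcoef. simpl Nat.pred. ring.
Qed.

Lemma rad_dcoef (a : nat -> C) (r : R) : rad a r -> rad (dcoef a) r.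
Proof.
  intros H s Hs. set (rho := (s + r) / 2).
  destruct (lac_dominated a (fun n => n) r rho H ltac:(intros; lia)) as [M [t [PM [Ht K]]]].
  { unfold rho; lra. }
  exists (M / rho). intros n. unfold dcoef. rewrite Cmod_mult, Cmod_R, Rabs_pos_eq by apply pos_INR.
  assert (R0 : 0 < rho) by (unfold rho; lra).
  apply Rmult_le_reg_r with rho; [exact R0|].
  replace (M / rho * rho) with M by (field; lra).
  apply Rle_trans with (M * t ^ S n).
  - eapply Rle_trans; [|apply (K (S n))].
    replace (INR (S n) * Cmod (a (S n)) * s ^ n * rho)
      with (Cmod (a (S n)) * INR (S n) * (s ^ n * rho)) by ring.
    apply Rmult_le_compat.
    + apply Rmult_le_pos; [apply Cmod_ge_0|apply pos_INR].
    + apply Rmult_le_pos; [apply pow_le|]; lra.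
    + apply Rmult_le_compat_l; [apply Cmod_ge_0|]. pose proof (pos_INR (S n)). nra.
    + rewrite <- tech_pow_Rmult, Rmult_comm. apply Rmult_le_compat_l; [lra|].
      apply pow_incr. unfold rho; lra.
  - rewrite <- (Rmult_1_r M) at 2. apply Rmult_le_compat_l; [exact PM|].
    rewrite <- (pow1 (S n)). apply pow_incr. lra.
Qed.

Lemma PS_0 (a : nat -> C) : PS a (RtoC 0) = a 0%nat.
Proof.
  assert (S : abs_summable (fun n => a n * RtoC 0 ^ n)%C).
  { apply abs_summable_incr. apply abs_summable_le with (fun _ => 0).
    - intros n. rewrite Cpow_S. replace (a (S n) * (0 * 0 ^ n))%C with (RtoC 0) by ring.
      rewrite Cmod_0. lra.
    - exists 0. apply filterlim_ext with (fun _ => 0); [|apply filterlim_const].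
      intros n. rewrite sum_n_const. ring. }
  unfold PS. rewrite CSeries_incr by exact S. rewrite CSeries_0; [simpl; ring|].
  intros n. rewrite Cpow_S. ring.
Qed.

(** * Goursat's theorem *)

Definition rcont (f : R -> C) (x : R) : Prop :=
  forall eps, 0 < eps -> exists d, 0 < d /\
    forall y, Rabs (y - x) < d -> Cmod (f y - f x)%C < eps.

Definition rcont_on (f : R -> C) (a b : R) : Prop := forall x, a <= x <= b -> rcont f x.

Definition CInt (f : R -> C) (a b : R) : C :=
  (RInt (fun x => Re (f x)) a b, RInt (fun x => Im (f x)) a b).

Lemma rcont_continuous (g : C -> R) (f : R -> C) (x : R) :
  (forall a b, Rabs (g a - g b) <= Cmod (a - b)%C) -> rcont f x ->
  continuous (fun t => g (f t)) x.
Proof.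
  intros Hg H. apply filterlim_locally. intros e.
  destruct (H e (cond_pos e)) as [d [D K]]. exists (mkposreal d D). intros y Hy.
  change (Rabs (g (f y) - g (f x)) < e).
  eapply Rle_lt_trans; [apply Hg|]. apply K. exact Hy.
Qed.

Lemma Re_lip (a b : C) : Rabs (Re a - Re b) <= Cmod (a - b)%C.
Proof. apply (re_le_Cmod (a - b)%C). Qed.

Lemma Im_lip (a b : C) : Rabs (Im a - Im b) <= Cmod (a - b)%C.
Proof. apply (im_le_Cmod (a - b)%C). Qed.

Lemma Cmod_lip (a b : C) : Rabs (Cmod a - Cmod b) <= Cmod (a - b)%C.
Proof.
  apply Rabs_le. split.
  - assert (T := Cmod_triangle_inv b (a - b)%C).
    replace (b + (a - b))%C with a in T by ring. lra.
  - assert (T := Cmod_triangle b (a - b)%C). replace (b + (a - b))%C with a in T by ring. lra.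
Qed.

Lemma ex_RInt_Re (f : R -> C) (a b : R) :
  a <= b -> rcont_on f a b -> ex_RInt (fun x => Re (f x)) a b.
Proof.
  intros Hab H. apply (@ex_RInt_continuous R_CompleteNormedModule). intros z.
  rewrite Rmin_left, Rmax_right by exact Hab. intros Hz.
  apply rcont_continuous; [apply Re_lip|now apply H].
Qed.

Lemma ex_RInt_Im (f : R -> C) (a b : R) :
  a <= b -> rcont_on f a b -> ex_RInt (fun x => Im (f x)) a b.
Proof.
  intros Hab H. apply (@ex_RInt_continuous R_CompleteNormedModule). intros z.
  rewrite Rmin_left, Rmax_right by exact Hab. intros Hz.
  apply rcont_continuous; [apply Im_lip|now apply H].
Qed.

Lemma rcont_ext (f g : R -> C) (x : R) : (forall t, f t = g t) -> rcont f x -> rcont g x.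
Proof.
  intros E H e He. destruct (H e He) as [d [D K]]. exists d. split; [exact D|].
  intros y Hy. rewrite <- !E. now apply K.
Qed.

Lemma rcont_comp (F : C -> C) (g : R -> C) (x : R) :
  rcont g x -> ccont F (g x) -> rcont (fun t => F (g t)) x.
Proof.
  intros Hg Hf e He. destruct (Hf e He) as [d [D K]].
  destruct (Hg d D) as [d' [D' K']]. exists d'. split; [exact D'|].
  intros w Hw. apply K, K', Hw.
Qed.

Lemma rcont_RtoC (x : R) : rcont RtoC x.
Proof.
  intros e He. exists e. split; [exact He|]. intros y Hy.
  rewrite <- RtoC_minus, Cmod_R. exact Hy.
Qed.

Lemma rcont_horiz (F : C -> C) (x y : R) : ccont F (x, y) -> rcont (fun t => F (t, y)) x.
Proof.
  intros H. apply (rcont_comp F (fun t => (t, y))); [|exact H].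
  intros e He. exists e. split; [exact He|]. intros t Ht.
  replace ((t, y) - (x, y))%C with (RtoC (t - x)); [now rewrite Cmod_R|].
  apply injective_projections; simpl; ring.
Qed.

Lemma rcont_vert (F : C -> C) (x y : R) : ccont F (x, y) -> rcont (fun t => F (x, t)) y.
Proof.
  intros H. apply (rcont_comp F (fun t => (x, t))); [|exact H].
  intros e He. exists e. split; [exact He|]. intros t Ht.
  replace ((x, t) - (x, y))%C with (Ci * RtoC (t - y))%C.
  - now rewrite Cmod_mult, Cmod_Ci, Cmod_R, Rmult_1_l.
  - apply injective_projections; simpl; ring.
Qed.

Lemma rcont_const (c : C) (x : R) : rcont (fun _ => c) x.
Proof. apply (rcont_comp (fun _ => c) RtoC); [apply rcont_RtoC|apply ccont_const]. Qed.

Lemma rcont_plus (f g : R -> C) (x : R) :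
  rcont f x -> rcont g x -> rcont (fun t => f t + g t)%C x.
Proof.
  intros Hf Hg e He.
  destruct (Hf (e / 2)) as [d1 [D1 K1]]; [lra|].
  destruct (Hg (e / 2)) as [d2 [D2 K2]]; [lra|].
  exists (Rmin d1 d2). split; [now apply Rmin_pos|]. intros w Hw.
  specialize (K1 w (Rlt_le_trans _ _ _ Hw (Rmin_l _ _))).
  specialize (K2 w (Rlt_le_trans _ _ _ Hw (Rmin_r _ _))).
  replace (f w + g w - (f x + g x))%C with ((f w - f x) + (g w - g x))%C by ring.
  eapply Rle_lt_trans; [apply Cmod_triangle|]. lra.
Qed.

Lemma rcont_scal (c : C) (f : R -> C) (x : R) : rcont f x -> rcont (fun t => c * f t)%C x.
Proof.
  intros H. apply (rcont_comp (fun z => c * z)%C f); [exact H|].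
  apply ccont_mult; [apply ccont_const|apply ccont_id].
Qed.

Lemma CInt_ext (f g : R -> C) (a b : R) :
  a <= b -> (forall x, a <= x <= b -> f x = g x) -> CInt f a b = CInt g a b.
Proof.
  intros Hab E. unfold CInt. f_equal; apply RInt_ext; intros x;
    rewrite Rmin_left, Rmax_right by exact Hab; intros Hx; rewrite E; auto; lra.
Qed.

Lemma CInt_plus (f g : R -> C) (a b : R) :
  a <= b -> rcont_on f a b -> rcont_on g a b ->
  CInt (fun x => f x + g x)%C a b = (CInt f a b + CInt g a b)%C.
Proof.
  intros Hab Hf Hg. unfold CInt, Cplus; simpl. f_equal.
  - apply (RInt_plus (fun x => Re (f x)) (fun x => Re (g x))); now apply ex_RInt_Re.
  - apply (RInt_plus (fun x => Im (f x)) (fun x => Im (g x))); now apply ex_RInt_Im.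
Qed.

Lemma CInt_scal (c : C) (f : R -> C) (a b : R) :
  a <= b -> rcont_on f a b -> CInt (fun x => c * f x)%C a b = (c * CInt f a b)%C.
Proof.
  intros Hab Hf. pose proof (ex_RInt_Re f a b Hab Hf) as H1.
  pose proof (ex_RInt_Im f a b Hab Hf) as H2.
  assert (S1 := fun k => ex_RInt_scal (fun x => Re (f x)) a b k H1).
  assert (S2 := fun k => ex_RInt_scal (fun x => Im (f x)) a b k H2).
  assert (R1 : forall k g, ex_RInt g a b -> RInt (fun x => k * g x) a b = k * RInt g a b).
  { intros k g Hg. exact (RInt_scal g a b k Hg). }
  apply injective_projections.
  - change (RInt (fun x => fst c * Re (f x) - snd c * Im (f x)) a b =
            fst c * RInt (fun x => Re (f x)) a b - snd c * RInt (fun x => Im (f x)) a b).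
    rewrite <- !R1 by assumption. exact (RInt_minus _ _ a b (S1 (fst c)) (S2 (snd c))).
  - change (RInt (fun x => fst c * Im (f x) + snd c * Re (f x)) a b =
            fst c * RInt (fun x => Im (f x)) a b + snd c * RInt (fun x => Re (f x)) a b).
    rewrite <- !R1 by assumption. exact (RInt_plus _ _ a b (S2 (fst c)) (S1 (snd c))).
Qed.

Lemma CInt_Chasles (f : R -> C) (a b c : R) :
  a <= b -> b <= c -> rcont_on f a c -> (CInt f a b + CInt f b c)%C = CInt f a c.
Proof.
  intros Hab Hbc H.
  assert (H1 : rcont_on f a b) by (intros x Hx; apply H; lra).
  assert (H2 : rcont_on f b c) by (intros x Hx; apply H; lra).
  unfold CInt, Cplus; simpl. f_equal.
  - apply (RInt_Chasles (fun x => Re (f x))); now apply ex_RInt_Re.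
  - apply (RInt_Chasles (fun x => Im (f x))); now apply ex_RInt_Im.
Qed.

Lemma CInt_shift (f : R -> C) (a b v : R) :
  a <= b -> rcont_on f (a + v) (b + v) ->
  CInt (fun x => f (x + v)) a b = CInt f (a + v) (b + v).
Proof.
  intros Hab H.
  assert (K : forall g : R -> R, ex_RInt g (a + v) (b + v) ->
    RInt (fun x => g (x + v)) a b = RInt g (a + v) (b + v)).
  { intros g Hg.
    assert (L := RInt_comp_lin g 1 v a b).
    replace (1 * a + v) with (a + v) in L by ring. replace (1 * b + v) with (b + v) in L by ring.
    rewrite <- (L Hg). apply RInt_ext. intros x _.
    change (g (x + v) = 1 * g (1 * x + v)). rewrite !Rmult_1_l. reflexivity. }
  unfold CInt. f_equal.
  - apply (K (fun x => Re (f x))). apply ex_RInt_Re; [lra|exact H].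
  - apply (K (fun x => Im (f x))). apply ex_RInt_Im; [lra|exact H].
Qed.

(** The factor 2 arises because real and imaginary parts are estimated separately; Goursat's
    argument tolerates any constant. *)
Lemma CInt_bound (f : R -> C) (a b M : R) :
  a <= b -> rcont_on f a b -> (forall x, a <= x <= b -> Cmod (f x) <= M) ->
  Cmod (CInt f a b) <= 2 * M * (b - a).
Proof.
  intros Hab H HM.
  assert (K : forall g : R -> R, ex_RInt g a b -> (forall x, a <= x <= b -> Rabs (g x) <= M) ->
    Rabs (RInt g a b) <= M * (b - a)).
  { intros g Hg Hb. rewrite Rmult_comm. apply abs_RInt_le_const; assumption. }
  eapply Rle_trans; [apply Cmod_le_abs|]. unfold CInt; simpl.
  assert (K1 := K _ (ex_RInt_Re f a b Hab H)). assert (K2 := K _ (ex_RInt_Im f a b Hab H)).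
  assert (L1 : Rabs (RInt (fun x => Re (f x)) a b) <= M * (b - a)).
  { apply K1. intros x Hx. eapply Rle_trans; [apply re_le_Cmod|now apply HM]. }
  assert (L2 : Rabs (RInt (fun x => Im (f x)) a b) <= M * (b - a)).
  { apply K2. intros x Hx. eapply Rle_trans; [apply im_le_Cmod|now apply HM]. }
  lra.
Qed.

(** The contour integral taken counterclockwise around the rectangle with lower left corner
    [(x, y)], width [w] and height [h]. *)
Definition rect_int (F : C -> C) (x y w h : R) : C :=
  ((CInt (fun t => F (t, y)) x (x + w) - CInt (fun t => F (t, (y + h)%R)) x (x + w)) +
   Ci * (CInt (fun t => F ((x + w)%R, t)) y (y + h) - CInt (fun t => F (x, t)) y (y + h)))%C.

Definition rect_cont (F : C -> C) (x y w h : R) : Prop :=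
  forall u v, x <= u <= x + w -> y <= v <= y + h -> ccont F (u, v).

Lemma rect_int_split (F : C -> C) (x y w h : R) :
  0 <= w -> 0 <= h -> rect_cont F x y (2 * w) (2 * h) ->
  rect_int F x y (2 * w) (2 * h) =
  (rect_int F x y w h + rect_int F (x + w) y w h +
   (rect_int F x (y + h) w h + rect_int F (x + w) (y + h) w h))%C.
Proof.
  intros Hw Hh HF. unfold rect_int.
  replace (x + 2 * w) with (x + w + w) by ring. replace (y + 2 * h) with (y + h + h) by ring.
  assert (Hx : forall v, y <= v <= y + 2 * h ->
    CInt (fun t => F (t, v)) x (x + w + w) =
    (CInt (fun t => F (t, v)) x (x + w) + CInt (fun t => F (t, v)) (x + w) (x + w + w))%C).
  { intros v Hv. symmetry. apply CInt_Chasles; try lra.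
    intros t Ht. apply rcont_horiz, HF; lra. }
  assert (Hy : forall u, x <= u <= x + 2 * w ->
    CInt (fun t => F (u, t)) y (y + h + h) =
    (CInt (fun t => F (u, t)) y (y + h) + CInt (fun t => F (u, t)) (y + h) (y + h + h))%C).
  { intros v Hv. symmetry. apply CInt_Chasles; try lra.
    intros t Ht. apply rcont_vert, HF; lra. }
  rewrite !Hx, !Hy by lra. ring.
Qed.

Lemma rect_int_plus (F G : C -> C) (x y w h : R) :
  0 <= w -> 0 <= h -> rect_cont F x y w h -> rect_cont G x y w h ->
  rect_int (fun z => F z + G z)%C x y w h = (rect_int F x y w h + rect_int G x y w h)%C.
Proof.
  intros Hw Hh HF HG. unfold rect_int.
  rewrite !CInt_plus; try lra;
    try (intros t Ht; first [apply rcont_horiz|apply rcont_vert]; first [apply HF|apply HG]; lra).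
  ring.
Qed.

Lemma rect_int_scal (c : C) (F : C -> C) (x y w h : R) :
  0 <= w -> 0 <= h -> rect_cont F x y w h ->
  rect_int (fun z => c * F z)%C x y w h = (c * rect_int F x y w h)%C.
Proof.
  intros Hw Hh HF. unfold rect_int.
  rewrite !CInt_scal; try lra;
    try (intros t Ht; first [apply rcont_horiz|apply rcont_vert]; apply HF; lra).
  ring.
Qed.

Lemma rect_int_bound (F : C -> C) (x y w h M : R) :
  0 <= w -> 0 <= h -> rect_cont F x y w h ->
  (forall u v, x <= u <= x + w -> y <= v <= y + h -> Cmod (F (u, v)) <= M) ->
  Cmod (rect_int F x y w h) <= 4 * M * (w + h).
Proof.
  intros Hw Hh HF HM. unfold rect_int.
  assert (B1 : Cmod (CInt (fun t => F (t, y)) x (x + w)) <= 2 * M * w).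
  { replace w with (x + w - x) at 2 by ring. apply CInt_bound; [lra| |].
    - intros t Ht. apply rcont_horiz, HF; lra.
    - intros t Ht. apply HM; lra. }
  assert (B2 : Cmod (CInt (fun t => F (t, (y + h)%R)) x (x + w)) <= 2 * M * w).
  { replace w with (x + w - x) at 2 by ring. apply CInt_bound; [lra| |].
    - intros t Ht. apply rcont_horiz, HF; lra.
    - intros t Ht. apply HM; lra. }
  assert (B3 : Cmod (CInt (fun t => F ((x + w)%R, t)) y (y + h)) <= 2 * M * h).
  { replace h with (y + h - y) at 2 by ring. apply CInt_bound; [lra| |].
    - intros t Ht. apply rcont_vert, HF; lra.
    - intros t Ht. apply HM; lra. }
  assert (B4 : Cmod (CInt (fun t => F (x, t)) y (y + h)) <= 2 * M * h).
  { replace h with (y + h - y) at 2 by ring. apply CInt_bound; [lra| |].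
    - intros t Ht. apply rcont_vert, HF; lra.
    - intros t Ht. apply HM; lra. }
  eapply Rle_trans; [apply Cmod_triangle|]. rewrite Cmod_mult, Cmod_Ci, Rmult_1_l.
  eapply Rle_trans; [apply Rplus_le_compat; apply Cmod_minus_le|]. lra.
Qed.

(** For a constant, opposite sides are literally the same integral, so they cancel formally. *)
Lemma rect_int_const (c : C) (x y w h : R) : rect_int (fun _ => c) x y w h = RtoC 0.
Proof. unfold rect_int. ring. Qed.

Lemma rect_int_id (x y w h : R) : rect_int (fun z => z) x y w h = RtoC 0.
Proof.
  assert (Q : forall a b, RInt (fun t => t) a b = (b * b - a * a) / 2).
  { intros a b. apply is_RInt_unique.
    replace ((b * b - a * a) / 2) with (minus (b * b / 2) (a * a / 2)).
    2:{ change (b * b / 2 - a * a / 2 = (b * b - a * a) / 2). field. }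
    apply (is_RInt_derive (fun t => t * t / 2) (fun t => t)).
    - intros t _. auto_derive; [exact I|field].
    - intros t _. apply continuous_id. }
  unfold rect_int, CInt; simpl. rewrite !RInt_const, !Q.
  apply injective_projections; simpl; unfold scal; simpl; unfold mult; simpl; field.
Qed.

(* A predicate on the dyadic subrectangles of a rectangle that is inherited
   from the four quarters and holds near every point holds for the rectangle:
   otherwise nested counterexamples shrink to a point. *)
Lemma dyadic_rect_induction (x0 y0 w h : R) (P : R -> R -> nat -> Prop) :
  0 <= w -> 0 <= h ->
  (forall x y n,
     x0 <= x -> x + w / 2 ^ n <= x0 + w -> y0 <= y -> y + h / 2 ^ n <= y0 + h ->
     let w' := w / 2 ^ S n in let h' := h / 2 ^ S n in
     P x y (S n) -> P (x + w') y (S n) -> P x (y + h') (S n) -> P (x + w') (y + h') (S n) ->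
     P x y n) ->
  (forall u v, x0 <= u <= x0 + w -> y0 <= v <= y0 + h ->
     exists N, forall n x y, (N <= n)%nat ->
       x0 <= x -> x + w / 2 ^ n <= x0 + w -> y0 <= y -> y + h / 2 ^ n <= y0 + h ->
       x <= u <= x + w / 2 ^ n -> y <= v <= y + h / 2 ^ n -> P x y n) ->
  P x0 y0 0%nat.
Proof.
  intros Hw Hh Hsplit Hloc. apply NNPP. intros H0.
  set (dec := fun A : Prop => excluded_middle_informative A).
  (* The sequence passes to the first quarter that violates [P]. When the first three satisfy it,
     the fourth is taken unchecked; [Hsplit] then shows that it must fail (in [Neg]). *)
  set (s := fix s n := match n with
    | O => (x0, y0)
    | S m => let p := s m in
             let x := fst p in let y := snd p in
             let w' := w / 2 ^ S m in let h' := h / 2 ^ S m in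
             if dec (P x y (S m)) then
               if dec (P (x + w') y (S m)) then
                 if dec (P x (y + h') (S m)) then (x + w', y + h') else (x, y + h')
               else (x + w', y)
             else (x, y)
    end).
  assert (P2 : forall n, 0 < 2 ^ n) by (intros n; apply pow_lt; lra).
  assert (Dw : forall n, w / 2 ^ n = 2 * (w / 2 ^ S n)).
  { intros n. simpl. field. specialize (P2 n). lra. }
  assert (Dh : forall n, h / 2 ^ n = 2 * (h / 2 ^ S n)).
  { intros n. simpl. field. specialize (P2 n). lra. }
  assert (Nw : forall n, 0 <= w / 2 ^ n) by (intros n; apply Rdiv_le_0_compat; auto).
  assert (Nh : forall n, 0 <= h / 2 ^ n) by (intros n; apply Rdiv_le_0_compat; auto).
  assert (Step : forall n,
    fst (s n) <= fst (s (S n)) /\ fst (s (S n)) + w / 2 ^ S n <= fst (s n) + w / 2 ^ n /\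
    snd (s n) <= snd (s (S n)) /\ snd (s (S n)) + h / 2 ^ S n <= snd (s n) + h / 2 ^ n).
  { intros n. rewrite (Dw n), (Dh n). pose proof (Nw (S n)). pose proof (Nh (S n)).
    change (s (S n)) with (let p := s n in
             let x := fst p in let y := snd p in
             let w' := w / 2 ^ S n in let h' := h / 2 ^ S n in
             if dec (P x y (S n)) then
               if dec (P (x + w') y (S n)) then
                 if dec (P x (y + h') (S n)) then (x + w', y + h') else (x, y + h')
               else (x + w', y)
             else (x, y)).
    cbv zeta. set (a := w / 2 ^ S n) in *. set (b := h / 2 ^ S n) in *.
    repeat match goal with |- context [dec ?c] => destruct (dec c) end;
      cbn [fst snd]; lra. }
  assert (Mono : forall n m, (n <= m)%nat ->
    fst (s n) <= fst (s m) /\ fst (s m) + w / 2 ^ m <= fst (s n) + w / 2 ^ n /\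
    snd (s n) <= snd (s m) /\ snd (s m) + h / 2 ^ m <= snd (s n) + h / 2 ^ n).
  { intros n m Hnm. induction Hnm as [|m Hnm IH]; [lra|]. specialize (Step m). lra. }
  assert (In0 : forall n, x0 <= fst (s n) /\ fst (s n) + w / 2 ^ n <= x0 + w /\
                          y0 <= snd (s n) /\ snd (s n) + h / 2 ^ n <= y0 + h).
  { intros n. pose proof (Mono 0%nat n ltac:(lia)) as M. simpl in M.
    replace (w / 1) with w in M by field. replace (h / 1) with h in M by field. exact M. }
  assert (Neg : forall n, ~ P (fst (s n)) (snd (s n)) n).
  { intros n. induction n as [|n IH]; [exact H0|]. intros HP. apply IH.
    destruct (In0 n) as [I1 [I2 [I3 I4]]].
    change (s (S n)) with (let p := s n in
             let x := fst p in let y := snd p in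
             let w' := w / 2 ^ S n in let h' := h / 2 ^ S n in
             if dec (P x y (S n)) then
               if dec (P (x + w') y (S n)) then
                 if dec (P x (y + h') (S n)) then (x + w', y + h') else (x, y + h')
               else (x + w', y)
             else (x, y)) in HP. cbv zeta in HP.
    repeat match type of HP with context [dec ?c] => destruct (dec c) end;
      cbn [fst snd] in HP; try tauto.
    now apply (Hsplit _ _ n I1 I2 I3 I4). }
  (* Nested intervals: the supremum of the left ends lies in all of them. *)
  assert (Lim : forall (c : nat -> R) (e : nat -> R),
    (forall n m, (n <= m)%nat -> c n <= c m /\ c m + e m <= c n + e n) ->
    (forall n, 0 <= e n) -> exists u, forall n, c n <= u <= c n + e n).
  { intros c e Hce He.
    assert (Ub : forall n m, c n <= c m + e m).
    { intros n m. destruct (Nat.le_ge_cases n m) as [L|L]; specialize (Hce _ _ L);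
        pose proof (He n); pose proof (He m); lra. }
    destruct (completeness (fun r => exists n, r = c n)) as [u [U1 U2]].
    - exists (c 0%nat + e 0%nat). intros r [n ->]. apply Ub.
    - exists (c 0%nat). now exists 0%nat.
    - exists u. intros n. split; [apply U1; now exists n|].
      apply U2. intros r [m ->]. apply Ub. }
  destruct (Lim (fun n => fst (s n)) (fun n => w / 2 ^ n)) as [u Hu];
    [intros n m L; specialize (Mono n m L); lra|exact Nw|].
  destruct (Lim (fun n => snd (s n)) (fun n => h / 2 ^ n)) as [v Hv];
    [intros n m L; specialize (Mono n m L); lra|exact Nh|].
  destruct (Hloc u v) as [N HN].
  - specialize (Hu 0%nat). simpl in Hu. replace (w / 1) with w in Hu by field. exact Hu.
  - specialize (Hv 0%nat). simpl in Hv. replace (h / 1) with h in Hv by field. exact Hv.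
  - apply (Neg N). destruct (In0 N) as [I1 [I2 [I3 I4]]]. apply HN; auto.
Qed.

Lemma half_pow_small (a d : R) : 0 <= a -> 0 < d -> exists N, forall n, (N <= n)%nat -> a / 2 ^ n < d.
Proof.
  intros Ha Hd. destruct (nfloor_ex (a / d)) as [N HN]; [now apply Rdiv_le_0_compat|].
  exists (S N). intros n Hn.
  assert (P : 0 < 2 ^ n) by (apply pow_lt; lra).
  apply Rmult_lt_reg_r with (2 ^ n); [exact P|].
  unfold Rdiv. rewrite Rmult_assoc, Rinv_l, Rmult_1_r by lra.
  assert (B : INR n <= 2 ^ n).
  { clear. induction n as [|n IH]; [simpl; lra|]. rewrite S_INR. simpl.
    assert (1 <= 2 ^ n) by (apply pow_R1_Rle; lra). lra. }
  assert (C : INR (S N) <= INR n) by now apply le_INR. rewrite S_INR in C.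
  assert (D : a / d * d < (INR N + 1) * d) by (apply Rmult_lt_compat_r; lra).
  unfold Rdiv in D. rewrite Rmult_assoc, Rinv_l, Rmult_1_r in D by lra. nra.
Qed.

(** On a small subrectangle [F] differs from an affine function by at most [e * (w' + h')]. The
    affine part integrates to 0, and the boundary length contributes another factor [w' + h'], so
    the integral is of the order of [e] times the area scale, which survives adding up four
    quarters. *)
Lemma goursat (F : C -> C) (x y w h : R) :
  0 <= w -> 0 <= h ->
  (forall u v, x <= u <= x + w -> y <= v <= y + h -> exists l, cderiv F (u, v) l) ->
  rect_int F x y w h = RtoC 0.
Proof.
  intros Hw Hh HF.
  assert (HC : rect_cont F x y w h).
  { intros u v Hu Hv. destruct (HF u v Hu Hv) as [l Hl]. now apply cderiv_ccont in Hl. }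
  apply Cmod_eq_0. apply Rle_antisym; [|apply Cmod_ge_0].
  apply le_epsilon. intros eps Heps. rewrite Rplus_0_l.
  set (K := (w + h) ^ 2). assert (K0 : 0 <= K) by apply pow2_ge_0.
  set (e := eps / (4 * K + 1)). assert (E0 : 0 < e) by (apply Rdiv_lt_0_compat; lra).
  apply Rle_trans with (4 * e * K).
  2:{ unfold e. replace (4 * (eps / (4 * K + 1)) * K) with (eps * (4 * K / (4 * K + 1))) by (field; lra).
      rewrite <- (Rmult_1_r eps) at 2. apply Rmult_le_compat_l; [lra|].
      apply Rmult_le_reg_r with (4 * K + 1); [lra|].
      unfold Rdiv. rewrite Rmult_assoc, Rinv_l by lra. lra. }
  assert (P2 : forall n, 0 < 2 ^ n) by (intros n; apply pow_lt; lra).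
  (* Dividing by [4 ^ n] makes the bound additive: four quarters at level [n + 1] give exactly the
     bound at level [n]. *)
  pose (P := fun (a b : R) (n : nat) =>
    Cmod (rect_int F a b (w / 2 ^ n) (h / 2 ^ n)) <= 4 * e * K / 4 ^ n).
  assert (Goal0 : P x y 0%nat).
  2:{ unfold P in Goal0. simpl in Goal0.
      replace (w / 1) with w in Goal0 by field. replace (h / 1) with h in Goal0 by field. lra. }
  apply (dyadic_rect_induction x y w h P Hw Hh).
  - intros a b n A1 A2 B1 B2 w' h' Q1 Q2 Q3 Q4. unfold P in *. fold w' h' in Q1, Q2, Q3, Q4.
    assert (Ew : w / 2 ^ n = 2 * w') by (unfold w'; simpl; field; specialize (P2 n); lra).
    assert (Eh : h / 2 ^ n = 2 * h') by (unfold h'; simpl; field; specialize (P2 n); lra).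
    rewrite Ew in *. rewrite Eh in *.
    assert (W0 : 0 <= w') by (apply Rdiv_le_0_compat; auto).
    assert (H0 : 0 <= h') by (apply Rdiv_le_0_compat; auto).
    rewrite rect_int_split; auto.
    2:{ intros u v Hu Hv. apply HC; lra. }
    replace (4 * e * K / 4 ^ n) with (4 * (4 * e * K / 4 ^ S n)).
    2:{ simpl. field. apply pow_nonzero. lra. }
    eapply Rle_trans; [apply Cmod_triangle|].
    eapply Rle_trans; [apply Rplus_le_compat; apply Cmod_triangle|]. lra.
  - intros u v Hu Hv. destruct (HF u v Hu Hv) as [l Hl].
    destruct (cderiv_quotient F (u, v) l Hl e E0) as [d [D Hd]].
    destruct (half_pow_small (w + h) d) as [N HN]; [lra|exact D|].
    exists N. intros n a b Hn A1 A2 B1 B2 Ua Vb. unfold P.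
    set (w' := w / 2 ^ n) in *. set (h' := h / 2 ^ n) in *.
    assert (W0 : 0 <= w') by (apply Rdiv_le_0_compat; auto).
    assert (H0 : 0 <= h') by (apply Rdiv_le_0_compat; auto).
    assert (Sd : w' + h' < d).
    { specialize (HN n Hn). unfold w', h'. lra. }
    assert (HC' : rect_cont F a b w' h').
    { intros p q Hp Hq. apply HC; lra. }
    (* The tangent function of [F] at the limit point; [F - A] is the remainder controlled by
       [Hd]. *)
    pose (A := fun z : C => (l * z + (F (u, v) - l * (u, v)))%C).
    assert (CA : forall z, ccont A z).
    { intros z. unfold A. apply ccont_plus; [|apply ccont_const].
      apply ccont_mult; [apply ccont_const|apply ccont_id]. }
    assert (CE : rect_cont (fun z => (F z + RtoC (-1) * A z)%C) a b w' h').
    { intros p q Hp Hq. apply ccont_plus; [now apply HC'|].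
      apply ccont_mult; [apply ccont_const|apply CA]. }
    assert (IA : rect_int A a b w' h' = RtoC 0).
    { unfold A. rewrite rect_int_plus; auto.
      - rewrite rect_int_scal; auto; [rewrite rect_int_id, rect_int_const; ring|].
        intros p q _ _. apply ccont_id.
      - intros p q _ _. apply ccont_mult; [apply ccont_const|apply ccont_id].
      - intros p q _ _. apply ccont_const. }
    assert (IE : rect_int F a b w' h' = rect_int (fun z => (F z + RtoC (-1) * A z)%C) a b w' h').
    { rewrite rect_int_plus, rect_int_scal, IA; auto; [ring|..].
      - intros p q _ _. apply CA.
      - intros p q _ _. apply ccont_mult; [apply ccont_const|apply CA]. }
    rewrite IE.
    replace (4 * e * K / 4 ^ n) with (4 * (e * (w' + h')) * (w' + h')).
    2:{ unfold w', h', K. replace (4 ^ n) with (2 ^ n * 2 ^ n).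
        - field. specialize (P2 n). lra.
        - rewrite <- Rpow_mult_distr. replace (2 * 2) with 4 by ring. reflexivity. }
    apply rect_int_bound; auto.
    intros p q Hp Hq.
    assert (Dist : Cmod ((p, q) - (u, v))%C <= w' + h').
    { eapply Rle_trans; [apply Cmod_le_abs|]. simpl.
      apply Rplus_le_compat; apply Rabs_le; lra. }
    replace (F (p, q) + RtoC (-1) * A (p, q))%C
      with (F (p, q) - F (u, v) - l * ((p, q) - (u, v)))%C by (unfold A; ring).
    eapply Rle_trans; [apply Hd; lra|]. apply Rmult_le_compat_l; lra.
Qed.

(** In the rectangle of width 1 between the two heights, the vertical sides cancel by
    periodicity. *)
Lemma periodic_line_int (E : C -> C) (c d : R) :
  c <= d ->
  (forall z, c <= Im z <= d -> exists l, cderiv E z l) ->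
  (forall z, E (z + 1)%C = E z) ->
  CInt (fun t => E (t, c)) 0 1 = CInt (fun t => E (t, d)) 0 1.
Proof.
  intros Hcd HE Hp.
  assert (G : rect_int E 0 c 1 (d - c) = RtoC 0).
  { apply goursat; try lra. intros u v Hu Hv. apply HE. simpl. lra. }
  unfold rect_int in G. replace (c + (d - c)) with d in G by ring.
  replace (0 + 1) with 1 in G by ring.
  rewrite (CInt_ext (fun t => E (1, t)) (fun t => E (0, t)) c d) in G; [|lra|].
  - apply Cminus_eq_0. rewrite <- G. ring.
  - intros t _. rewrite <- (Hp (0, t)). f_equal. apply injective_projections; simpl; ring.
Qed.

(** * Fourier uniqueness and the identity theorem *)

Definition cis (n : Z) (z : C) : C := Cexp (2 * PI * Ci * IZR n * z)%C.

Lemma cis_plus_r (n : Z) (z w : C) : cis n (z + w)%C = (cis n z * cis n w)%C.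
Proof. unfold cis. rewrite <- Cexp_plus. apply f_equal; ring. Qed.

Lemma cis_plus_l (n m : Z) (z : C) : cis (n + m) z = (cis n z * cis m z)%C.
Proof. unfold cis. rewrite <- Cexp_plus, plus_IZR, RtoC_plus. apply f_equal; ring. Qed.

Lemma cis_0 (z : C) : cis 0 z = RtoC 1.
Proof. unfold cis. rewrite <- Cexp_0. apply f_equal; ring. Qed.

Lemma cis_at_0 (n : Z) : cis n (RtoC 0) = RtoC 1.
Proof. unfold cis. rewrite <- Cexp_0. apply f_equal; ring. Qed.

Lemma cis_nz (n : Z) (z : C) : cis n z <> RtoC 0.
Proof. apply Cexp_nz. Qed.

Lemma cis_R (n : Z) (t : R) :
  cis n t = (cos (2 * PI * IZR n * t), sin (2 * PI * IZR n * t)).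
Proof.
  unfold cis, Cexp.
  replace (2 * PI * Ci * IZR n * t)%C with (0, 2 * PI * IZR n * t).
  2:{ apply injective_projections; simpl; ring. }
  simpl. rewrite exp_0. apply injective_projections; simpl; ring.
Qed.

Lemma cis_at_1 (n : Z) : cis n (RtoC 1) = RtoC 1.
Proof.
  rewrite cis_R. rewrite Rmult_1_r.
  assert (H : forall k : nat, cos (2 * PI * INR k) = 1 /\ sin (2 * PI * INR k) = 0).
  { intros k. replace (2 * PI * INR k) with (0 + 2 * INR k * PI) by ring.
    rewrite cos_period, sin_period, cos_0, sin_0. now split. }
  destruct (Z.le_gt_cases 0 n) as [Hn|Hn].
  - rewrite <- (Z2Nat.id n Hn), <- INR_IZR_INZ. destruct (H (Z.to_nat n)) as [-> ->]. reflexivity.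
  - replace n with (- Z.of_nat (Z.to_nat (- n)))%Z by lia.
    rewrite opp_IZR, <- INR_IZR_INZ.
    replace (2 * PI * - INR (Z.to_nat (- n))) with (- (2 * PI * INR (Z.to_nat (- n)))) by ring.
    rewrite cos_neg, sin_neg. destruct (H (Z.to_nat (- n))) as [-> ->].
    unfold RtoC. f_equal. ring.
Qed.

Lemma cis_period (n : Z) (z : C) : cis n (z + 1)%C = cis n z.
Proof. rewrite cis_plus_r, cis_at_1. ring. Qed.

Lemma cderiv_cis (n : Z) (z : C) : cderiv (cis n) z (cis n z * (2 * PI * Ci * IZR n))%C.
Proof.
  unfold cis. apply (cderiv_comp Cexp (fun z => 2 * PI * Ci * IZR n * z)%C).
  - eapply cderiv_eq; [apply cderiv_scal, cderiv_id|ring].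
  - apply cderiv_Cexp.
Qed.

Lemma rcont_ccont (F : C -> C) (x : R) : ccont F (RtoC x) -> rcont (fun t => F (RtoC t)) x.
Proof. intros H. apply (rcont_comp F RtoC); [apply rcont_RtoC|exact H]. Qed.

(** Extending a function [h] of a real variable to [z -> h (Re z)] reduces this to products of
    functions on [C]. *)
Lemma rcont_mult (f g : R -> C) (x : R) :
  rcont f x -> rcont g x -> rcont (fun t => f t * g t)%C x.
Proof.
  intros Hf Hg.
  assert (Q : forall (F G : C -> C), ccont F (RtoC x) -> ccont G (RtoC x) ->
            rcont (fun t => F t * G t)%C x).
  { intros F G HF HG. apply (rcont_ccont (fun z => F z * G z)%C). now apply ccont_mult. }
  assert (L : forall h : R -> C, rcont h x -> ccont (fun z => h (Re z)) (RtoC x)).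
  { intros h Hh e He. destruct (Hh e He) as [d [D K]]. exists d. split; [exact D|].
    intros w Hw. apply K. eapply Rle_lt_trans; [apply (Re_lip w (RtoC x))|exact Hw]. }
  exact (Q _ _ (L f Hf) (L g Hg)).
Qed.

Lemma rcont_cis (n : Z) (x : R) : rcont (fun t => cis n (RtoC t)) x.
Proof. apply rcont_ccont. eapply cderiv_ccont, cderiv_cis. Qed.

(** This is [cos^2 (pi (t - x))], which equals 1 exactly for [t - x] an integer. Its powers are
    trigonometric polynomials that concentrate at [x]. *)
Definition bump (x t : R) : R := (1 + cos (2 * PI * (t - x))) / 2.

Lemma bump_cis (x t : R) :
  RtoC (bump x t) =
  (RtoC (1 / 2) + RtoC (1 / 4) * (cis 1 (RtoC (- x)) * cis 1 t + cis (-1) (RtoC (- x)) * cis (-1) t))%C.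
Proof.
  rewrite <- !cis_plus_r, <- RtoC_plus, !cis_R. unfold bump.
  replace (2 * PI * 1 * (- x + t)) with (2 * PI * (t - x)) by ring.
  replace (2 * PI * -1 * (- x + t)) with (- (2 * PI * (t - x))) by ring.
  rewrite cos_neg, sin_neg. apply injective_projections; simpl; field.
Qed.

(** Multiplication by [bump] mixes the frequencies [n - 1], [n] and [n + 1], so functions with
    vanishing coefficients are preserved. *)
Lemma bump_fourier (u : R -> C) (x : R) (N : nat) :
  (forall t, rcont u t) -> (forall n, CInt (fun t => u t * cis n t)%C 0 1 = RtoC 0) ->
  forall n, CInt (fun t => RtoC (bump x t ^ N) * (u t * cis n t))%C 0 1 = RtoC 0 /\
            (forall s, rcont (fun t => RtoC (bump x t ^ N) * (u t * cis n t))%C s).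
Proof.
  intros Hu H. induction N as [|N IH]; intros n.
  - split.
    + rewrite <- (H n). apply CInt_ext; [lra|]. intros t _. simpl. ring.
    + intros s. apply rcont_ext with (fun t => u t * cis n t)%C; [intros t; simpl; ring|].
      apply rcont_mult; [apply Hu|apply rcont_cis].
  - pose (g := fun m t => (RtoC (bump x t ^ N) * (u t * cis m t))%C).
    assert (E : forall t, (RtoC (bump x t ^ S N) * (u t * cis n t))%C =
      (RtoC (1 / 2) * g n t + (RtoC (1 / 4) * cis 1 (RtoC (- x)) * g (n + 1)%Z t +
         RtoC (1 / 4) * cis (-1) (RtoC (- x)) * g (n + -1)%Z t))%C).
    { intros t. unfold g. rewrite <- tech_pow_Rmult, RtoC_mult, bump_cis, !cis_plus_l. ring. }
    assert (Cg : forall m s, rcont (g m) s) by (intros m s; apply IH).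
    assert (Ig : forall m, CInt (g m) 0 1 = RtoC 0) by (intros m; apply IH).
    split.
    + rewrite (CInt_ext _ _ 0 1 ltac:(lra) (fun t _ => E t)).
      rewrite CInt_plus; [|lra| |].
      * rewrite CInt_plus; [|lra| |].
        -- rewrite !CInt_scal, !Ig; try lra; try (intros s _; apply Cg). ring.
        -- intros s _. apply rcont_scal, Cg.
        -- intros s _. apply rcont_scal, Cg.
      * intros s _. apply rcont_scal, Cg.
      * intros s _. apply rcont_plus; apply rcont_scal, Cg.
    + intros s. eapply rcont_ext; [intros t; symmetry; apply E|].
      apply rcont_plus; [apply rcont_scal, Cg|apply rcont_plus; apply rcont_scal, Cg].
Qed.

Lemma bump_range (x t : R) : 0 <= bump x t <= 1.
Proof. unfold bump. pose proof (COS_bound (2 * PI * (t - x))). lra. Qed.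

Lemma bump_near (x t d : R) : 0 < d <= 1 / 4 -> Rabs (t - x) <= d ->
  (1 + cos (2 * PI * d)) / 2 <= bump x t.
Proof.
  intros Hd Ht. unfold bump. pose proof PI_RGT_0.
  assert (E : cos (2 * PI * (t - x)) = cos (2 * PI * Rabs (t - x))).
  { unfold Rabs. destruct (Rcase_abs (t - x)); [|reflexivity].
    rewrite <- cos_neg. f_equal. ring. }
  rewrite E. pose proof (Rabs_pos (t - x)).
  destruct Ht as [Ht|Ht]; [|rewrite Ht; lra].
  assert (cos (2 * PI * d) < cos (2 * PI * Rabs (t - x))).
  { apply cos_decreasing_1; nra. }
  lra.
Qed.

Lemma bump_far (x t d : R) : 0 < d <= 1 / 4 -> d <= Rabs (t - x) <= 1 - d ->
  bump x t <= (1 + cos (2 * PI * d)) / 2.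
Proof.
  intros Hd Ht. unfold bump. pose proof PI_RGT_0.
  assert (E : cos (2 * PI * (t - x)) = cos (2 * PI * Rabs (t - x))).
  { unfold Rabs. destruct (Rcase_abs (t - x)); [|reflexivity].
    rewrite <- cos_neg. f_equal. ring. }
  rewrite E. set (s := Rabs (t - x)) in *.
  assert (cos (2 * PI * s) <= cos (2 * PI * d)).
  { destruct (Rle_lt_dec s (1 / 2)) as [L|L].
    - destruct (proj1 Ht) as [Q|Q]; [|rewrite Q; lra].
      left. apply cos_decreasing_1; nra.
    - replace (cos (2 * PI * s)) with (cos (2 * PI * (1 - s))).
      + destruct (Req_dec (1 - s) d) as [Q|Q]; [rewrite Q; lra|].
        left. apply cos_decreasing_1; nra.
      + replace (2 * PI * (1 - s)) with (- (2 * PI * s) + 2 * INR 1 * PI) by (simpl; ring).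
        rewrite cos_period. apply cos_neg. }
  lra.
Qed.

Lemma RInt_ge_const (g : R -> R) (a b m : R) :
  a <= b -> ex_RInt g a b -> (forall t, a < t < b -> m <= g t) -> m * (b - a) <= RInt g a b.
Proof.
  intros Hab Hg H.
  assert (E : RInt (fun _ => m) a b = (b - a) * m) by (rewrite RInt_const; reflexivity).
  rewrite Rmult_comm, <- E. apply RInt_le; auto. apply ex_RInt_const.
Qed.

(** If [u x] were not 0, the integral of [bump^N * u], which is 0, would receive near [x] a
    contribution of order [k1^N], whereas the rest can only oppose it by order [k2^N] with
    [k2 < k1]. *)
Lemma fourier_unique (u : R -> C) (x : R) :
  (forall t, rcont u t) -> (forall n, CInt (fun t => u t * cis n t)%C 0 1 = RtoC 0) ->
  0 < x < 1 -> u x = RtoC 0.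
Proof.
  intros Hu H Hx. apply NNPP. intros Nz.
  set (c := Cmod (u x) ^ 2).
  assert (Pc : 0 < c) by (apply pow_lt; now apply Cmod_gt_0).
  (* Rotation makes the value at [x] the positive number [|u x|^2], and the comparison can be made
     with real integrals. *)
  pose (v := fun t => Re (Cconj (u x) * u t)%C).
  assert (Vx : v x = c).
  { unfold v, c. rewrite Cmult_comm, <- Cmod2_conj. now rewrite Cmod2_alt. }
  assert (Cv : forall t, rcont (fun t => Cconj (u x) * u t)%C t).
  { intros t. apply rcont_scal, Hu. }
  assert (Vc : forall t, continuous v t).
  { intros t. apply (rcont_continuous Re (fun t => Cconj (u x) * u t)%C); [apply Re_lip|apply Cv]. }
  assert (Kc : forall N t, continuous (fun t => bump x t ^ N * v t) t).
  { intros N t. apply (continuous_mult (fun t => bump x t ^ N) v); [|apply Vc].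
    apply (@ex_derive_continuous R_AbsRing R_NormedModule). unfold bump. auto_derive. exact I. }
  assert (KI : forall N a b, ex_RInt (fun t => bump x t ^ N * v t) a b).
  { intros N a b. apply (@ex_RInt_continuous R_CompleteNormedModule). intros z _. apply Kc. }
  assert (I0 : forall N, RInt (fun t => bump x t ^ N * v t) 0 1 = 0).
  { intros N. destruct (bump_fourier u x N Hu H 0%Z) as [Z Z'].
    assert (Q : CInt (fun t => Cconj (u x) * (RtoC (bump x t ^ N) * (u t * cis 0 t)))%C 0 1 = RtoC 0).
    { rewrite CInt_scal, Z; [ring|lra|]. intros s _. apply Z'. }
    apply (f_equal Re) in Q.
    change (RInt (fun t => Re (Cconj (u x) * (RtoC (bump x t ^ N) * (u t * cis 0 t)))%C) 0 1 = 0) in Q.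
    etransitivity; [|exact Q]. apply RInt_ext. intros t _.
    rewrite cis_0. unfold v. simpl. ring. }
  destruct (continuity_ab_maj (fun t => Rabs (v t)) 0 1) as [tm [Hm _]]; [lra| |].
  { intros t _. apply continuity_pt_filterlim.
    apply (continuous_comp v Rabs); [apply Vc|apply continuous_Rabs]. }
  set (M := Rabs (v tm)) in *. simpl in Hm.
  assert (M0 : 0 <= M) by apply Rabs_pos.
  assert (Hv : exists d, 0 < d /\ forall t, Rabs (t - x) < d -> c / 2 <= v t).
  { assert (B := proj1 (filterlim_locally v (v x)) (Vc x) (mkposreal (c / 2) ltac:(lra))).
    destruct B as [d B]. exists d. split; [apply cond_pos|]. intros t Ht.
    specialize (B t Ht). change (Rabs (v t - v x) < c / 2) in B.
    rewrite Vx in B. apply Rabs_def2 in B. lra. }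
  destruct Hv as [d0 [D0 Hd0]].
  (* The last two bounds keep every [t] in [[0, 1]] at distance at most [1 - d] from [x], away from
     the next peak of the periodic [bump]; [d0 / 2] keeps [v >= c / 2] on the window. *)
  set (d := Rmin (Rmin (1 / 4) (d0 / 2)) (Rmin (x / 2) ((1 - x) / 2))).
  assert (Dp : 0 < d) by (repeat apply Rmin_pos; lra).
  assert (D1 : d <= 1 / 4) by (eapply Rle_trans; [apply Rmin_l|apply Rmin_l]).
  assert (D2 : d <= d0 / 2) by (eapply Rle_trans; [apply Rmin_l|apply Rmin_r]).
  assert (D3 : d <= x / 2) by (eapply Rle_trans; [apply Rmin_r|apply Rmin_l]).
  assert (D4 : d <= (1 - x) / 2) by (eapply Rle_trans; [apply Rmin_r|apply Rmin_r]).
  set (k1 := (1 + cos (2 * PI * (d / 2))) / 2).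
  set (k2 := (1 + cos (2 * PI * d)) / 2).
  pose proof PI_RGT_0 as PP.
  assert (K12 : k2 < k1).
  { unfold k1, k2. assert (cos (2 * PI * d) < cos (2 * PI * (d / 2))).
    { apply cos_decreasing_1; nra. } lra. }
  assert (K2 : 0 < k2).
  { unfold k2. assert (0 <= cos (2 * PI * d)); [|lra].
    apply cos_ge_0; nra. }
  assert (Low : forall N t, 0 <= t <= 1 -> - (M * k2 ^ N) <= bump x t ^ N * v t).
  { intros N t Ht. pose proof (bump_range x t) as Br.
    assert (Bp : 0 <= bump x t ^ N) by (apply pow_le; lra).
    assert (Kp : 0 <= k2 ^ N) by (apply pow_le; lra).
    destruct (Rlt_le_dec (Rabs (t - x)) d) as [L|L].
    - assert (0 <= v t). { specialize (Hd0 t ltac:(lra)). lra. }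
      nra.
    - assert (U : bump x t <= k2).
      { apply bump_far; [lra|]. split; [exact L|]. apply Rabs_le. lra. }
      assert (Up : bump x t ^ N <= k2 ^ N) by (apply pow_incr; lra).
      specialize (Hm t Ht).
      assert (V : - M <= v t). { pose proof (Rabs_def2). revert Hm. unfold Rabs.
        destruct (Rcase_abs (v t)); lra. }
      nra. }
  (* The half window [d / 2] gives the larger constant [k1] near [x], while [Low] bounds the
     integrand from below on the two outer intervals. *)
  assert (Main : forall N, d * (c / 2) * k1 ^ N <= 2 * M * k2 ^ N).
  { intros N.
    assert (A1 : (- (M * k2 ^ N)) * (x - d / 2 - 0) <= RInt (fun t => bump x t ^ N * v t) 0 (x - d / 2)).
    { apply RInt_ge_const; [lra|apply KI|]. intros t Ht. apply Low. lra. }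
    assert (A2 : (- (M * k2 ^ N)) * (1 - (x + d / 2)) <= RInt (fun t => bump x t ^ N * v t) (x + d / 2) 1).
    { apply RInt_ge_const; [lra|apply KI|]. intros t Ht. apply Low. lra. }
    assert (A3 : (k1 ^ N * (c / 2)) * (x + d / 2 - (x - d / 2))
                 <= RInt (fun t => bump x t ^ N * v t) (x - d / 2) (x + d / 2)).
    { apply RInt_ge_const; [lra|apply KI|]. intros t Ht.
      assert (Ha : Rabs (t - x) <= d / 2) by (apply Rabs_le; lra).
      apply Rmult_le_compat.
      - apply pow_le. lra.
      - lra.
      - apply pow_incr. split; [lra|]. apply bump_near; [lra|exact Ha].
      - apply Hd0. lra. }
    assert (S1 := RInt_Chasles _ _ _ _ (KI N 0 (x - d / 2)) (KI N (x - d / 2) (x + d / 2))).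
    assert (S2 := RInt_Chasles _ _ _ _ (KI N 0 (x + d / 2)) (KI N (x + d / 2) 1)).
    rewrite I0 in S2. rewrite <- S1 in S2.
    match type of S2 with plus (plus ?p ?q) ?r = _ => change (p + q + r = 0) in S2 end.
    assert (Kp : 0 <= M * k2 ^ N) by (apply Rmult_le_pos; [exact M0|apply pow_le; lra]).
    nra. }
  (* By Bernoulli, [(1 + y)^N = (k1 / k2)^N] is unbounded, which contradicts [Main]. *)
  set (y := k1 / k2 - 1).
  assert (Y : 0 < y).
  { unfold y. apply Rlt_0_minus. apply Rmult_lt_reg_r with k2; [exact K2|].
    unfold Rdiv. rewrite Rmult_assoc, Rinv_l by lra. lra. }
  destruct (nfloor_ex (2 * M / (d * (c / 2)) / y)) as [N [_ HN]].
  { assert (0 < d * (c / 2)) by nra.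
    apply Rdiv_le_0_compat; [apply Rdiv_le_0_compat; lra|exact Y]. }
  specialize (Main (S N)). assert (Ber := poly (S N) y Y). rewrite S_INR in Ber.
  assert (Dc : 0 < d * (c / 2)) by nra.
  assert (Kp : 0 < k2 ^ S N) by (apply pow_lt; lra).
  assert (E : (1 + y) ^ S N * k2 ^ S N = k1 ^ S N).
  { rewrite <- Rpow_mult_distr. f_equal. unfold y. field. lra. }
  rewrite <- E in Main.
  assert (B1 : d * (c / 2) * (1 + y) ^ S N <= 2 * M).
  { apply Rmult_le_reg_r with (k2 ^ S N); [exact Kp|]. lra. }
  assert (B2 : 2 * M < (INR N + 1) * y * (d * (c / 2))).
  { apply Rmult_lt_reg_r with (/ (d * (c / 2)) * / y).
    - apply Rmult_lt_0_compat; now apply Rinv_0_lt_compat.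
    - replace ((INR N + 1) * y * (d * (c / 2)) * (/ (d * (c / 2)) * / y)) with (INR N + 1) by (field; split; lra).
      unfold Rdiv at 1 in HN. unfold Rdiv in HN |- *. lra. }
  nra.
Qed.

Lemma periodic_Z (E : C -> C) : (forall z, E (z + 1)%C = E z) -> forall (n : Z) z, E (z + IZR n)%C = E z.
Proof.
  intros Hp.
  assert (Pn : forall (n : nat) z, E (z + INR n)%C = E z).
  { intros n. induction n as [|n IH]; intros z.
    - simpl. f_equal. ring.
    - rewrite S_INR, RtoC_plus, Cplus_assoc, Hp. apply IH. }
  intros n z. destruct (Z.le_gt_cases 0 n) as [Hn|Hn].
  - rewrite <- (Z2Nat.id n Hn), <- INR_IZR_INZ. apply Pn.
  - rewrite <- (Pn (Z.to_nat (- n)) (z + IZR n)%C). f_equal.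
    rewrite INR_IZR_INZ, Z2Nat.id by lia. rewrite opp_IZR, RtoC_opp. ring.
Qed.

(** Moving the line of integration up to height [y] multiplies the integrals by the nonzero numbers
    [cis n (0, y)], so all coefficients on that line vanish too. *)
Lemma entire_periodic_0 (E : C -> C) :
  (forall z, exists l, cderiv E z l) -> (forall z, E (z + 1)%C = E z) ->
  (forall n, CInt (fun t => E t * cis n t)%C 0 1 = RtoC 0) ->
  forall x y, 0 <= y -> E (x, y) = RtoC 0.
Proof.
  intros HE Hp H x y Hy.
  assert (CE : forall z, ccont E z).
  { intros z. destruct (HE z) as [l Hl]. now apply cderiv_ccont in Hl. }
  assert (Z0 : forall t, 0 < t < 1 -> E (t, y) = RtoC 0).
  { intros t Ht. apply (fourier_unique (fun t => E (t, y)) t); [| |exact Ht].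
    - intros s. apply rcont_horiz, CE.
    - intros n.
      assert (Q := periodic_line_int (fun z => E z * cis n z)%C 0 y Hy).
      cbv beta in Q. rewrite (CInt_ext (fun t => E (t, 0) * cis n (t, 0))%C (fun t => E t * cis n t)%C) in Q;
        [|lra|reflexivity].
      rewrite H in Q.
      assert (L : CInt (fun t => E (t, y) * cis n (t, y))%C 0 1 =
                  (cis n (0, y) * CInt (fun t => E (t, y) * cis n t)%C 0 1)%C).
      { rewrite <- CInt_scal; [|lra|].
        - apply CInt_ext; [lra|]. intros t' _.
          replace (cis n (t', y)) with (cis n (0, y) * cis n t')%C; [ring|].
          rewrite <- cis_plus_r. f_equal. apply injective_projections; simpl; ring.
        - intros s _. apply rcont_mult; [apply rcont_horiz, CE|apply rcont_cis]. }
      rewrite L in Q.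
      assert (Q' : RtoC 0 = (cis n (0, y) * CInt (fun t => E (t, y) * cis n t)%C 0 1)%C).
      { apply Q.
        - intros z _. destruct (HE z) as [l Hl]. eexists. apply cderiv_mult; [exact Hl|apply cderiv_cis].
        - intros z. now rewrite Hp, cis_period. }
      apply NNPP. intros Nz. apply (Cmult_neq_0 _ _ (cis_nz n (0, y)) Nz). now symmetry. }
  (* [fourier_unique] covers the open interval; the end point follows by continuity and all other
     points by periodicity. *)
  assert (Z1 : forall t, 0 <= t < 1 -> E (t, y) = RtoC 0).
  { intros t Ht. destruct (Req_dec t 0) as [->|N]; [|apply Z0; lra].
    apply NNPP. intros Nz.
    destruct (ccont_nonzero E (0, y) (CE _) Nz) as [d [D K]].
    set (s := Rmin (d / 2) (1 / 2)). assert (S0 : 0 < s) by (apply Rmin_pos; lra).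
    assert (S1 : s <= d / 2) by apply Rmin_l. assert (S2 : s <= 1 / 2) by apply Rmin_r.
    specialize (K (s, y)). rewrite (Z0 s) in K by lra. rewrite Cmod_0 in K.
    assert (P := proj1 (Cmod_gt_0 _) Nz).
    replace ((s, y) - (0, y))%C with (RtoC s) in K.
    2:{ apply injective_projections; simpl; ring. }
    rewrite Cmod_R, Rabs_pos_eq in K by lra. specialize (K ltac:(lra)). lra. }
  destruct (base_fp x) as [F1 F2]. unfold frac_part in *.
  rewrite <- (Z1 (x - IZR (Int_part x))) by lra.
  rewrite <- (periodic_Z E Hp (Int_part x) (x - IZR (Int_part x), y)). f_equal.
  apply injective_projections; simpl; ring.
Qed.

(** The function [E w = f (c - (z - c) exp(2 pi i w))] is 1-periodic, and raising [w] shrinks the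
    circle towards [c]. High up [E] vanishes, hence so do its coefficients on the real line and [E]
    itself on the open unit interval. The sign makes [w = 1/2], an interior point, correspond to
    [z]. *)
Lemma disc_identity (f : C -> C) (c : C) (r0 r : R) :
  0 < r0 -> (forall z, Cmod (z - c)%C < r -> exists l, cderiv f z l) ->
  (forall z, Cmod (z - c)%C < r0 -> f z = RtoC 0) ->
  forall z, Cmod (z - c)%C < r -> f z = RtoC 0.
Proof.
  intros Hr0 Hf Hz z Hr.
  set (m := Cmod (z - c)%C) in *.
  destruct (Rlt_le_dec m r0) as [L|L]; [now apply Hz|].
  assert (M0 : 0 < m) by lra.
  pose (E := fun w => f (c + (- (z - c)) * cis 1 w)%C).
  assert (Mod : forall w, Cmod (c + (- (z - c)) * cis 1 w - c)%C = m * exp (- (2 * PI * Im w))).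
  { intros w. replace (c + - (z - c) * cis 1 w - c)%C with (- (z - c) * cis 1 w)%C by ring.
    rewrite Cmod_mult, Cmod_opp. fold m. unfold cis. rewrite Cmod_Cexp. apply f_equal, f_equal.
    destruct w as [w1 w2]. simpl. ring. }
  pose proof PI_RGT_0 as PP.
  assert (DE : forall w, 0 <= Im w -> exists l, cderiv E w l).
  { intros w Hw. destruct (Hf (c + (- (z - c)) * cis 1 w)%C) as [l Hl].
    - rewrite Mod. apply Rle_lt_trans with (m * 1); [|lra].
      apply Rmult_le_compat_l; [lra|]. rewrite <- exp_0.
      destruct (Req_dec (Im w) 0) as [->|N]; [rewrite Rmult_0_r, Ropp_0; lra|].
      left. apply exp_increasing. nra.
    - eexists. unfold E. apply (cderiv_comp f (fun w => c + (- (z - c)) * cis 1 w)%C); [|exact Hl].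
      apply cderiv_plus; [apply cderiv_const|]. apply cderiv_scal, cderiv_cis. }
  assert (PE : forall w, E (w + 1)%C = E w).
  { intros w. unfold E. now rewrite cis_period. }
  (* At this height the circle has radius [m exp(-2 pi Y) <= m / (1 + 2 pi Y) < r0]. *)
  set (Y := m / r0).
  assert (HY : 0 <= Y) by (apply Rdiv_le_0_compat; lra).
  assert (EY : forall t, E (t, Y) = RtoC 0).
  { intros t. unfold E. apply Hz. rewrite Mod. simpl.
    rewrite exp_Ropp. apply Rmult_lt_reg_r with (exp (2 * PI * Y)); [apply exp_pos|].
    rewrite Rmult_assoc, Rinv_l by (apply Rgt_not_eq, exp_pos).
    assert (X : 1 + 2 * PI * Y <= exp (2 * PI * Y)).
    { destruct (Req_dec (2 * PI * Y) 0) as [->|N]; [rewrite exp_0; lra|].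
      left. now apply exp_ineq1. }
    assert (m = r0 * Y) by (unfold Y; field; lra).
    assert (2 * 3 < 2 * PI) by (pose proof PI2_3_2; lra).
    nra. }
  assert (V : E (RtoC (1 / 2)) = RtoC 0).
  { apply (fourier_unique (fun t => E (RtoC t)) (1 / 2)); [| |lra].
    - intros t. apply rcont_ccont. destruct (DE (RtoC t)) as [l Hl]; [simpl; lra|].
      now apply cderiv_ccont in Hl.
    - intros n. rewrite (CInt_ext _ (fun t => E (t, 0) * cis n (t, 0))%C 0 1); [|lra|reflexivity].
      rewrite (periodic_line_int (fun z => E z * cis n z)%C 0 Y HY).
      + rewrite (CInt_ext _ (fun _ => RtoC 0 * RtoC 0)%C 0 1); [|lra|].
        * rewrite (CInt_scal (RtoC 0) (fun _ => RtoC 0)); [ring|lra|]. intros s _. apply rcont_const.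
        * intros t _. rewrite EY. ring.
      + intros w Hw. destruct (DE w) as [l Hl]; [lra|]. eexists.
        apply cderiv_mult; [exact Hl|apply cderiv_cis].
      + intros w. now rewrite PE, cis_period. }
  unfold E in V. rewrite cis_R in V.
  replace (2 * PI * 1 * (1 / 2)) with PI in V by field. rewrite cos_PI, sin_PI in V.
  rewrite <- V. f_equal. destruct z as [z1 z2], c as [c1 c2].
  apply injective_projections; simpl; ring.
Qed.

(* Vanishing propagates along the segment from [a] to [b]: at the supremum of the
   good parameters the disc identity extends the vanishing further. *)
Lemma segment_identity (f : C -> C) (U : C -> Prop) (a b : C) (r0 : R) :
  (forall z, U z -> exists r, 0 < r /\ forall w, Cmod (w - z)%C < r -> U w) ->
  (forall z, U z -> exists l, cderiv f z l) ->
  (forall t, 0 <= t <= 1 -> U (a + t * (b - a))%C) ->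
  0 < r0 -> (forall z, Cmod (z - a)%C < r0 -> f z = RtoC 0) -> f b = RtoC 0.
Proof.
  intros HU Hf Hseg Hr0 Hz.
  pose (p := fun t : R => (a + t * (b - a))%C).
  pose (G := fun t => 0 <= t <= 1 /\ exists e, 0 < e /\ forall z, Cmod (z - p t)%C < e -> f z = RtoC 0).
  assert (G0 : G 0).
  { split; [lra|]. exists r0. split; [exact Hr0|]. intros z H. apply Hz.
    unfold p in H. replace (a + 0 * (b - a))%C with a in H by ring. exact H. }
  destruct (completeness G) as [s [S1 S2]].
  - exists 1. intros t [Ht _]. lra.
  - now exists 0.
  - assert (Hs : 0 <= s <= 1).
    { split; [now apply S1|]. apply S2. intros t [Ht _]. lra. }
    destruct (HU (p s) (Hseg s Hs)) as [r [Hr HB]].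
    (* Adding 1 makes the Lipschitz bound strict, so a parameter step of [2 * h] stays inside the
       open disc of radius [r / 2] around [p t]; it also covers [a = b]. *)
    set (L := Cmod (b - a)%C + 1). assert (L0 : 0 < L) by (pose proof (Cmod_ge_0 (b - a)%C); unfold L; lra).
    assert (Dist : forall t t', Cmod (p t - p t')%C <= Rabs (t - t') * L).
    { intros t t'. unfold p. replace (a + t * (b - a) - (a + t' * (b - a)))%C with ((t - t') * (b - a))%C by ring.
      rewrite <- RtoC_minus, Cmod_mult, Cmod_R. apply Rmult_le_compat_l; [apply Rabs_pos|]. unfold L. lra. }
    set (h := r / 4 / L). assert (H0 : 0 < h) by (repeat apply Rdiv_lt_0_compat; lra).
    assert (HhL : h * L = r / 4) by (unfold h; field; lra).
    assert (Ex : exists t, G t /\ s - h < t).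
    { apply NNPP. intros N. assert (s <= s - h); [|lra]. apply S2. intros t Gt.
      apply Rnot_lt_le. intros Q. apply N. now exists t. }
    destruct Ex as [t [[Ht [e [He Gt]]] Hts]].
    assert (Hts2 : t <= s) by (apply S1; split; [exact Ht|now exists e]).
    assert (Z : forall z, Cmod (z - p t)%C < r / 2 -> f z = RtoC 0).
    { apply (disc_identity f (p t) e (r / 2) He).
      - intros z Hzt. apply Hf, HB.
        replace (z - p s)%C with ((z - p t) + (p t - p s))%C by ring.
        eapply Rle_lt_trans; [apply Cmod_triangle|].
        specialize (Dist t s). rewrite Rabs_left1 in Dist by lra. nra.
      - exact Gt. }
    assert (Near : forall t', Rabs (t' - t) <= 2 * h -> 0 <= t' <= 1 ->
      exists e', 0 < e' /\ forall z, Cmod (z - p t')%C < e' -> f z = RtoC 0).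
    { intros t' Ht' _.
      specialize (Dist t' t).
      assert (Dl : Cmod (p t' - p t)%C <= r / 2) by nra.
      destruct (Rle_lt_or_eq_dec _ _ Dl) as [Q|Q].
      - exists (r / 2 - Cmod (p t' - p t)%C). split; [lra|]. intros z Hzz. apply Z.
        replace (z - p t)%C with ((z - p t') + (p t' - p t))%C by ring.
        eapply Rle_lt_trans; [apply Cmod_triangle|]. lra.
      - exfalso. unfold L in *. pose proof (Rabs_pos (t' - t)).
        assert (Dist2 : Cmod (p t' - p t)%C <= Rabs (t' - t) * Cmod (b - a)%C).
        { unfold p. replace (a + t' * (b - a) - (a + t * (b - a)))%C with ((t' - t) * (b - a))%C by ring.
          rewrite <- RtoC_minus, Cmod_mult, Cmod_R. lra. }
        assert (Rabs (t' - t) * Cmod (b - a)%C <= 2 * h * Cmod (b - a)%C)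
          by (apply Rmult_le_compat_r; [apply Cmod_ge_0|exact Ht']).
        lra. }
    destruct (Rle_lt_dec 1 (t + 2 * h)) as [Q|Q].
    + destruct (Near 1) as [e' [He' K]]; [apply Rabs_le; lra|lra|].
      apply K. unfold p. replace (b - (a + 1 * (b - a)))%C with (RtoC 0) by ring.
      rewrite Cmod_0. exact He'.
    + exfalso. assert (t + 2 * h <= s); [|lra]. apply S1. split; [lra|].
      apply Near; [|lra]. replace (t + 2 * h - t) with (2 * h) by ring. rewrite Rabs_pos_eq; lra.
Qed.

(** * Hypergeometric series and their transformations *)

Lemma is_derive_along_reals (g : C -> R) (h : C -> C) (t : R) (l : C) :
  (forall z w, g (z - w)%C = g z - g w) -> (forall (x : R) z, g (x * z)%C = x * g z) ->
  (forall z, Rabs (g z) <= Cmod z) ->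
  cderiv h (RtoC t) l -> is_derive (fun s : R => g (h (RtoC s))) t (g l).
Proof.
  intros G1 G2 G3 H. split; [apply is_linear_scal_l|].
  intros x Hx e.
  assert (E : x = t).
  { symmetry. apply (@is_filter_lim_locally_unique R_AbsRing R_NormedModule). exact Hx. }
  subst x.
  destruct (cderiv_quotient h (RtoC t) l H e (cond_pos e)) as [d [D K]].
  exists (mkposreal d D). intros s Hs.
  change (Rabs (g (h (RtoC s)) - g (h (RtoC t)) - (s - t) * g l) <= e * Rabs (s - t)).
  rewrite <- G2, <- !G1. eapply Rle_trans; [apply G3|].
  assert (Q : (RtoC s - RtoC t)%C = RtoC (s - t)) by (symmetry; apply RtoC_minus).
  specialize (K (RtoC s)). rewrite Q, Cmod_R in K. rewrite (Cmult_comm (RtoC (s - t))).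
  apply K. exact Hs.
Qed.

(** The mean value theorem on the segment from 0 to [z], for real and imaginary parts. At 0 only
    continuity is assumed, because a singular differential equation gives no information on the
    derivative there. *)
Lemma cderiv_0_const (f : C -> C) (r : R) :
  (forall z, z <> RtoC 0 -> Cmod z < r -> cderiv f z (RtoC 0)) -> ccont f (RtoC 0) ->
  forall z, Cmod z < r -> f z = f (RtoC 0).
Proof.
  intros Hd Hc z Hz. destruct (Ceq_dec z (RtoC 0)) as [->|Nz]; [reflexivity|].
  assert (Mz : 0 < Cmod z) by now apply Cmod_gt_0.
  assert (Main : forall g : C -> R,
    (forall z w, g (z - w)%C = g z - g w) -> (forall (x : R) z, g (x * z)%C = x * g z) ->
    (forall z, Rabs (g z) <= Cmod z) -> g (f z) = g (f (RtoC 0))).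
  { intros g G1 G2 G3.
    assert (P1 : forall t : R, 0 < t <= 1 -> cderiv (fun w => f (w * z)%C) (RtoC t) (RtoC 0)).
    { intros t Ht. eapply cderiv_eq.
      - apply (cderiv_comp f (fun w => w * z)%C).
        + apply cderiv_mult; [apply cderiv_id|apply cderiv_const].
        + apply Hd.
          * apply Cmult_neq_0; [|exact Nz]. intros Q. apply RtoC_inj in Q. lra.
          * rewrite Cmod_mult, Cmod_R, Rabs_pos_eq by lra. nra.
      - ring. }
    assert (P2 : forall t : R, 0 <= t <= 1 -> ccont (fun w => f (w * z)%C) (RtoC t)).
    { intros t Ht. destruct (Req_dec t 0) as [->|N].
      - apply (ccont_comp f (fun w => w * z)%C).
        + apply ccont_mult; [apply ccont_id|apply ccont_const].
        + replace (RtoC 0 * z)%C with (RtoC 0) by ring. exact Hc.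
      - eapply cderiv_ccont, P1. lra. }
    assert (G0 : g (RtoC 0) = 0).
    { specialize (G1 (RtoC 0) (RtoC 0)). rewrite Cminus_diag in G1. lra. }
    destruct (MVT_gen (fun t : R => g (f (RtoC t * z)%C)) 0 1 (fun _ => 0)) as [c [_ Hmvt]].
    - intros t. rewrite Rmin_left, Rmax_right by lra. intros Ht. rewrite <- G0.
      apply (is_derive_along_reals g (fun w => f (w * z)%C)); auto. apply P1. lra.
    - intros t. rewrite Rmin_left, Rmax_right by lra. intros Ht.
      apply continuity_pt_filterlim.
      apply (rcont_continuous g (fun t => f (RtoC t * z)%C)).
      + intros a b. rewrite <- G1. apply G3.
      + apply (rcont_ccont (fun w => f (w * z)%C)). now apply P2.
    - replace (RtoC 1 * z)%C with z in Hmvt by ring.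
      replace (RtoC 0 * z)%C with (RtoC 0) in Hmvt by ring. lra. }
  apply injective_projections.
  - apply (Main Re); [reflexivity| |apply re_le_Cmod]. intros x [w1 w2]. simpl. ring.
  - apply (Main Im); [reflexivity| |apply im_le_Cmod]. intros x [w1 w2]. simpl. ring.
Qed.

(* Abel's identity makes [p * Wronskian] constant, hence 0 because [p] vanishes
   at the singular point; so the two solutions are proportional. *)
Lemma singular_ode_unique (y1 d1 e1 y2 d2 e2 p p' k : C -> C) (r : R) :
  0 < r ->
  (forall z, Cmod z < r -> cderiv y1 z (d1 z) /\ cderiv d1 z (e1 z)) ->
  (forall z, Cmod z < r -> cderiv y2 z (d2 z) /\ cderiv d2 z (e2 z)) ->
  (forall z, Cmod z < r -> cderiv p z (p' z)) ->
  p (RtoC 0) = RtoC 0 -> (forall z, Cmod z < r -> z <> RtoC 0 -> p z <> RtoC 0) ->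
  (forall z, Cmod z < r -> y2 z <> RtoC 0) ->
  (forall z, Cmod z < r -> (p z * e1 z + p' z * d1 z)%C = (k z * y1 z)%C) ->
  (forall z, Cmod z < r -> (p z * e2 z + p' z * d2 z)%C = (k z * y2 z)%C) ->
  forall z, Cmod z < r -> (y1 z * y2 (RtoC 0))%C = (y1 (RtoC 0) * y2 z)%C.
Proof.
  intros Hr H1 H2 Hp P0 Pn Yn O1 O2 z Hz.
  assert (R0 : Cmod (RtoC 0) < r) by now rewrite Cmod_0.
  assert (V : forall w, Cmod w < r -> (p w * (y1 w * d2 w - d1 w * y2 w))%C = RtoC 0).
  { intros w Hw.
    rewrite (cderiv_0_const (fun w => p w * (y1 w * d2 w - d1 w * y2 w))%C r); auto.
    - rewrite P0. ring.
    - intros u _ Hu. destruct (H1 u Hu) as [A1 A2]. destruct (H2 u Hu) as [B1 B2].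
      eapply cderiv_eq.
      + apply cderiv_mult; [exact (Hp u Hu)|].
        apply cderiv_minus; apply cderiv_mult; eassumption.
      + cbv beta.
        replace (_ + _)%C with (y1 u * (p u * e2 u + p' u * d2 u) - y2 u * (p u * e1 u + p' u * d1 u))%C by ring.
        rewrite O1, O2 by exact Hu. ring.
    - destruct (H1 _ R0) as [A1 A2]. destruct (H2 _ R0) as [B1 B2].
      eapply cderiv_ccont. apply cderiv_mult; [exact (Hp _ R0)|].
      apply cderiv_minus; apply cderiv_mult; eassumption. }
  assert (Q : (y1 z / y2 z)%C = (y1 (RtoC 0) / y2 (RtoC 0))%C).
  { apply (cderiv_0_const (fun w => y1 w / y2 w)%C r); auto.
    - intros w Nw Hw. eapply cderiv_eq; [apply cderiv_div; [apply H1|apply H2|apply Yn]; exact Hw|].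
      specialize (V w Hw). specialize (Pn w Hw Nw).
      assert (Z : (y1 w * d2 w - d1 w * y2 w)%C = RtoC 0).
      { apply NNPP. intros N. now apply (Cmult_neq_0 _ _ Pn N). }
      replace (d1 w * y2 w - y1 w * d2 w)%C with (- (y1 w * d2 w - d1 w * y2 w))%C by ring.
      rewrite Z. field. now apply Yn.
    - eapply cderiv_ccont, cderiv_div; [apply H1|apply H2|apply Yn]; exact R0. }
  pose proof (Yn z Hz) as N1. pose proof (Yn _ R0) as N2.
  replace (y1 z * y2 (RtoC 0))%C with ((y1 z / y2 z) * y2 z * y2 (RtoC 0))%C by (field; exact N1).
  rewrite Q. field. exact N2.
Qed.

(** Coefficients of [z f'(z)]: unlike differentiation, the Euler operator does not shift the
    index. *)
Definition tcoef (a : nat -> C) (n : nat) : C := (INR n * a n)%C.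

Lemma rad_tcoef (a : nat -> C) (r : R) : rad a r -> rad (tcoef a) r.
Proof.
  intros H s Hs.
  destruct (lac_dominated a (fun n => n) r s H ltac:(intros; lia) Hs) as [M [t [PM [Ht K]]]].
  exists M. intros n. unfold tcoef. rewrite Cmod_mult, Cmod_R, Rabs_pos_eq by apply pos_INR.
  apply Rle_trans with (M * t ^ n).
  - eapply Rle_trans; [|apply (K n)]. apply Rmult_le_compat_r; [apply pow_le; lra|].
    rewrite Rmult_comm. apply Rmult_le_compat_l; [apply Cmod_ge_0|].
    pose proof (pos_INR n). nra.
  - rewrite <- (Rmult_1_r M) at 2. apply Rmult_le_compat_l; [exact PM|].
    rewrite <- (pow1 n). apply pow_incr. lra.
Qed.

Lemma rad_plus (a b : nat -> C) (r : R) : rad a r -> rad b r -> rad (fun n => a n + b n)%C r.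
Proof.
  intros Ha Hb s Hs. destruct (Ha s Hs) as [A HA]. destruct (Hb s Hs) as [B HB].
  exists (A + B). intros n. specialize (HA n). specialize (HB n).
  eapply Rle_trans; [apply Rmult_le_compat_r; [apply pow_le; lra|apply Cmod_triangle]|]. lra.
Qed.

Lemma rad_scal (c : C) (a : nat -> C) (r : R) : rad a r -> rad (fun n => c * a n)%C r.
Proof.
  intros Ha s Hs. destruct (Ha s Hs) as [A HA]. exists (Cmod c * A). intros n.
  rewrite Cmod_mult, Rmult_assoc. apply Rmult_le_compat_l; [apply Cmod_ge_0|apply HA].
Qed.

Lemma PS_ext (a b : nat -> C) (z : C) : (forall n, a n = b n) -> PS a z = PS b z.
Proof. intros E. apply CSeries_ext. intros n. now rewrite E. Qed.

Lemma PS_plus (a b : nat -> C) (r : R) (z : C) :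
  rad a r -> rad b r -> Cmod z < r -> PS (fun n => a n + b n)%C z = (PS a z + PS b z)%C.
Proof.
  intros Ha Hb Hz. unfold PS. rewrite <- CSeries_plus by (eapply PS_summable; eassumption).
  apply CSeries_ext. intros n. ring.
Qed.

Lemma PS_scal (c : C) (a : nat -> C) (r : R) (z : C) :
  rad a r -> Cmod z < r -> PS (fun n => c * a n)%C z = (c * PS a z)%C.
Proof.
  intros Ha Hz. unfold PS. rewrite <- CSeries_scal by (eapply PS_summable; eassumption).
  apply CSeries_ext. intros n. ring.
Qed.

Lemma PS_mult_var_dcoef (a : nat -> C) (r : R) (z : C) :
  rad a r -> Cmod z < r -> (z * PS (dcoef a) z)%C = PS (tcoef a) z.
Proof.
  intros Ha Hz. pose proof (PS_summable _ _ _ (rad_tcoef _ _ Ha) Hz) as S.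
  pose proof (PS_summable _ _ _ (rad_dcoef _ _ Ha) Hz) as S'.
  unfold PS. rewrite (CSeries_incr (fun n => tcoef a n * z ^ n)%C S), <- CSeries_scal by exact S'.
  unfold tcoef at 1. simpl INR at 1.
  rewrite <- (Cplus_0_l (CSeries (fun n => z * _)%C)). apply f_equal2; [ring|].
  apply CSeries_ext. intros n. unfold dcoef, tcoef. rewrite Cpow_S. ring.
Qed.

(** The coefficients for [c = 1], left unsimplified so that [hyp a b] is convertible with
    [hypergeom_series a b 1]. *)
Definition hcoef (a b : C) (n : nat) : C :=
  (poch a n * poch b n / (poch (RtoC 1) n * poch (RtoC 1) n))%C.

Definition hyp (a b : C) : C -> C := PS (hcoef a b).

Lemma INR_S_nz (n : nat) : (RtoC 1 + INR n)%C <> RtoC 0.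
Proof.
  rewrite <- RtoC_plus. intros H. apply RtoC_inj in H. pose proof (pos_INR n). lra.
Qed.

Lemma poch_1_nz (n : nat) : poch (RtoC 1) n <> RtoC 0.
Proof.
  induction n as [|n IH]; simpl.
  - intros H. apply RtoC_inj in H. lra.
  - apply Cmult_neq_0; [exact IH|apply INR_S_nz].
Qed.

Lemma hcoef_S (a b : C) (n : nat) :
  hcoef a b (S n) = ((a + INR n) * (b + INR n) / ((1 + INR n) * (1 + INR n)) * hcoef a b n)%C.
Proof.
  unfold hcoef. simpl poch. field. split; [apply poch_1_nz|apply INR_S_nz].
Qed.

Lemma hcoef_0 (a b : C) : hcoef a b 0 = RtoC 1.
Proof. unfold hcoef. simpl. field. Qed.

(** The ratio of consecutive coefficients has modulus at most 1, since [|a + n|] and [|b + n|] are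
    at most [1 + n]. *)
Lemma hcoef_bound (a b : C) (n : nat) : Cmod a <= 1 -> Cmod b <= 1 -> Cmod (hcoef a b n) <= 1.
Proof.
  intros Ha Hb. induction n as [|n IH]; [rewrite hcoef_0, Cmod_1; lra|].
  rewrite hcoef_S, Cmod_mult, Cmod_div by (apply Cmult_neq_0; apply INR_S_nz).
  rewrite !Cmod_mult. pose proof (pos_INR n) as P.
  assert (E : Cmod (1 + INR n)%C = 1 + INR n).
  { rewrite <- RtoC_plus, Cmod_R. apply Rabs_pos_eq. lra. }
  assert (B : forall c, Cmod c <= 1 -> Cmod (c + INR n)%C <= 1 + INR n).
  { intros c Hc. eapply Rle_trans; [apply Cmod_triangle|]. rewrite Cmod_R, (Rabs_pos_eq (INR n)); lra. }
  rewrite E. pose proof (Cmod_ge_0 (hcoef a b n)).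
  assert (Q : Cmod (a + INR n)%C * Cmod (b + INR n)%C / ((1 + INR n) * (1 + INR n)) <= 1).
  { apply Rmult_le_reg_r with ((1 + INR n) * (1 + INR n)); [nra|].
    unfold Rdiv. rewrite Rmult_assoc, Rinv_l by nra. rewrite Rmult_1_r, Rmult_1_l.
    apply Rmult_le_compat; try apply Cmod_ge_0; now apply B. }
  assert (0 <= Cmod (a + INR n)%C * Cmod (b + INR n)%C / ((1 + INR n) * (1 + INR n))).
  { apply Rdiv_le_0_compat; [|nra]. apply Rmult_le_pos; apply Cmod_ge_0. }
  nra.
Qed.

Lemma rad_hcoef (a b : C) : Cmod a <= 1 -> Cmod b <= 1 -> rad (hcoef a b) 1.
Proof.
  intros Ha Hb s Hs. exists 1. intros n. rewrite <- (Rmult_1_r 1).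
  apply Rmult_le_compat; [apply Cmod_ge_0|apply pow_le; lra|now apply hcoef_bound|].
  rewrite <- (pow1 n). apply pow_incr. lra.
Qed.

Definition hyp1 (a b : C) : C -> C := PS (dcoef (hcoef a b)).
Definition hyp2 (a b : C) : C -> C := PS (dcoef (dcoef (hcoef a b))).

Lemma hyp_0 (a b : C) : hyp a b (RtoC 0) = RtoC 1.
Proof. unfold hyp. rewrite PS_0. apply hcoef_0. Qed.

Lemma cderiv_hyp (a b z : C) : Cmod a <= 1 -> Cmod b <= 1 -> Cmod z < 1 ->
  cderiv (hyp a b) z (hyp1 a b z) /\ cderiv (hyp1 a b) z (hyp2 a b z).
Proof.
  intros Ha Hb Hz. pose proof (rad_hcoef a b Ha Hb) as R.
  split; apply PS_cderiv with 1; auto. now apply rad_dcoef.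
Qed.

Lemma hyp_ode (a b z : C) : Cmod a <= 1 -> Cmod b <= 1 -> Cmod z < 1 ->
  (z * (1 - z) * hyp2 a b z + (1 - (a + b + 1) * z) * hyp1 a b z - a * b * hyp a b z)%C = RtoC 0.
Proof.
  intros Ha Hb Hz. pose proof (rad_hcoef a b Ha Hb) as R0.
  set (c := hcoef a b) in *.
  pose proof (rad_dcoef _ _ R0) as R1. pose proof (rad_tcoef _ _ R0) as T0.
  pose proof (rad_tcoef _ _ R1) as T1.
  (* Then [tcoef c'] has entries [n (n - 1) c n], the coefficients of [z^2 f'']. *)
  set (c' := fun n => (tcoef c n + RtoC (-1) * c n)%C).
  assert (R' : rad c' 1) by (apply rad_plus; [exact T0|now apply rad_scal]).
  assert (E1 : (z * hyp2 a b z)%C = PS (tcoef (dcoef c)) z) by now apply PS_mult_var_dcoef with 1.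
  assert (E2 : (z * PS (tcoef (dcoef c)) z)%C = PS (tcoef c') z).
  { rewrite <- (PS_mult_var_dcoef c' 1) by assumption. apply f_equal, PS_ext. intros n.
    unfold c', tcoef, dcoef. rewrite S_INR, RtoC_plus. ring. }
  assert (E3 : (z * hyp1 a b z)%C = PS (tcoef c) z) by now apply PS_mult_var_dcoef with 1.
  replace (z * (1 - z) * hyp2 a b z + (1 - (a + b + 1) * z) * hyp1 a b z - a * b * hyp a b z)%C
    with (z * hyp2 a b z + RtoC (-1) * (z * (z * hyp2 a b z)) +
          (hyp1 a b z + (- (a + b + 1)) * (z * hyp1 a b z)) + (- (a * b)) * hyp a b z)%C by ring.
  rewrite E1, E2, E3. unfold hyp1, hyp. fold c.
  pose proof (rad_tcoef _ _ R') as T'.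
  rewrite <- !(PS_scal _ _ 1) by assumption.
  rewrite <- (PS_plus (tcoef (dcoef c)) _ 1) by (try apply rad_scal; assumption).
  rewrite <- (PS_plus (dcoef c) _ 1) by (try apply rad_scal; assumption).
  rewrite <- !(PS_plus _ _ 1) by (repeat (apply rad_plus || apply rad_scal || assumption)).
  apply CSeries_0. intros n. unfold c', tcoef, dcoef, c. rewrite hcoef_S, S_INR, RtoC_plus.
  field. apply INR_S_nz.
Qed.

(** [hyp a 1] is the binomial series of [(1 - z)^(-a)]. It replaces complex powers throughout, and
    this equation yields the laws of exponents that are needed. *)
Lemma binomial_ode (a z : C) : Cmod a <= 1 -> Cmod z < 1 ->
  ((1 - z) * hyp1 a 1 z)%C = (a * hyp a 1 z)%C.
Proof.
  intros Ha Hz. assert (H1 : Cmod (RtoC 1) <= 1) by (rewrite Cmod_1; lra).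
  pose proof (rad_hcoef a 1 Ha H1) as R0. set (c := hcoef a 1) in *.
  pose proof (rad_dcoef _ _ R0) as R1. pose proof (rad_tcoef _ _ R0) as T0.
  replace ((1 - z) * hyp1 a 1 z)%C with (hyp1 a 1 z + RtoC (-1) * (z * hyp1 a 1 z))%C by ring.
  unfold hyp1, hyp. fold c. rewrite (PS_mult_var_dcoef c 1) by assumption.
  rewrite <- !(PS_scal _ _ 1) by assumption.
  rewrite <- (PS_plus _ _ 1) by (try apply rad_scal; assumption).
  apply PS_ext. intros n. unfold dcoef, tcoef, c. rewrite hcoef_S, S_INR, RtoC_plus.
  field. apply INR_S_nz.
Qed.

Lemma Cmod_1_minus_nz (z : C) : Cmod z < 1 -> (1 - z)%C <> RtoC 0.
Proof.
  intros H E. apply Cminus_eq_0 in E. rewrite <- E, Cmod_1 in H. lra.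
Qed.

Lemma Cmod_1_plus_nz (z : C) : Cmod z < 1 -> (1 + z)%C <> RtoC 0.
Proof.
  intros H. replace (1 + z)%C with (1 - - z)%C by ring. apply Cmod_1_minus_nz. now rewrite Cmod_opp.
Qed.

Lemma cderiv_binomial (a z : C) : Cmod a <= 1 -> Cmod z < 1 ->
  cderiv (hyp a 1) z (a * hyp a 1 z / (1 - z))%C.
Proof.
  intros Ha Hz. assert (H1 : Cmod (RtoC 1) <= 1) by (rewrite Cmod_1; lra).
  destruct (cderiv_hyp a (RtoC 1) z Ha H1 Hz) as [D _].
  apply (cderiv_eq _ _ _ _ D).
  rewrite <- binomial_ode by assumption. field. now apply Cmod_1_minus_nz.
Qed.

Lemma cderiv_binomial_comp (a : C) (g : C -> C) (z l : C) : Cmod a <= 1 -> Cmod (g z) < 1 ->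
  cderiv g z l -> cderiv (fun w => hyp a 1 (g w)) z (a * hyp a 1 (g z) / (1 - g z) * l)%C.
Proof.
  intros Ha Hz Hg. apply (cderiv_comp (hyp a 1) g); [exact Hg|]. now apply cderiv_binomial.
Qed.

Lemma Cmod_0_lt_1 : Cmod (RtoC 0) < 1.
Proof. rewrite Cmod_0. lra. Qed.

Lemma ccont_binomial_0 (a : C) : Cmod a <= 1 -> ccont (hyp a 1) (RtoC 0).
Proof. intros Ha. eapply cderiv_ccont, cderiv_binomial; [exact Ha|apply Cmod_0_lt_1]. Qed.

Lemma binomial_opp (a z : C) : Cmod a <= 1 -> Cmod z < 1 ->
  (hyp a 1 z * hyp (- a) 1 z)%C = RtoC 1.
Proof.
  intros Ha Hz. assert (Ha' : Cmod (- a)%C <= 1) by now rewrite Cmod_opp.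
  rewrite (cderiv_0_const (fun w => hyp a 1 w * hyp (- a) 1 w)%C 1); [rewrite !hyp_0; ring| | |exact Hz].
  - intros w _ Hw. eapply cderiv_eq; [apply cderiv_mult; apply cderiv_binomial; assumption|].
    cbv beta. field. now apply Cmod_1_minus_nz.
  - apply ccont_mult; now apply ccont_binomial_0.
Qed.

Lemma binomial_1 (z : C) : Cmod z < 1 -> ((1 - z) * hyp 1 1 z)%C = RtoC 1.
Proof.
  intros Hz. assert (H1 : Cmod (RtoC 1) <= 1) by (rewrite Cmod_1; lra).
  rewrite (cderiv_0_const (fun w => (1 - w) * hyp 1 1 w)%C 1); [rewrite !hyp_0; ring| | |exact Hz].
  - intros w _ Hw. eapply cderiv_eq.
    + apply cderiv_mult; [|apply cderiv_binomial; assumption].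
      apply cderiv_minus; [apply cderiv_const|apply cderiv_id].
    + cbv beta. field. now apply Cmod_1_minus_nz.
  - apply ccont_mult; [|now apply ccont_binomial_0].
    eapply cderiv_ccont, cderiv_minus; [apply cderiv_const|apply cderiv_id].
Qed.

Lemma Cmod_RtoC_div (x y : R) : 0 < y -> Cmod (RtoC x / RtoC y)%C = Rabs x / y.
Proof.
  intros Hy. rewrite Cmod_div.
  - rewrite !Cmod_R, (Rabs_pos_eq y); lra.
  - intros H. apply RtoC_inj in H. lra.
Qed.

Lemma Cmod_half : Cmod (1 / 2)%C = 1 / 2.
Proof. rewrite Cmod_RtoC_div by lra. rewrite Rabs_R1. reflexivity. Qed.

Lemma Cmod_sixth : Cmod (1 / 6)%C = 1 / 6.
Proof. rewrite Cmod_RtoC_div by lra. rewrite Rabs_R1. reflexivity. Qed.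

Lemma binomial_half_sq (z : C) : Cmod z < 1 ->
  ((1 - z) * (hyp (1 / 2) 1 z * hyp (1 / 2) 1 z))%C = RtoC 1.
Proof.
  intros Hz. assert (H1 : Cmod (1 / 2)%C <= 1) by (rewrite Cmod_half; lra).
  rewrite (cderiv_0_const (fun w => (1 - w) * (hyp (1 / 2) 1 w * hyp (1 / 2) 1 w))%C 1);
    [rewrite !hyp_0; ring| | |exact Hz].
  - intros w _ Hw. eapply cderiv_eq.
    + apply cderiv_mult; [|apply cderiv_mult; apply cderiv_binomial; assumption].
      apply cderiv_minus; [apply cderiv_const|apply cderiv_id].
    + cbv beta. field. now apply Cmod_1_minus_nz.
  - apply ccont_mult; [|apply ccont_mult; now apply ccont_binomial_0].
    eapply cderiv_ccont, cderiv_minus; [apply cderiv_const|apply cderiv_id].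
Qed.

Lemma RtoC_nz (x : R) : x <> 0 -> RtoC x <> RtoC 0.
Proof. intros H E. apply H. now apply RtoC_inj. Qed.

Lemma Cmod_sq (w : C) : Cmod (w * w)%C = Cmod w * Cmod w.
Proof. apply Cmod_mult. Qed.

Lemma landen_arg_bound (w : C) : Cmod w < 1 / 10 -> Cmod (4 * w / ((1 + w) * (1 + w)))%C < 1.
Proof.
  intros H. assert (N : (1 + w)%C <> RtoC 0) by (apply Cmod_1_plus_nz; lra).
  rewrite Cmod_div by now apply Cmult_neq_0. rewrite !Cmod_mult, Cmod_R, Rabs_pos_eq by lra.
  assert (T := Cmod_triangle_inv 1 w). rewrite Cmod_1 in T.
  apply Rmult_lt_reg_r with (Cmod (1 + w)%C * Cmod (1 + w)%C); [nra|].
  unfold Rdiv. rewrite Rmult_assoc, Rinv_l by nra. nra.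
Qed.

(** Here [hyp (2 * a) 1 (- w)] is [(1 + w)^(-2a)]. Both sides solve [(p y')' = k y] with
    [p = w (1 - w^2)^(2a)] and have the value 1 at 0, where [p] vanishes. *)
Lemma quadratic_transformation (a : C) : Cmod a <= 1 -> Cmod (2 * a)%C <= 1 ->
  exists r, 0 < r <= 1 / 10 /\ forall w, Cmod w < r ->
    hyp a a (w * w)%C =
    (hyp (2 * a) 1 (- w) * hyp a (1 / 2) (4 * w / ((1 + w) * (1 + w))))%C.
Proof.
  intros Ha H2a.
  assert (Hh : Cmod (1 / 2)%C <= 1) by (rewrite Cmod_half; lra).
  assert (H2a' : Cmod (- (2 * a))%C <= 1) by now rewrite Cmod_opp.
  pose (phi := fun w : C => (4 * w / ((1 + w) * (1 + w)))%C).
  pose (phi1 := fun w : C => (4 * (1 - w) / ((1 + w) * (1 + w) * (1 + w)))%C).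
  pose (phi2 := fun w : C => ((8 * w - 16) / ((1 + w) * (1 + w) * ((1 + w) * (1 + w))))%C).
  pose (s := fun w : C => hyp (2 * a) 1 (- w)%C).
  pose (y2 := fun w => (s w * hyp a (1 / 2) (phi w))%C).
  pose (d2 := fun w => (- (2 * a) * s w / (1 + w) * hyp a (1 / 2) (phi w)
                        + s w * (hyp1 a (1 / 2) (phi w) * phi1 w))%C).
  pose (e2 := fun w => (2 * a * (2 * a + 1) * s w / ((1 + w) * (1 + w)) * hyp a (1 / 2) (phi w)
                        + 2 * (- (2 * a) * s w / (1 + w)) * (hyp1 a (1 / 2) (phi w) * phi1 w)
                        + s w * (hyp2 a (1 / 2) (phi w) * (phi1 w * phi1 w)
                                 + hyp1 a (1 / 2) (phi w) * phi2 w))%C).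
  pose (y1 := fun w : C => hyp a a (w * w)%C).
  pose (d1 := fun w : C => (2 * w * hyp1 a a (w * w))%C).
  pose (e1 := fun w : C => (2 * hyp1 a a (w * w) + 4 * (w * w) * hyp2 a a (w * w))%C).
  (* This is [(1 - w^2)^(2a)], the integrating factor that puts the equation into self-adjoint
     form. *)
  pose (b := fun w : C => hyp (- (2 * a)) 1 (w * w)%C).
  pose (p := fun w : C => (w * b w)%C).
  pose (p' := fun w : C => (b w * (1 - w * w - 4 * a * (w * w)) / (1 - w * w))%C).
  pose (k := fun w : C => (4 * (a * a) * w * b w / (1 - w * w))%C).
  assert (Bphi : forall w, Cmod w < 1 / 10 -> Cmod (phi w) < 1) by apply landen_arg_bound.
  assert (Bn : forall w, Cmod w < 1 / 10 -> Cmod (- w)%C < 1).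
  { intros w Hw. rewrite Cmod_opp. lra. }
  assert (Bs : forall w, Cmod w < 1 / 10 -> Cmod (w * w)%C < 1).
  { intros w Hw. rewrite Cmod_sq. pose proof (Cmod_ge_0 w). nra. }
  assert (N1 : forall w, Cmod w < 1 / 10 -> (1 + w)%C <> RtoC 0).
  { intros w Hw. apply Cmod_1_plus_nz. lra. }
  assert (N2 : forall w, Cmod w < 1 / 10 -> (1 - w * w)%C <> RtoC 0).
  { intros w Hw. apply Cmod_1_minus_nz. now apply Bs. }
  assert (Dphi : forall w, Cmod w < 1 / 10 -> cderiv phi w (phi1 w)).
  { intros w Hw. unfold phi. eapply cderiv_eq.
    - apply cderiv_div; [apply cderiv_scal, cderiv_id| |apply Cmult_neq_0; now apply N1].
      apply cderiv_mult; (apply cderiv_plus; [apply cderiv_const|apply cderiv_id]).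
    - unfold phi1. field. now apply N1. }
  assert (Dphi1 : forall w, Cmod w < 1 / 10 -> cderiv phi1 w (phi2 w)).
  { intros w Hw. unfold phi1.
    assert (P : cderiv (fun w => 1 + w)%C w (0 + 1)%C)
      by (apply cderiv_plus; [apply cderiv_const|apply cderiv_id]).
    eapply cderiv_eq.
    - apply cderiv_div.
      + apply cderiv_scal, cderiv_minus; [apply cderiv_const|apply cderiv_id].
      + apply cderiv_mult; [apply cderiv_mult; exact P|exact P].
      + repeat apply Cmult_neq_0; now apply N1.
    - unfold phi2. field. now apply N1. }
  assert (Ds : forall w, Cmod w < 1 / 10 -> cderiv s w (- (2 * a) * s w / (1 + w))%C).
  { intros w Hw. unfold s. eapply cderiv_eq.
    - apply (cderiv_binomial_comp (2 * a) (fun w => - w)%C); auto. apply cderiv_opp, cderiv_id.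
    - field. now apply N1. }
  assert (Db : forall w, Cmod w < 1 / 10 -> cderiv b w (- (4 * a * w) * b w / (1 - w * w))%C).
  { intros w Hw. unfold b. eapply cderiv_eq.
    - apply (cderiv_binomial_comp (- (2 * a)) (fun w => w * w)%C); auto.
      apply cderiv_mult; apply cderiv_id.
    - cbv beta. field. now apply N2. }
  assert (DG : forall w, Cmod w < 1 / 10 ->
     cderiv (fun w => hyp a (1 / 2) (phi w)) w (hyp1 a (1 / 2) (phi w) * phi1 w)%C /\
     cderiv (fun w => hyp1 a (1 / 2) (phi w)) w (hyp2 a (1 / 2) (phi w) * phi1 w)%C).
  { intros w Hw. destruct (cderiv_hyp a (1 / 2) (phi w) Ha Hh (Bphi w Hw)) as [D1 D2].
    split; (apply (cderiv_comp _ phi); [now apply Dphi|assumption]). }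
  assert (DY : forall w, Cmod w < 1 / 10 ->
     cderiv y1 w (hyp1 a a (w * w) * (1 * w + w * 1))%C /\
     cderiv (fun w => hyp1 a a (w * w)%C) w (hyp2 a a (w * w) * (1 * w + w * 1))%C).
  { intros w Hw. destruct (cderiv_hyp a a (w * w)%C Ha Ha (Bs w Hw)) as [D1 D2].
    split; (apply (cderiv_comp _ (fun w => w * w)%C); [apply cderiv_mult; apply cderiv_id|assumption]). }
  assert (H2 : forall w, Cmod w < 1 / 10 -> cderiv y2 w (d2 w) /\ cderiv d2 w (e2 w)).
  { intros w Hw. destruct (DG w Hw) as [G1 G2]. split.
    - unfold y2. eapply cderiv_eq; [apply cderiv_mult; [now apply Ds|exact G1]|].
      unfold d2. ring.
    - unfold d2. eapply cderiv_eq.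
      + apply cderiv_plus; apply cderiv_mult.
        * apply cderiv_div; [apply cderiv_scal; now apply Ds| |now apply N1].
          apply cderiv_plus; [apply cderiv_const|apply cderiv_id].
        * exact G1.
        * now apply Ds.
        * apply cderiv_mult; [exact G2|now apply Dphi1].
      + unfold e2. cbv beta. field. now apply N1. }
  assert (H1 : forall w, Cmod w < 1 / 10 -> cderiv y1 w (d1 w) /\ cderiv d1 w (e1 w)).
  { intros w Hw. destruct (DY w Hw) as [G1 G2]. split.
    - eapply cderiv_eq; [exact G1|]. unfold d1. ring.
    - unfold d1. eapply cderiv_eq.
      + apply cderiv_mult; [apply cderiv_scal, cderiv_id|exact G2].
      + unfold e1. cbv beta. ring. }
  assert (Hp : forall w, Cmod w < 1 / 10 -> cderiv p w (p' w)).
  { intros w Hw. unfold p. eapply cderiv_eq; [apply cderiv_mult; [apply cderiv_id|now apply Db]|].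
    unfold p'. field. now apply N2. }
  assert (O1 : forall w, Cmod w < 1 / 10 -> (p w * e1 w + p' w * d1 w)%C = (k w * y1 w)%C).
  { intros w Hw. assert (Od := hyp_ode a a (w * w)%C Ha Ha (Bs w Hw)).
    apply Cminus_eq_0. unfold p, p', k, e1, d1, y1.
    transitivity (4 * w * b w / (1 - w * w) * RtoC 0)%C; [rewrite <- Od|ring].
    field. now apply N2. }
  assert (O2 : forall w, Cmod w < 1 / 10 -> (p w * e2 w + p' w * d2 w)%C = (k w * y2 w)%C).
  { intros w Hw. assert (Od := hyp_ode a (1 / 2) (phi w) Ha Hh (Bphi w Hw)).
    apply Cminus_eq_0. unfold p, p', k, e2, d2, y2.
    set (G := hyp a (1 / 2) (phi w)) in *. set (G1 := hyp1 a (1 / 2) (phi w)) in *.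
    set (G2 := hyp2 a (1 / 2) (phi w)) in *.
    (* The multiplier is found by comparing the coefficients of [G2]: it equals
       [p s phi1^2 / (phi (1 - phi))]. *)
    transitivity (b w / (1 - w * w) * (4 * s w * (1 - w) / (1 + w)) * RtoC 0)%C; [rewrite <- Od|ring].
    unfold phi, phi1, phi2. field. split; [now apply N1|].
    intros Q. apply (N2 w Hw). rewrite <- Q. ring. }
  assert (R0 : Cmod (RtoC 0) < 1 / 10) by (rewrite Cmod_0; lra).
  assert (Z1 : y1 (RtoC 0) = RtoC 1).
  { unfold y1. replace (RtoC 0 * RtoC 0)%C with (RtoC 0) by ring. apply hyp_0. }
  assert (Z2 : y2 (RtoC 0) = RtoC 1).
  { unfold y2, s, phi. replace (4 * 0 / ((1 + 0) * (1 + 0)))%C with (RtoC 0).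
    - replace (- RtoC 0)%C with (RtoC 0) by ring. rewrite !hyp_0. ring.
    - field. }
  assert (Zb : b (RtoC 0) = RtoC 1).
  { unfold b. replace (RtoC 0 * RtoC 0)%C with (RtoC 0) by ring. apply hyp_0. }
  (* The uniqueness argument divides by [y2] and by [p], and continuity at 0 keeps [y2] and [b] away
     from 0 only on some small disc; hence the unspecified radius. *)
  destruct (ccont_nonzero y2 (RtoC 0)) as [r1 [R1 K1]].
  { eapply cderiv_ccont. now apply H2. }
  { rewrite Z2. apply RtoC_nz. lra. }
  destruct (ccont_nonzero b (RtoC 0)) as [r2 [R2 K2]].
  { eapply cderiv_ccont. now apply Db. }
  { rewrite Zb. apply RtoC_nz. lra. }
  rewrite Z2, Cmod_1 in K1. rewrite Zb, Cmod_1 in K2.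
  set (r := Rmin (1 / 10) (Rmin r1 r2)).
  assert (L0 : 0 < r) by (repeat apply Rmin_pos; lra).
  assert (L1 : r <= 1 / 10) by apply Rmin_l.
  assert (L2 : r <= r1) by (eapply Rle_trans; [apply Rmin_r|apply Rmin_l]).
  assert (L3 : r <= r2) by (eapply Rle_trans; [apply Rmin_r|apply Rmin_r]).
  exists r. split; [lra|]. intros w Hw.
  assert (Q := singular_ode_unique y1 d1 e1 y2 d2 e2 p p' k r L0).
  rewrite Z1, Z2 in Q. change (y1 w = y2 w).
  assert (Sub : forall z, (z - 0)%C = z) by (intros; ring).
  rewrite <- (Cmult_1_r (y1 w)), Q; try (intros z Hz; (apply H1 || apply H2 || apply Hp || apply O1 || apply O2); lra);
    try exact Hw; try ring.
  - unfold p. ring.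
  - intros z Hz Nz. unfold p. apply Cmult_neq_0; [exact Nz|].
    apply Cmod_gt_0. specialize (K2 z). rewrite Sub in K2. specialize (K2 ltac:(lra)). lra.
  - intros z Hz. apply Cmod_gt_0. specialize (K1 z). rewrite Sub in K1. specialize (K1 ltac:(lra)). lra.
Qed.

(** * The cube root of unity and the cubic transformation *)

Lemma omega_eq : omega = (- (1 / 2), sqrt 3 / 2).
Proof. unfold omega. apply injective_projections; simpl; field. Qed.

Lemma sqrt3_sq : sqrt 3 * sqrt 3 = 3.
Proof. apply sqrt_sqrt. lra. Qed.

Lemma omega_sq : (omega * omega)%C = (- (1) - omega)%C.
Proof.
  pose proof sqrt3_sq as H. rewrite omega_eq. apply injective_projections; simpl; nra.
Qed.

Lemma Cmod_omega : Cmod omega = 1.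
Proof.
  pose proof sqrt3_sq as H. rewrite omega_eq. unfold Cmod. transitivity (sqrt 1); [|exact sqrt_1]. apply f_equal. simpl. lra.
Qed.

(** With the constant expressed through [omega], identities about [nu] become polynomial identities
    modulo [omega^2 = -1 - omega]. *)
Lemma three_sqrt3_i : (3 * sqrt 3 * Ci)%C = (6 * omega + 3)%C.
Proof. rewrite omega_eq. apply injective_projections; simpl; field. Qed.

Definition nu_lambda (l : C) : C :=
  (3 * sqrt 3 * Ci * (l * (1 - l)) /
   ((1 + omega * l) * (1 + omega * l) * (1 + omega * l)))%C.

Lemma one_minus_nu_lambda (l : C) : (1 + omega * l)%C <> RtoC 0 ->
  (1 - nu_lambda l)%C =
  ((1 + omega * omega * l) * (1 + omega * omega * l) * (1 + omega * omega * l) /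
   ((1 + omega * l) * (1 + omega * l) * (1 + omega * l)))%C.
Proof.
  intros N. unfold nu_lambda. rewrite three_sqrt3_i. pose proof omega_sq as W.
  field_simplify_eq; [|exact N]. cbv beta; ring [W].
Qed.

Lemma nu_lambda_bound (l : C) : Cmod l < 1 / 100 -> Cmod (nu_lambda l) < 1.
Proof.
  intros H. assert (Hw : Cmod (omega * l)%C = Cmod l) by (rewrite Cmod_mult, Cmod_omega; ring).
  assert (N : (1 + omega * l)%C <> RtoC 0) by (apply Cmod_1_plus_nz; lra).
  unfold nu_lambda. rewrite Cmod_div by (repeat apply Cmult_neq_0; exact N).
  rewrite !Cmod_mult, Cmod_Ci, !Cmod_R, !Rabs_pos_eq by (try apply sqrt_pos; lra).
  assert (T := Cmod_triangle_inv 1 (omega * l)%C). rewrite Cmod_1, Hw in T.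
  assert (T2 := Cmod_minus_le 1 l). rewrite Cmod_1 in T2.
  pose proof sqrt3_sq as S. pose proof (sqrt_pos 3) as S0.
  assert (S2 : sqrt 3 <= 2) by nra.
  pose proof (Cmod_ge_0 l). pose proof (Cmod_ge_0 (1 - l)%C).
  set (m := Cmod (1 + omega * l)%C) in *.
  assert (M1 : 99 / 100 <= m) by lra.
  assert (M2 : 9 / 10 <= m * m) by nra.
  assert (M3 : 8 / 10 <= m * m * m) by nra.
  apply Rmult_lt_reg_r with (m * m * m); [lra|].
  unfold Rdiv at 1. rewrite Rmult_assoc, Rinv_l by lra.
  assert (Q : Cmod l * Cmod (1 - l)%C <= 1 / 100 * 2) by (apply Rmult_le_compat; lra).
  nra.
Qed.

(** The map [l -> nu] has degree 3 with fibre 0, 1, infinity over 0 and one triple point over each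
    of 1 and infinity. The equation of [F(1/6, 1/2, 1)] has exponent differences 0 at 0 and 1/3 at 1
    and infinity. Pulling back triples the latter to 1, and after the factor [(1 + omega l)^(-1/2)]
    these two points are regular. What is left are singularities at 0, 1 and infinity with
    differences 0, as for [F(1/2, 1/2, 1)]. *)
Lemma cubic_transformation :
  exists r, 0 < r <= 1 / 100 /\ forall l, Cmod l < r ->
    hyp (1 / 2) (1 / 2) l =
    (hyp (1 / 2) 1 (- (omega * l)) * hyp (1 / 6) (1 / 2) (nu_lambda l))%C.
Proof.
  assert (Hh : Cmod (1 / 2)%C <= 1) by (rewrite Cmod_half; lra).
  assert (H6 : Cmod (1 / 6)%C <= 1) by (rewrite Cmod_sixth; lra).
  pose (c := (3 * sqrt 3 * Ci)%C).
  pose (u := fun l : C => (1 + omega * l)%C).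
  pose (v := fun l : C => (1 + omega * omega * l)%C).
  (* The derivative of [nu_lambda]; its numerator is a square because [nu = 1] is attained to third
     order where [v = 0]. *)
  pose (n1 := fun l : C => (c * (v l * v l) / (u l * u l * (u l * u l)))%C).
  pose (n2 := fun l : C => (c * (2 * (omega * omega) * v l * u l - 4 * omega * (v l * v l)) /
                           (u l * u l * (u l * u l) * u l))%C).
  pose (s := fun l : C => hyp (1 / 2) 1 (- (omega * l))%C).
  pose (y2 := fun l => (s l * hyp (1 / 6) (1 / 2) (nu_lambda l))%C).
  pose (d2 := fun l => (- (omega / 2) * s l / u l * hyp (1 / 6) (1 / 2) (nu_lambda l)
                        + s l * (hyp1 (1 / 6) (1 / 2) (nu_lambda l) * n1 l))%C).
  pose (e2 := fun l => (3 / 4 * (omega * omega) * s l / (u l * u l) * hyp (1 / 6) (1 / 2) (nu_lambda l)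
                        + 2 * (- (omega / 2) * s l / u l) * (hyp1 (1 / 6) (1 / 2) (nu_lambda l) * n1 l)
                        + s l * (hyp2 (1 / 6) (1 / 2) (nu_lambda l) * (n1 l * n1 l)
                                 + hyp1 (1 / 6) (1 / 2) (nu_lambda l) * n2 l))%C).
  pose (y1 := hyp (1 / 2) (1 / 2)).
  pose (d1 := hyp1 (1 / 2) (1 / 2)).
  pose (e1 := hyp2 (1 / 2) (1 / 2)).
  pose (p := fun l : C => (l * (1 - l))%C).
  pose (p' := fun l : C => (1 - 2 * l)%C).
  pose (k := fun _ : C => (1 / 4)%C).
  assert (Bw : forall l, Cmod l < 1 / 100 -> Cmod (- (omega * l))%C < 1).
  { intros l Hl. rewrite Cmod_opp, Cmod_mult, Cmod_omega. lra. }
  assert (Nu : forall l, Cmod l < 1 / 100 -> u l <> RtoC 0).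
  { intros l Hl. apply Cmod_1_plus_nz. specialize (Bw l Hl). now rewrite Cmod_opp in Bw. }
  assert (Du : forall l, cderiv u l omega).
  { intros l. unfold u. eapply cderiv_eq.
    - apply cderiv_plus; [apply cderiv_const|apply cderiv_scal, cderiv_id].
    - ring. }
  assert (Dv : forall l, cderiv v l (omega * omega)%C).
  { intros l. unfold v. eapply cderiv_eq.
    - apply cderiv_plus; [apply cderiv_const|apply cderiv_scal, cderiv_id].
    - ring. }
  pose proof omega_sq as W.
  assert (Dn : forall l, Cmod l < 1 / 100 -> cderiv nu_lambda l (n1 l)).
  { intros l Hl. unfold nu_lambda.
    apply cderiv_ext with (fun l => c * (l * (1 - l)) / (u l * u l * u l))%C; [reflexivity|].
    eapply cderiv_eq.
    - apply cderiv_div.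
      + apply cderiv_scal, cderiv_mult; [apply cderiv_id|].
        apply cderiv_minus; [apply cderiv_const|apply cderiv_id].
      + apply cderiv_mult; [apply cderiv_mult; apply Du|apply Du].
      + repeat apply Cmult_neq_0; now apply Nu.
    - unfold n1. specialize (Nu l Hl). unfold u, v in *. field_simplify_eq; [|exact Nu]. cbv beta; ring [W]. }
  assert (Dn1 : forall l, Cmod l < 1 / 100 -> cderiv n1 l (n2 l)).
  { intros l Hl. unfold n1. eapply cderiv_eq.
    - apply cderiv_div.
      + apply cderiv_scal, cderiv_mult; apply Dv.
      + apply cderiv_mult; apply cderiv_mult; apply Du.
      + repeat apply Cmult_neq_0; now apply Nu.
    - unfold n2. field. now apply Nu. }
  assert (Ds : forall l, Cmod l < 1 / 100 -> cderiv s l (- (omega / 2) * s l / u l)%C).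
  { intros l Hl. unfold s. eapply cderiv_eq.
    - apply (cderiv_binomial_comp (1 / 2) (fun l => - (omega * l))%C); auto.
      apply cderiv_opp, cderiv_scal, cderiv_id.
    - unfold u. field. now apply Nu. }
  assert (DG : forall l, Cmod l < 1 / 100 ->
     cderiv (fun l => hyp (1 / 6) (1 / 2) (nu_lambda l)) l (hyp1 (1 / 6) (1 / 2) (nu_lambda l) * n1 l)%C /\
     cderiv (fun l => hyp1 (1 / 6) (1 / 2) (nu_lambda l)) l (hyp2 (1 / 6) (1 / 2) (nu_lambda l) * n1 l)%C).
  { intros l Hl. destruct (cderiv_hyp (1 / 6) (1 / 2) (nu_lambda l) H6 Hh (nu_lambda_bound l Hl)) as [D1 D2].
    split; (apply (cderiv_comp _ nu_lambda); [now apply Dn|assumption]). }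
  assert (H2 : forall l, Cmod l < 1 / 100 -> cderiv y2 l (d2 l) /\ cderiv d2 l (e2 l)).
  { intros l Hl. destruct (DG l Hl) as [G1 G2]. split.
    - unfold y2. eapply cderiv_eq; [apply cderiv_mult; [now apply Ds|exact G1]|].
      unfold d2. ring.
    - unfold d2. eapply cderiv_eq.
      + apply cderiv_plus; apply cderiv_mult.
        * apply cderiv_div; [apply cderiv_scal; now apply Ds|apply Du|now apply Nu].
        * exact G1.
        * now apply Ds.
        * apply cderiv_mult; [exact G2|now apply Dn1].
      + unfold e2. cbv beta. field. now apply Nu. }
  assert (H1 : forall l, Cmod l < 1 / 100 -> cderiv y1 l (d1 l) /\ cderiv d1 l (e1 l)).
  { intros l Hl. apply (cderiv_hyp (1 / 2) (1 / 2) l Hh Hh). lra. }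
  assert (Hp : forall l, Cmod l < 1 / 100 -> cderiv p l (p' l)).
  { intros l Hl. unfold p. eapply cderiv_eq.
    - apply cderiv_mult; [apply cderiv_id|]. apply cderiv_minus; [apply cderiv_const|apply cderiv_id].
    - unfold p'. ring. }
  assert (O1 : forall l, Cmod l < 1 / 100 -> (p l * e1 l + p' l * d1 l)%C = (k l * y1 l)%C).
  { intros l Hl. assert (Od := hyp_ode (1 / 2) (1 / 2) l Hh Hh ltac:(lra)).
    apply Cminus_eq_0. unfold p, p', k, e1, d1, y1. rewrite <- Od. field. }
  assert (O2 : forall l, Cmod l < 1 / 100 -> (p l * e2 l + p' l * d2 l)%C = (k l * y2 l)%C).
  { intros l Hl. assert (Od := hyp_ode (1 / 6) (1 / 2) (nu_lambda l) H6 Hh (nu_lambda_bound l Hl)).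
    apply Cminus_eq_0. specialize (Nu l Hl).
    unfold p, p', k, e2, d2, y2.
    set (G := hyp (1 / 6) (1 / 2) (nu_lambda l)) in *. set (G1 := hyp1 (1 / 6) (1 / 2) (nu_lambda l)) in *.
    set (G2 := hyp2 (1 / 6) (1 / 2) (nu_lambda l)) in *.
    (* Again the multiplier comes from the coefficient of [G2]: [p s n1^2 / (nu (1 - nu))]. *)
    transitivity (s l * c * v l / (u l * u l) * RtoC 0)%C; [rewrite <- Od|ring].
    replace (nu_lambda l * (1 - nu_lambda l))%C
      with (c * (l * (1 - l)) * (v l * v l * v l) / (u l * u l * u l * (u l * u l * u l)))%C.
    2:{ rewrite one_minus_nu_lambda by exact Nu. unfold nu_lambda. fold c. unfold u, v in *. field. exact Nu. }
    unfold nu_lambda. fold c. unfold n1, n2. unfold c. rewrite three_sqrt3_i.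
    generalize (s l). intros sl. unfold u, v in *.
    field_simplify_eq; [|exact Nu]. cbv beta; ring [W]. }
  assert (R0 : Cmod (RtoC 0) < 1 / 100) by (rewrite Cmod_0; lra).
  assert (Z1 : y1 (RtoC 0) = RtoC 1) by apply hyp_0.
  assert (Z2 : y2 (RtoC 0) = RtoC 1).
  { unfold y2, s. replace (nu_lambda (RtoC 0)) with (RtoC 0).
    - replace (- (omega * RtoC 0))%C with (RtoC 0) by ring. rewrite !hyp_0. ring.
    - unfold nu_lambda. field. }
  destruct (ccont_nonzero y2 (RtoC 0)) as [r1 [R1 K1]].
  { eapply cderiv_ccont. now apply H2. }
  { rewrite Z2. apply RtoC_nz. lra. }
  rewrite Z2, Cmod_1 in K1.
  set (r := Rmin (1 / 100) r1).
  assert (L0 : 0 < r) by (apply Rmin_pos; lra).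
  assert (L1 : r <= 1 / 100) by apply Rmin_l.
  assert (L2 : r <= r1) by apply Rmin_r.
  exists r. split; [lra|]. intros l Hl.
  assert (Q := singular_ode_unique y1 d1 e1 y2 d2 e2 p p' k r L0).
  rewrite Z1, Z2 in Q. change (y1 l = y2 l).
  assert (Sub : forall z, (z - 0)%C = z) by (intros; ring).
  rewrite <- (Cmult_1_r (y1 l)), Q; try (intros z Hz; (apply H1 || apply H2 || apply Hp || apply O1 || apply O2); lra);
    try exact Hl; try ring.
  - unfold p. ring.
  - intros z Hz Nz. unfold p. apply Cmult_neq_0; [exact Nz|]. apply Cmod_1_minus_nz. lra.
  - intros z Hz. apply Cmod_gt_0. specialize (K1 z). rewrite Sub in K1. specialize (K1 ltac:(lra)). lra.
Qed.

(** * Continuation to the cut plane *)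

(** The principal square root by the half-angle formulas. On the cut [a = 0] makes the imaginary
    part meaningless, so it is used on [slit_plane] only. *)
Definition csqrt (z : C) : C :=
  let a := sqrt ((Cmod z + Re z) / 2) in (a, Im z / (2 * a)).

Definition slit_plane (z : C) : Prop := Im z = 0 -> 0 < Re z.

Lemma slit_plane_pos (z : C) : slit_plane z -> 0 < Cmod z + Re z.
Proof.
  intros H. destruct z as [x y]. simpl in *. unfold slit_plane in H. simpl in H.
  pose proof (re_le_Cmod (x, y)) as R. simpl in R.
  destruct (Req_dec y 0) as [E|N].
  - specialize (H E). pose proof (Cmod_ge_0 (x, y)). lra.
  - assert (Q := Cmod2_alt (x, y)). simpl in Q.
    assert (x < Cmod (x, y) /\ - x < Cmod (x, y)).
    { pose proof (Cmod_ge_0 (x, y)). assert (0 < y * y) by nra. split; nra. }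
    lra.
Qed.

Lemma csqrt_Re_pos (z : C) : slit_plane z -> 0 < Re (csqrt z).
Proof. intros H. apply slit_plane_pos in H. simpl. apply sqrt_lt_R0. lra. Qed.

Lemma csqrt_sq (z : C) : slit_plane z -> (csqrt z * csqrt z)%C = z.
Proof.
  intros H. pose proof (slit_plane_pos z H) as P. pose proof (csqrt_Re_pos z H) as P'.
  unfold csqrt in *. set (a := sqrt ((Cmod z + Re z) / 2)) in *. simpl in P'.
  assert (A : a * a = (Cmod z + Re z) / 2) by (apply sqrt_sqrt; lra).
  assert (Q := Cmod2_alt z). destruct z as [x y]. simpl in *.
  apply injective_projections; simpl.
  - set (m := Cmod (x, y)) in *. 
    replace (a * a - y / (2 * a) * (y / (2 * a))) with (a * a - y * y / 4 / (a * a)) by (field; lra).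
    rewrite A. replace (y * y) with ((m - x) * (m + x)) by nra. field. lra.
  - field. lra.
Qed.

Lemma slit_plane_open (z : C) : slit_plane z ->
  exists r, 0 < r /\ forall w, Cmod (w - z)%C < r -> slit_plane w.
Proof.
  intros H. pose proof (slit_plane_pos z H) as P. exists ((Cmod z + Re z) / 2). split; [lra|].
  intros w Hw. intros Ew.
  pose proof (Re_lip w z) as L1. pose proof (Cmod_lip w z) as L2.
  apply Rabs_le_between in L1. apply Rabs_le_between in L2.
  destruct (Rlt_le_dec 0 (Re w)) as [Q|Q]; [exact Q|exfalso].
  assert (E : Cmod w = - Re w).
  { destruct w as [x y]. simpl in *. rewrite Ew. change (x, 0) with (RtoC x).
    rewrite Cmod_R, Rabs_left1 by exact Q. reflexivity. }
  lra.
Qed.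

(** From [(csqrt w - s) (csqrt w + s) = w - z] the difference quotient is [1 / (csqrt w + s)]. Its
    denominator has modulus at least [Re s > 0], which gives continuity of the root and then of the
    quotient. *)
Lemma cderiv_csqrt (z : C) : slit_plane z -> cderiv csqrt z (/ (2 * csqrt z))%C.
Proof.
  intros H. destruct (slit_plane_open z H) as [r [Hr HB]].
  pose proof (csqrt_Re_pos z H) as P. set (s := csqrt z) in *.
  assert (Sn : forall w, slit_plane w -> (csqrt w + s)%C <> RtoC 0 /\ Re s <= Cmod (csqrt w + s)%C).
  { intros w Hw. pose proof (csqrt_Re_pos w Hw) as P'.
    assert (Q := re_le_Cmod (csqrt w + s)%C).
    assert (E : Re (csqrt w + s)%C = Re (csqrt w) + Re s) by reflexivity.
    rewrite E, Rabs_pos_eq in Q by lra. split; [apply Cmod_gt_0|]; lra. }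
  assert (Fac : forall w, slit_plane w -> ((csqrt w - s) * (csqrt w + s))%C = (w - z)%C).
  { intros w Hw. transitivity (csqrt w * csqrt w - s * s)%C; [ring|].
    unfold s. now rewrite !csqrt_sq. }
  assert (Ns : s <> RtoC 0).
  { apply Cmod_gt_0. pose proof (re_le_Cmod s) as Q. rewrite Rabs_pos_eq in Q; lra. }
  assert (Cs : ccont csqrt z).
  { intros e He. exists (Rmin r (e * Re s)). split; [apply Rmin_pos; nra|]. intros w Hw.
    assert (Hw1 : slit_plane w) by (apply HB; eapply Rlt_le_trans; [exact Hw|apply Rmin_l]).
    assert (Hw2 : Cmod (w - z)%C < e * Re s) by (eapply Rlt_le_trans; [exact Hw|apply Rmin_r]).
    fold s. rewrite <- Fac, Cmod_mult in Hw2 by exact Hw1. destruct (Sn w Hw1) as [_ Q].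
    pose proof (Cmod_ge_0 (csqrt w - s)%C). nra. }
  assert (Ci' : ccont (fun w => / (csqrt w + s))%C z).
  { apply ccont_inv; [apply ccont_plus; [exact Cs|apply ccont_const]|now apply Sn]. }
  apply cderiv_ext_loc with (f := fun w => (s + / (csqrt w + s) * (w - z))%C) (r := r); [exact Hr| |].
  - intros w Hw. apply HB in Hw. rewrite <- (Fac w Hw). field. now apply Sn.
  - exists (fun w => / (csqrt w + s))%C. split; [|split; [|exact Ci']].
    + intros w. rewrite Cminus_diag. ring.
    + fold s. apply f_equal. ring.
Qed.

Lemma cut_plane_slit (z : C) : cut_plane z <-> slit_plane (1 - z)%C.
Proof.
  unfold cut_plane, slit_plane. destruct z as [x y]. simpl. split.
  - intros H E. apply Rnot_le_lt. intros Q. apply H. lra.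
  - intros H [E Q]. specialize (H ltac:(lra)). lra.
Qed.

Lemma unit_disc_cut_plane (z : C) : unit_disc z -> cut_plane z.
Proof.
  intros H [_ Q]. unfold unit_disc in H. pose proof (re_le_Cmod z) as R.
  rewrite Rabs_pos_eq in R; lra.
Qed.

(** Gives content to the [epsilon] in [hypergeom]. Solved for [F(a, 1/2, 1; z)], the quadratic
    transformation has a right-hand side that makes sense whenever [|w| < 1]. *)
Lemma hypergeom_continuation_exists (a : C) : Cmod a <= 1 / 2 ->
  exists g, analytic_continuation unit_disc cut_plane
              (hypergeom_series a (1 / 2)%C (RtoC 1)) g.
Proof.
  intros Ha'. assert (Ha : Cmod a <= 1) by lra.
  assert (H2a : Cmod (2 * a)%C <= 1) by (rewrite Cmod_mult, Cmod_R, Rabs_pos_eq; lra).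
  assert (H2a' : Cmod (- (2 * a))%C <= 1) by now rewrite Cmod_opp.
  assert (Hh : Cmod (1 / 2)%C <= 1) by (rewrite Cmod_half; lra).
  (* [z = 4 w / (1 + w)^2] maps the unit disc onto the cut plane. *)
  pose (w := fun z => ((1 - csqrt (1 - z)) / (1 + csqrt (1 - z)))%C).
  assert (N1 : forall z, cut_plane z -> (1 + csqrt (1 - z))%C <> RtoC 0).
  { intros z Hz. apply cut_plane_slit, csqrt_Re_pos in Hz.
    intros E. apply (f_equal Re) in E. change (1 + Re (csqrt (1 - z)%C) = 0) in E. lra. }
  assert (Wd : forall z, cut_plane z -> Cmod (w z) < 1).
  { intros z Hz. pose proof (N1 z Hz) as N. apply cut_plane_slit, csqrt_Re_pos in Hz.
    unfold w. rewrite Cmod_div by exact N. pose proof (proj1 (Cmod_gt_0 _) N) as P.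
    apply Rmult_lt_reg_r with (Cmod (1 + csqrt (1 - z))%C); [exact P|].
    unfold Rdiv. rewrite Rmult_assoc, Rinv_l, Rmult_1_l, Rmult_1_r by lra.
    clear -Hz. destruct (csqrt (1 - z)%C) as [x y]. simpl in Hz.
    apply sqrt_lt_1_alt. simpl. split; [|lra].
    pose proof (Rle_0_sqr (1 + - x)). pose proof (Rle_0_sqr (0 + - y)). unfold Rsqr in *. lra. }
  assert (Wz : forall z, cut_plane z -> (4 * w z / ((1 + w z) * (1 + w z)))%C = z).
  { intros z Hz. pose proof (N1 z Hz) as N. apply cut_plane_slit, csqrt_sq in Hz.
    transitivity (1 - csqrt (1 - z) * csqrt (1 - z))%C; [|rewrite Hz; ring].
    unfold w. field. split; [exact N|].
    replace (1 + csqrt (1 - z) + (1 - csqrt (1 - z)))%C with (RtoC 2) by ring. apply RtoC_nz. lra. }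
  assert (Dw : forall z, cut_plane z -> exists l, cderiv w z l).
  { intros z Hz. assert (D : cderiv (fun z => csqrt (1 - z)%C) z (/ (2 * csqrt (1 - z)) * (0 - 1))%C).
    { apply (cderiv_comp csqrt (fun z => 1 - z)%C).
      - apply cderiv_minus; [apply cderiv_const|apply cderiv_id].
      - apply cderiv_csqrt. now apply cut_plane_slit. }
    eexists. unfold w. apply cderiv_div; [| |now apply N1].
    - apply cderiv_minus; [apply cderiv_const|exact D].
    - apply cderiv_plus; [apply cderiv_const|exact D]. }
  (* The first factor is [(1 + w)^(2a)]. *)
  pose (g := fun z => (hyp (- (2 * a)) 1 (- w z) * hyp a a (w z * w z))%C).
  assert (Dg : forall z, cut_plane z -> exists l, cderiv g z l).
  { intros z Hz. destruct (Dw z Hz) as [l Dl]. pose proof (Wd z Hz) as Bw.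
    assert (B2 : Cmod (w z * w z)%C < 1).
    { rewrite Cmod_sq. pose proof (Cmod_ge_0 (w z)). nra. }
    destruct (cderiv_hyp a a (w z * w z)%C Ha Ha B2) as [D1 _].
    eexists. unfold g. apply cderiv_mult.
    - apply (cderiv_binomial_comp _ (fun z => - w z)%C); [exact H2a'|now rewrite Cmod_opp|].
      apply cderiv_opp. exact Dl.
    - apply (cderiv_comp (hyp a a) (fun z => w z * w z)%C); [apply cderiv_mult; exact Dl|exact D1]. }
  exists g. split; [exact unit_disc_cut_plane|]. split.
  { apply holomorphic_onE. exact Dg. }
  intros z Hz. apply Cminus_eq_0.
  change (hypergeom_series a (1 / 2)%C (RtoC 1) z) with (hyp a (1 / 2) z).
  destruct (quadratic_transformation a Ha H2a) as [r [Hr HQ]].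
  assert (C0 : cut_plane (RtoC 0)) by (apply unit_disc_cut_plane; unfold unit_disc; rewrite Cmod_0; lra).
  assert (W0 : w (RtoC 0) = RtoC 0).
  { unfold w. replace (csqrt (1 - 0)) with (RtoC 1); [field|].
    unfold csqrt. simpl. replace (1 - 0)%C with (RtoC 1) by ring.
    rewrite Cmod_1. simpl. replace ((1 + (1 + - 0)) / 2) with 1 by field. rewrite sqrt_1.
    apply injective_projections; simpl; field. }
  destruct (Dw _ C0) as [l0 Dl0]. apply cderiv_ccont in Dl0.
  destruct (Dl0 r ltac:(lra)) as [d [Hd Kd]].
  (* The transformation is known only for small [w], that is for [z] near 0; the identity theorem
     carries the agreement to the whole unit disc. *)
  apply (disc_identity (fun z => g z - hyp a (1 / 2) z)%C (RtoC 0) (Rmin d 1) 1).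
  - apply Rmin_pos; lra.
  - intros x Hx. replace (x - 0)%C with x in Hx by ring.
    destruct (Dg x (unit_disc_cut_plane x Hx)) as [l Hl].
    destruct (cderiv_hyp a (1 / 2) x Ha Hh Hx) as [D1 _].
    eexists. apply cderiv_minus; [exact Hl|exact D1].
  - intros x Hx.
    assert (X1 : Cmod (x - 0)%C < d) by (eapply Rlt_le_trans; [exact Hx|apply Rmin_l]).
    assert (X2 : Cmod (x - 0)%C < 1) by (eapply Rlt_le_trans; [exact Hx|apply Rmin_r]).
    replace (x - 0)%C with x in X2 by ring.
    specialize (Kd x X1). rewrite W0 in Kd. replace (w x - 0)%C with (w x) in Kd by ring.
    pose proof (unit_disc_cut_plane x X2) as Cx.
    unfold g. rewrite (HQ (w x) Kd), (Wz x Cx).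
    assert (Bo := binomial_opp (2 * a) (- w x)%C H2a).
    rewrite Cmod_opp in Bo. specialize (Bo (Wd x Cx)).
    transitivity ((hyp (2 * a) 1 (- w x) * hyp (- (2 * a)) 1 (- w x) - 1) * hyp a (1 / 2) x)%C; [ring|].
    rewrite Bo. ring.
  - replace (z - 0)%C with z by ring. exact Hz.
Qed.

Lemma hypergeom_spec (a : C) : Cmod a <= 1 / 2 ->
  holomorphic_on cut_plane (hypergeom a (1 / 2)%C (RtoC 1)) /\
  forall z, Cmod z < 1 -> hypergeom a (1 / 2)%C (RtoC 1) z = hyp a (1 / 2) z.
Proof.
  intros Ha.
  pose proof (epsilon_spec (inhabits (fun _ : C => RtoC 0)) _ (hypergeom_continuation_exists a Ha))
    as [_ [H1 H2]].
  split; [exact H1|]. intros z Hz. exact (H2 z Hz).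
Qed.

(** * Theta functions *)

(** The half of Jacobi's series over [n >= 0]: it is a power series in [v], entire for [|q| < 1]. *)
Definition half_theta (q v : C) : C := PS (fun n => q ^ (n * n))%C v.

(** The terms are [(|q|^n s)^n], at most 1 once [|q|^n <= 1 / (s + 1)]; the finitely many earlier
    ones are at most [(s + 1)^N]. *)
Lemma rad_gauss (q : C) (r : R) : Cmod q < 1 -> rad (fun n => q ^ (n * n))%C r.
Proof.
  intros Hq s Hs. pose proof (Cmod_ge_0 q) as Q0.
  destruct (pow_lt_1_zero (Cmod q) ltac:(rewrite Rabs_pos_eq; lra) (/ (s + 1))) as [N HN].
  { apply Rinv_0_lt_compat. lra. }
  exists ((s + 1) ^ N). intros n. rewrite Cmod_pow, pow_mult, <- Rpow_mult_distr.
  assert (Qn : 0 <= Cmod q ^ n) by now apply pow_le.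
  destruct (le_lt_dec N n) as [L|L].
  - specialize (HN n L). rewrite Rabs_pos_eq in HN by exact Qn.
    apply Rle_trans with (1 ^ n).
    + apply pow_incr. split; [nra|].
      apply Rle_trans with (/ (s + 1) * (s + 1)); [|rewrite Rinv_l; lra].
      apply Rmult_le_compat; lra.
    + rewrite pow1. apply pow_R1_Rle. lra.
  - apply Rle_trans with ((s + 1) ^ n).
    + apply pow_incr. split; [nra|].
      assert (Cmod q ^ n <= 1) by (rewrite <- (pow1 n); apply pow_incr; lra). nra.
    + apply Rle_pow; [lra|lia].
Qed.

Lemma half_theta_summable (q v : C) : Cmod q < 1 ->
  abs_summable (fun n => q ^ (n * n) * v ^ n)%C.
Proof. intros H. apply PS_summable with (Cmod v + 1); [now apply rad_gauss|lra]. Qed.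

Lemma cderiv_half_theta (q v : C) : Cmod q < 1 -> exists l, cderiv (half_theta q) v l.
Proof.
  intros H. eexists. apply PS_cderiv with (Cmod v + 1); [now apply rad_gauss|lra].
Qed.

Lemma half_theta_shift (q v : C) : Cmod q < 1 ->
  half_theta q v = (1 + q * v * half_theta q (q * q * v))%C.
Proof.
  intros H. unfold half_theta, PS. rewrite CSeries_incr by now apply half_theta_summable.
  rewrite <- CSeries_scal by now apply half_theta_summable.
  apply f_equal2; [simpl; ring|]. apply CSeries_ext. intros n.
  replace (S n * S n)%nat with (n * n + n + n + 1)%nat by lia.
  rewrite !Cpow_add_r, !Cpow_mult_l, Cpow_S. simpl. ring.
Qed.

(** The bilateral series of [q^(n^2) exp(2 pi i n z)]; 1 is subtracted because both halves contain
    the term [n = 0]. *)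
Definition jacobi_theta (q z : C) : C :=
  (half_theta q (cis 1 z) + half_theta q (cis (-1) z) - 1)%C.

Lemma cderiv_jacobi_theta (q z : C) : Cmod q < 1 -> exists l, cderiv (jacobi_theta q) z l.
Proof.
  intros H. destruct (cderiv_half_theta q (cis 1 z) H) as [l1 L1].
  destruct (cderiv_half_theta q (cis (-1) z) H) as [l2 L2].
  eexists. unfold jacobi_theta. apply cderiv_minus; [|apply cderiv_const].
  apply cderiv_plus; (eapply (cderiv_comp (half_theta q)); [apply cderiv_cis|eassumption]).
Qed.

Lemma jacobi_theta_period (q z : C) : jacobi_theta q (z + 1)%C = jacobi_theta q z.
Proof. unfold jacobi_theta. now rewrite !cis_period. Qed.

Lemma cis_opp (n : Z) (z : C) : cis n (- z)%C = cis (- n) z.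
Proof. unfold cis. rewrite opp_IZR, RtoC_opp. apply f_equal. ring. Qed.

Lemma cis_m1 (z : C) : cis (-1) z = (/ cis 1 z)%C.
Proof. unfold cis. rewrite <- Cexp_opp. apply f_equal. ring. Qed.

Lemma jacobi_theta_even (q z : C) : jacobi_theta q (- z)%C = jacobi_theta q z.
Proof. unfold jacobi_theta. rewrite !cis_opp. simpl. ring. Qed.

Definition nome (tau : C) : C := Cexp (PI * Ci * tau)%C.

Lemma Cmod_nome (tau : C) : Cmod (nome tau) = exp (- (PI * Im tau)).
Proof. unfold nome. rewrite Cmod_Cexp. apply f_equal. destruct tau as [x y]. simpl. ring. Qed.

Lemma nome_nz (tau : C) : nome tau <> RtoC 0.
Proof. apply Cexp_nz. Qed.

Lemma nome_lt_1 (tau : C) : 0 < Im tau -> Cmod (nome tau) < 1.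
Proof.
  intros H. rewrite Cmod_nome, <- exp_0. apply exp_increasing. pose proof PI_RGT_0. nra.
Qed.

Lemma nome_double (tau : C) : nome (2 * tau)%C = (nome tau * nome tau)%C.
Proof. unfold nome. rewrite <- Cexp_plus. apply f_equal. ring. Qed.

Lemma cis_1_tau (tau : C) : cis 1 tau = (nome tau * nome tau)%C.
Proof. unfold cis, nome. rewrite <- Cexp_plus. apply f_equal. ring. Qed.

Lemma cis_m2 (z : C) : cis (-2) z = (/ (cis 1 z * cis 1 z))%C.
Proof. unfold cis. rewrite <- Cexp_plus, <- Cexp_opp. apply f_equal. ring. Qed.

Lemma cis_1_half_tau (tau : C) : cis 1 (tau / 2)%C = nome tau.
Proof. unfold cis, nome. apply f_equal. field. Qed.

Lemma cis_1_half : cis 1 (1 / 2)%C = RtoC (-1).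
Proof.
  replace (1 / 2)%C with (RtoC (1 / 2)) by (rewrite RtoC_div by lra; reflexivity).
  rewrite cis_R. replace (2 * PI * 1 * (1 / 2)) with PI by field. rewrite cos_PI, sin_PI. reflexivity.
Qed.

Lemma jacobi_theta_quasi (tau z : C) : 0 < Im tau ->
  jacobi_theta (nome tau) (z + tau)%C = (/ nome tau * cis (-1) z * jacobi_theta (nome tau) z)%C.
Proof.
  intros H. apply nome_lt_1 in H. pose proof (nome_nz tau) as Nq. pose proof (cis_nz 1 z) as Nw.
  unfold jacobi_theta. rewrite !(cis_m1), cis_plus_r, (cis_1_tau tau).
  set (q := nome tau) in *. set (w := cis 1 z) in *.
    rewrite (half_theta_shift q (/ (w * (q * q)))%C) by exact H.
  rewrite (half_theta_shift q w) by exact H.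
  replace (q * q * / (w * (q * q)))%C with (/ w)%C by (field; now split).
  replace (w * (q * q))%C with (q * q * w)%C by ring.
  field. now split.
Qed.

(** The theta constants as functions of the nome. In [th10] the factor [q^(1/4)] is left out, so
    that all three are single-valued and holomorphic in the unit disc. *)
Definition th00 (q : C) : C := (2 * half_theta q 1 - 1)%C.
Definition th01 (q : C) : C := (2 * half_theta q (-1) - 1)%C.
Definition th10 (q : C) : C := (2 * half_theta q q)%C.

Lemma jacobi_theta_0 (q : C) : jacobi_theta q (RtoC 0) = th00 q.
Proof. unfold jacobi_theta, th00. rewrite !cis_at_0. ring. Qed.

Lemma jacobi_theta_half (q : C) : jacobi_theta q (1 / 2)%C = th01 q.
Proof.
  unfold jacobi_theta, th01. rewrite cis_m1, cis_1_half.
  replace (/ RtoC (-1))%C with (RtoC (-1)) by field. ring.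
Qed.

Lemma jacobi_theta_half_tau (tau : C) : 0 < Im tau ->
  jacobi_theta (nome tau) (tau / 2)%C = th10 (nome tau).
Proof.
  intros H. apply nome_lt_1 in H. pose proof (nome_nz tau) as Nq.
  unfold jacobi_theta, th10. rewrite cis_m1, cis_1_half_tau. set (q := nome tau) in *.
  rewrite (half_theta_shift q (/ q)%C) by exact H.
  replace (q * q * / q)%C with q by (field; exact Nq). field. exact Nq.
Qed.

Lemma jacobi_theta_zero (tau : C) : 0 < Im tau ->
  jacobi_theta (nome tau) (1 / 2 + tau / 2)%C = RtoC 0.
Proof.
  intros H. apply nome_lt_1 in H. pose proof (nome_nz tau) as Nq.
    unfold jacobi_theta. rewrite cis_m1, cis_plus_r, cis_1_half, cis_1_half_tau. set (q := nome tau) in *.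
  rewrite (half_theta_shift q (/ (RtoC (-1) * q))%C) by exact H.
  replace (q * q * / (RtoC (-1) * q))%C with (RtoC (-1) * q)%C by (field; exact Nq). field. exact Nq.
Qed.

(** * Fourier coefficients of quasi-periodic entire functions, and theta duplication *)

Lemma periodic_shift_int (F : C -> C) (w : C) :
  (forall z, ccont F z) -> (forall z, F (z + 1)%C = F z) ->
  CInt (fun t => F (t + w)%C) 0 1 = CInt (fun t => F (t, Im w)) 0 1.
Proof.
  intros HC Hp. destruct w as [x y]. simpl.
  set (s := x - IZR (Int_part x)).
  assert (Hs : 0 <= s < 1) by (destruct (base_fp x) as [F1 F2]; unfold frac_part in *; unfold s; lra).
  pose (g := fun t => F (t, y)).
  assert (Cg : forall t, rcont g t) by (intros t; apply rcont_horiz, HC).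
  assert (Pg : forall t, g (t + 1) = g t).
  { intros t. unfold g. rewrite <- (Hp (t, y)). f_equal. apply injective_projections; simpl; ring. }
  rewrite (CInt_ext _ (fun t => g (t + s)) 0 1); [|lra|].
  2:{ intros t _. unfold g. rewrite <- (periodic_Z F Hp (Int_part x) (t + s, y)). f_equal.
      unfold s. apply injective_projections; simpl; ring. }
  rewrite CInt_shift by (try lra; intros t _; apply Cg).
  rewrite <- (CInt_Chasles g (0 + s) 1 (1 + s)) by (try lra; intros t _; apply Cg).
  change (fun t => F (t, y)) with g.
  rewrite <- (CInt_Chasles g 0 s 1) by (try lra; intros t _; apply Cg).
  rewrite Rplus_0_l, Cplus_comm. f_equal.
  assert (Q := CInt_shift g 0 s 1 ltac:(lra) ltac:(intros t _; apply Cg)).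
  replace (0 + 1) with 1 in Q by ring. rewrite (Rplus_comm s 1) in Q. rewrite <- Q.
  apply CInt_ext; [lra|]. intros t _. apply Pg.
Qed.

(** With this sign, [fcoef E n] is the coefficient of [exp(-2 pi i n z)]. *)
Definition fcoef (E : C -> C) (n : Z) : C := CInt (fun t => E t * cis n t)%C 0 1.

Definition entire (E : C -> C) : Prop := forall z, exists l, cderiv E z l.

Lemma entire_ccont (E : C -> C) (z : C) : entire E -> ccont E z.
Proof. intros H. destruct (H z) as [l Hl]. now apply cderiv_ccont in Hl. Qed.

(** Moving the path from [[0, 1]] to [[tau, tau + 1]] does not change the integral of [E * cis n],
    and quasi-periodicity turns the new one into a coefficient with index lowered by [N]. So [N]
    consecutive coefficients determine all others. *)
Lemma fcoef_quasi_periodic (E : C -> C) (tau K : C) (N : Z) :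
  0 < Im tau -> entire E -> (forall z, E (z + 1)%C = E z) ->
  (forall z, E (z + tau)%C = (K * cis (- N) z * E z)%C) ->
  forall n, fcoef E n = (K * cis n tau * fcoef E (n - N))%C.
Proof.
  intros Ht HE Hp Hq n. unfold fcoef.
  pose (F := fun z => (E z * cis n z)%C).
  assert (DF : forall z, exists l, cderiv F z l).
  { intros z. destruct (HE z) as [l Hl]. eexists. apply cderiv_mult; [exact Hl|apply cderiv_cis]. }
  assert (PF : forall z, F (z + 1)%C = F z) by (intros z; unfold F; now rewrite Hp, cis_period).
  assert (Q := periodic_line_int F 0 (Im tau) ltac:(lra) (fun z _ => DF z) PF).
  rewrite <- (periodic_shift_int F tau (fun z => entire_ccont F z DF) PF) in Q.
  change (CInt (fun t => F (t, 0)) 0 1) with (CInt (fun t => E t * cis n t)%C 0 1) in Q.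
  rewrite Q, <- CInt_scal.
  - apply CInt_ext; [lra|]. intros t _. unfold F. rewrite Hq, cis_plus_r.
    unfold Z.sub. rewrite cis_plus_l. ring.
  - lra.
  - intros t _. apply rcont_mult; [|apply rcont_cis]. apply rcont_ccont, entire_ccont, HE.
Qed.

Lemma quasi_periodic_0_1 (E : C -> C) (tau K : C) :
  0 < Im tau -> entire E -> K <> RtoC 0 -> (forall z, E (z + 1)%C = E z) ->
  (forall z, E (z + tau)%C = (K * cis (-1) z * E z)%C) -> fcoef E 0 = RtoC 0 ->
  forall x y, 0 <= y -> E (x, y) = RtoC 0.
Proof.
  intros Ht HE HK Hp Hq H0. apply entire_periodic_0; auto.
  assert (R := fcoef_quasi_periodic E tau K 1 Ht HE Hp Hq). fold (fcoef E).
  assert (Up : forall n, fcoef E n = RtoC 0 -> fcoef E (n + 1) = RtoC 0).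
  { intros n Hn. rewrite R. replace (n + 1 - 1)%Z with n by lia. rewrite Hn. ring. }
  assert (Dn : forall n, fcoef E n = RtoC 0 -> fcoef E (n - 1) = RtoC 0).
  { intros n Hn. rewrite R in Hn. apply NNPP. intros Nz.
    apply (Cmult_neq_0 _ _ (Cmult_neq_0 _ _ HK (cis_nz n tau)) Nz Hn). }
  intros n. change (fcoef E n = RtoC 0). revert n. apply Z.bi_induction; [intros ? ? ->; reflexivity|exact H0|].
  intros n. split; intros Hn.
  - now apply Up.
  - replace n with (Z.succ n - 1)%Z by lia. now apply Dn.
Qed.

Lemma quasi_periodic_0_2 (E : C -> C) (tau K : C) :
  0 < Im tau -> entire E -> K <> RtoC 0 -> (forall z, E (z + 1)%C = E z) ->
  (forall z, E (z + tau)%C = (K * cis (-2) z * E z)%C) ->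
  fcoef E 0 = RtoC 0 -> fcoef E 1 = RtoC 0 ->
  forall x y, 0 <= y -> E (x, y) = RtoC 0.
Proof.
  intros Ht HE HK Hp Hq H0 H1. apply entire_periodic_0; auto.
  assert (R := fcoef_quasi_periodic E tau K 2 Ht HE Hp Hq).
  assert (Up : forall n, fcoef E n = RtoC 0 -> fcoef E (n + 2) = RtoC 0).
  { intros n Hn. rewrite R. replace (n + 2 - 2)%Z with n by lia. rewrite Hn. ring. }
  assert (Dn : forall n, fcoef E n = RtoC 0 -> fcoef E (n - 2) = RtoC 0).
  { intros n Hn. rewrite R in Hn. apply NNPP. intros Nz.
    apply (Cmult_neq_0 _ _ (Cmult_neq_0 _ _ HK (cis_nz n tau)) Nz Hn). }
  assert (All : forall n, fcoef E n = RtoC 0 /\ fcoef E (n + 1) = RtoC 0).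
  { apply Z.bi_induction; [intros ? ? ->; reflexivity|now split|].
    intros n. split; intros [A1 A2].
    - split; [exact A2|]. replace (Z.succ n + 1)%Z with (n + 2)%Z by lia. now apply Up.
    - split; [|exact A1]. replace n with (Z.succ n + 1 - 2)%Z by lia. now apply Dn. }
  intros n. exact (proj1 (All n)).
Qed.

Lemma half_antiperiodic_int (f : R -> C) :
  (forall t, rcont f t) -> (forall t, f (t + 1 / 2) = (- f t)%C) -> CInt f 0 1 = RtoC 0.
Proof.
  intros Hc Ha. rewrite <- (CInt_Chasles f 0 (1 / 2) 1) by (try lra; intros t _; apply Hc).
  assert (Q := CInt_shift f 0 (1 / 2) (1 / 2) ltac:(lra) ltac:(intros t _; apply Hc)).
  replace (0 + 1 / 2) with (1 / 2) in Q by ring. replace (1 / 2 + 1 / 2) with 1 in Q by field.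
  rewrite <- Q. rewrite (CInt_ext (fun t => f (t + 1 / 2)) (fun t => RtoC (-1) * f t)%C 0 (1 / 2)); [|lra|].
  - rewrite CInt_scal by (try lra; intros t _; apply Hc). ring.
  - intros t _. rewrite Ha. ring.
Qed.

Lemma fcoef_minus_scal (E F : C -> C) (c : C) (n : Z) : entire E -> entire F ->
  fcoef (fun z => E z - c * F z)%C n = (fcoef E n - c * fcoef F n)%C.
Proof.
  intros HE HF. unfold fcoef.
  assert (Q : forall G, entire G -> rcont_on (fun t => G t * cis n t)%C 0 1).
  { intros G HG t _. apply rcont_mult; [|apply rcont_cis]. apply rcont_ccont, entire_ccont, HG. }
  rewrite (CInt_ext _ (fun t => E t * cis n t + (- c) * (F t * cis n t))%C 0 1); [|lra|intros t _; ring].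
  rewrite CInt_plus, CInt_scal; try lra; try (now apply Q); [ring|].
  intros t Ht. apply rcont_scal. now apply Q.
Qed.

Lemma entire_minus_scal (E F : C -> C) (c : C) : entire E -> entire F ->
  entire (fun z => E z - c * F z)%C.
Proof.
  intros HE HF z. destruct (HE z) as [l L]. destruct (HF z) as [m M].
  eexists. apply cderiv_minus; [exact L|]. apply cderiv_scal. exact M.
Qed.

(* The square of a theta function is a section of degree 2, so it lies in the
   span of [theta(2 tau, 2 z)] and [e^(2 pi i z) theta(2 tau, 2 z + tau)]; the
   zero of theta at [(1 + tau) / 2] fixes the ratio of the two coefficients. *)
Lemma theta_duplication (tau : C) : 0 < Im tau ->
  let q := nome tau in
  th00 (q * q) <> RtoC 0 -> th10 (q * q) <> RtoC 0 ->
  exists k : C,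
    (th00 q * th00 q)%C = (k * (th00 (q * q) * th00 (q * q) + q * (th10 (q * q) * th10 (q * q))))%C /\
    (th01 q * th01 q)%C = (k * (th00 (q * q) * th00 (q * q) - q * (th10 (q * q) * th10 (q * q))))%C /\
    (th10 q * th10 q)%C = (2 * k * (th00 (q * q) * th10 (q * q)))%C.
Proof.
  intros Ht q Na Nd.
  assert (Hq : Cmod q < 1) by now apply nome_lt_1.
  assert (Ht2 : 0 < Im (2 * tau)%C) by (destruct tau as [x y]; simpl in *; lra).
  assert (Eq : nome (2 * tau)%C = (q * q)%C) by apply nome_double.
  assert (Hq2 : Cmod (q * q)%C < 1) by (rewrite <- Eq; now apply nome_lt_1).
  assert (Nq : q <> RtoC 0) by apply nome_nz.
  pose (F := fun z => (jacobi_theta q z * jacobi_theta q z)%C).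
  pose (f0 := fun z => jacobi_theta (q * q) (2 * z)%C).
  pose (f1 := fun z => (cis 1 z * jacobi_theta (q * q) (2 * z + tau))%C).
  assert (DF : entire F).
  { intros z. destruct (cderiv_jacobi_theta q z Hq) as [l L]. eexists. apply cderiv_mult; exact L. }
  assert (D0 : entire f0).
  { intros z. destruct (cderiv_jacobi_theta (q * q) (2 * z)%C Hq2) as [l L].
    eexists. apply (cderiv_comp (jacobi_theta (q * q)) (fun z => 2 * z)%C); [apply cderiv_scal, cderiv_id|exact L]. }
  assert (D1 : entire f1).
  { intros z. destruct (cderiv_jacobi_theta (q * q) (2 * z + tau)%C Hq2) as [l L].
    eexists. apply cderiv_mult; [apply cderiv_cis|].
    apply (cderiv_comp (jacobi_theta (q * q)) (fun z => 2 * z + tau)%C); [|exact L].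
    apply cderiv_plus; [apply cderiv_scal, cderiv_id|apply cderiv_const]. }
  assert (P2 : forall z, jacobi_theta (q * q) (z + 2)%C = jacobi_theta (q * q) z).
  { intros z. replace (z + 2)%C with (z + 1 + 1)%C by ring. now rewrite !jacobi_theta_period. }
  assert (PF : forall z, F (z + 1)%C = F z) by (intros z; unfold F; now rewrite jacobi_theta_period).
  assert (P0 : forall z, f0 (z + 1)%C = f0 z).
  { intros z. unfold f0. replace (2 * (z + 1))%C with (2 * z + 2)%C by ring. apply P2. }
  assert (P1 : forall z, f1 (z + 1)%C = f1 z).
  { intros z. unfold f1. replace (2 * (z + 1) + tau)%C with (2 * z + tau + 2)%C by ring.
    now rewrite P2, cis_period. }
  set (K := (/ (q * q))%C).
  assert (NK : K <> RtoC 0).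
  { intros E0. apply (Cmult_neq_0 _ _ Nq Nq). unfold K in E0.
    rewrite <- (Cmult_1_r (q * q)), <- (Cinv_r (q * q)) by now apply Cmult_neq_0.
    rewrite E0. ring. }
  assert (QF : forall z, F (z + tau)%C = (K * cis (-2) z * F z)%C).
  { intros z. unfold F, q. rewrite jacobi_theta_quasi by exact Ht. fold q.
    rewrite cis_m1, cis_m2. unfold K. field. split; first [exact Nq | apply cis_nz]. }
  assert (Q2 : forall z, jacobi_theta (q * q) (z + 2 * tau)%C =
                (/ (q * q) * cis (-1) z * jacobi_theta (q * q) z)%C).
  { intros z. rewrite <- Eq. now apply jacobi_theta_quasi. }
  assert (Q0 : forall z, f0 (z + tau)%C = (K * cis (-2) z * f0 z)%C).
  { intros z. unfold f0. replace (2 * (z + tau))%C with (2 * z + 2 * tau)%C by ring.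
    rewrite Q2, cis_m1, cis_m2. replace (2 * z)%C with (z + z)%C by ring. rewrite cis_plus_r. reflexivity. }
  assert (Q1 : forall z, f1 (z + tau)%C = (K * cis (-2) z * f1 z)%C).
  { intros z. unfold f1. replace (2 * (z + tau) + tau)%C with (2 * z + tau + 2 * tau)%C by ring.
    rewrite Q2, cis_m1, cis_m2. replace (2 * z + tau)%C with (z + z + tau)%C by ring.
    rewrite !cis_plus_r, (cis_1_tau tau). fold q. unfold K. field. split; first [exact Nq | apply cis_nz]. }
  assert (HalfE : forall t : R, RtoC (t + 1 / 2) = (t + 1 / 2)%C).
  { intros t. rewrite RtoC_plus. f_equal. rewrite RtoC_div by lra. reflexivity. }
  (* [f0] has period 1/2, and [f1] changes sign under the shift by 1/2. So each has coefficients of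
     one parity only, and the linear system for [c0] and [c1] is diagonal. *)
  assert (C01 : fcoef f0 1 = RtoC 0).
  { apply half_antiperiodic_int.
    - intros t. apply rcont_mult; [|apply rcont_cis]. apply rcont_ccont, entire_ccont, D0.
    - intros t. rewrite HalfE. unfold f0. replace (2 * (t + 1 / 2))%C with (2 * t + 1)%C by field.
      rewrite jacobi_theta_period, cis_plus_r, cis_1_half. ring. }
  assert (C10 : fcoef f1 0 = RtoC 0).
  { apply half_antiperiodic_int.
    - intros t. apply rcont_mult; [|apply rcont_cis]. apply rcont_ccont, entire_ccont, D1.
    - intros t. rewrite HalfE, !cis_0. unfold f1. replace (2 * (t + 1 / 2) + tau)%C with (2 * t + tau + 1)%C by field.
      rewrite jacobi_theta_period, cis_plus_r, cis_1_half. ring. }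
  (* Otherwise [f0] would vanish on the closed upper half-plane, in particular at 0, where its value
     is [th00 (q * q)]. *)
  assert (C00 : fcoef f0 0 <> RtoC 0).
  { intros Z. apply Na. rewrite <- jacobi_theta_0.
    assert (V := quasi_periodic_0_2 f0 tau K Ht D0 NK P0 Q0 Z C01 0 0 ltac:(lra)).
    unfold f0 in V. etransitivity; [|exact V]. apply f_equal. apply injective_projections; simpl; ring. }
  assert (VT : jacobi_theta (q * q) tau = th10 (q * q)).
  { rewrite <- Eq, <- jacobi_theta_half_tau by exact Ht2. f_equal. field. }
  assert (C11 : fcoef f1 1 <> RtoC 0).
  { intros Z. apply Nd. rewrite <- VT.
    assert (V := quasi_periodic_0_2 f1 tau K Ht D1 NK P1 Q1 C10 Z 0 0 ltac:(lra)).
    unfold f1 in V. change (0, 0) with (RtoC 0) in V. rewrite cis_at_0 in V. etransitivity; [|exact V].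
    replace (2 * 0 + tau)%C with tau by ring. ring. }
  set (c0 := (fcoef F 0 / fcoef f0 0)%C). set (c1 := (fcoef F 1 / fcoef f1 1)%C).
  pose (G := fun z => (F z - c0 * f0 z)%C).
  assert (DG : entire G) by now apply entire_minus_scal.
  assert (V : forall x y, 0 <= y -> (G (x, y) - c1 * f1 (x, y))%C = RtoC 0).
  { apply (quasi_periodic_0_2 (fun z => G z - c1 * f1 z)%C tau K Ht); auto.
    - now apply entire_minus_scal.
    - intros z. unfold G. now rewrite PF, P0, P1.
    - intros z. unfold G. rewrite QF, Q0, Q1. ring.
    - rewrite fcoef_minus_scal by assumption. unfold G. rewrite fcoef_minus_scal, C10 by assumption.
      unfold c0. field. exact C00.
    - rewrite fcoef_minus_scal by assumption. unfold G. rewrite fcoef_minus_scal, C01 by assumption.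
      unfold c1. field. exact C11. }
  assert (V' : forall z, 0 <= Im z -> F z = (c0 * f0 z + c1 * f1 z)%C).
  { intros [x y] Hz. specialize (V x y Hz). unfold G in V. apply Cminus_eq_0. rewrite <- V. ring. }
  set (a := th00 (q * q)) in *. set (d := th10 (q * q)) in *.
  assert (Q20 : jacobi_theta (q * q) (2 * tau)%C = (a / (q * q))%C).
  { replace (2 * tau)%C with (0 + 2 * tau)%C by ring. rewrite Q2, cis_at_0, jacobi_theta_0. fold a.
    field. exact Nq. }
  assert (Chalf : cis 1 (1 / 2 + tau / 2)%C = (- q)%C).
  { rewrite cis_plus_r, cis_1_half, cis_1_half_tau. fold q. ring. }
  assert (V1 : (th00 q * th00 q)%C = (c0 * a + c1 * d)%C).
  { rewrite <- jacobi_theta_0. change (F (RtoC 0) = (c0 * a + c1 * d)%C).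
    rewrite V' by (simpl; lra). unfold f0, f1. rewrite cis_at_0.
    replace (2 * 0 + tau)%C with tau by ring. replace (2 * 0)%C with (RtoC 0) by ring.
    rewrite VT, jacobi_theta_0. fold a. ring. }
  assert (V2 : (th01 q * th01 q)%C = (c0 * a - c1 * d)%C).
  { rewrite <- jacobi_theta_half. change (F (1 / 2)%C = (c0 * a - c1 * d)%C).
    rewrite V'.
    2:{ replace (1 / 2)%C with (RtoC (1 / 2)) by (rewrite RtoC_div by lra; reflexivity). simpl. lra. }
    unfold f0, f1. rewrite cis_1_half.
    replace (2 * (1 / 2) + tau)%C with (tau + 1)%C by field. replace (2 * (1 / 2))%C with (0 + 1)%C by field.
    rewrite !jacobi_theta_period, VT, jacobi_theta_0. fold a. ring. }
  assert (ImH : Im (tau / 2)%C = Im tau / 2).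
  { destruct tau as [x y]. simpl. field. }
  assert (V3 : (th10 q * th10 q)%C = (c0 * d + c1 * a / q)%C).
  { unfold q at 1 2. rewrite <- jacobi_theta_half_tau by exact Ht. fold q.
    change (F (tau / 2)%C = (c0 * d + c1 * a / q)%C).
    rewrite V' by lra. unfold f0, f1. rewrite cis_1_half_tau. fold q.
    replace (2 * (tau / 2) + tau)%C with (2 * tau)%C by field. replace (2 * (tau / 2))%C with tau by field.
    rewrite VT, Q20. field. exact Nq. }
  (* Evaluation at the zero of theta expresses [c1] through [c0], so a single unknown factor
     [k = c0 / a] remains. *)
  assert (V4 : RtoC 0 = (c0 * d - c1 * a / q)%C).
  { transitivity (F (1 / 2 + tau / 2)%C).
    - unfold F. unfold q. rewrite jacobi_theta_zero by exact Ht. ring.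
    - rewrite V'.
      2:{ change (0 <= Im (1 / 2)%C + Im (tau / 2)%C). rewrite ImH.
          replace (1 / 2)%C with (RtoC (1 / 2)) by (rewrite RtoC_div by lra; reflexivity). simpl. lra. }
      unfold f0, f1. rewrite Chalf.
      replace (2 * (1 / 2 + tau / 2) + tau)%C with (2 * tau + 1)%C by field.
      replace (2 * (1 / 2 + tau / 2))%C with (tau + 1)%C by field.
      rewrite !jacobi_theta_period, VT, Q20. field. exact Nq. }
  assert (Ec1 : c1 = (c0 * d * q / a)%C).
  { apply Cminus_eq_0. transitivity (- (q / a) * (c0 * d - c1 * a / q))%C; [field; now split|].
    rewrite <- V4. ring. }
  exists (c0 / a)%C. rewrite V1, V2, V3, Ec1. repeat split; field; try exact Na; now split.
Qed.

(** * Duplication near the cusp *)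

Lemma half_theta_near_1 (q v : C) : Cmod q < 1 -> Cmod v <= 1 ->
  Cmod (half_theta q v - 1)%C <= Cmod q / (1 - Cmod q).
Proof.
  intros Hq Hv. pose proof (Cmod_ge_0 q) as Q0. pose proof (half_theta_summable q v Hq) as Sm.
  unfold half_theta, PS. rewrite CSeries_incr by exact Sm.
  replace (q ^ (0 * 0) * v ^ 0 + _ - 1)%C
    with (CSeries (fun n => q ^ (S n * S n) * v ^ S n)%C) by (simpl; ring).
  rewrite <- Series_geom_scal by lra.
  apply Cmod_CSeries_le; [|apply ex_series_geom_scal; lra].
  intros n. rewrite Cmod_mult, !Cmod_pow. rewrite tech_pow_Rmult.
  apply Rle_trans with (Cmod q ^ S n * 1); [|lra].
  apply Rmult_le_compat; try (apply pow_le; apply Cmod_ge_0).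
  - replace (S n * S n)%nat with (S n + n * S n)%nat by lia. rewrite pow_add.
    rewrite <- (Rmult_1_r (Cmod q ^ S n)) at 2. apply Rmult_le_compat_l; [now apply pow_le|].
    rewrite <- (pow1 (n * S n)). apply pow_incr. lra.
  - rewrite <- (pow1 (S n)). apply pow_incr. split; [apply Cmod_ge_0|exact Hv].
Qed.

Lemma small_ratio (x : R) : 0 <= x <= 1 / 12 -> x / (1 - x) <= 1 / 11.
Proof.
  intros H. apply Rmult_le_reg_r with (1 - x); [lra|].
  unfold Rdiv at 1. rewrite Rmult_assoc, Rinv_l by lra. lra.
Qed.

Lemma half_theta_bounds (q v : C) : Cmod q <= 1 / 12 -> Cmod v <= 1 ->
  Cmod (half_theta q v - 1)%C <= 1 / 11.
Proof.
  intros Hq Hv. eapply Rle_trans; [apply half_theta_near_1; lra|].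
  apply small_ratio. split; [apply Cmod_ge_0|exact Hq].
Qed.

Lemma theta_bounds (q : C) : Cmod q <= 1 / 12 ->
  (9 / 11 <= Cmod (th00 q) <= 13 / 11) /\ (9 / 11 <= Cmod (th01 q) <= 13 / 11) /\
  (20 / 11 <= Cmod (th10 q) <= 24 / 11).
Proof.
  intros Hq.
  (* [m = 1] yields [th00] and [th01], [m = 2] yields [th10]. *)
  assert (K : forall v (m : R), Cmod v <= 1 -> 1 <= m ->
    m - 2 / 11 <= Cmod (2 * half_theta q v - RtoC (2 - m))%C <= m + 2 / 11).
  { intros v m Hv Hm. assert (H := half_theta_bounds q v Hq Hv).
    replace (2 * half_theta q v - RtoC (2 - m))%C with (RtoC m + 2 * (half_theta q v - 1))%C.
    2:{ rewrite RtoC_minus. ring. }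
    assert (E : Cmod (2 * (half_theta q v - 1))%C <= 2 / 11).
    { rewrite Cmod_mult, Cmod_R, Rabs_pos_eq; lra. }
    assert (M : Cmod (RtoC m) = m) by (rewrite Cmod_R, Rabs_pos_eq; lra).
    pose proof (Cmod_triangle (RtoC m) (2 * (half_theta q v - 1))%C).
    pose proof (Cmod_triangle_inv (RtoC m) (2 * (half_theta q v - 1))%C). lra. }
  assert (K1 := K (RtoC 1) 1 ltac:(rewrite Cmod_1; lra) ltac:(lra)).
  assert (K2 := K (RtoC (-1)) 1 ltac:(rewrite Cmod_R, Rabs_left; lra) ltac:(lra)).
  assert (K3 := K q 2 ltac:(lra) ltac:(lra)).
  replace (2 - 1) with 1 in K1, K2 by ring. replace (2 - 2) with 0 in K3 by ring.
  replace (2 * half_theta q q - 0)%C with (th10 q) in K3 by (unfold th10; ring).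
  fold (th00 q) in K1. fold (th01 q) in K2. lra.
Qed.

Lemma theta_nz (q : C) : Cmod q <= 1 / 12 ->
  th00 q <> RtoC 0 /\ th01 q <> RtoC 0 /\ th10 q <> RtoC 0.
Proof.
  intros H. destruct (theta_bounds q H) as [A1 [A2 A3]].
  repeat split; apply Cmod_gt_0; lra.
Qed.

Lemma abs_summable_sub (u : nat -> C) (q : C) : Cmod q < 1 ->
  (forall n, Cmod (u n) <= Cmod q ^ n) -> abs_summable u.
Proof.
  intros Hq H. apply abs_summable_le with (fun n => 1 * Cmod q ^ n).
  - intros n. rewrite Rmult_1_l. apply H.
  - apply ex_series_geom_scal. split; [apply Cmod_ge_0|exact Hq].
Qed.

Lemma Cmod_pow_le (q : C) (n m : nat) : Cmod q < 1 -> (n <= m)%nat -> Cmod (q ^ m)%C <= Cmod q ^ n.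
Proof.
  intros Hq H. rewrite Cmod_pow. replace m with (n + (m - n))%nat by lia. rewrite pow_add.
  rewrite <- (Rmult_1_r (Cmod q ^ n)) at 2. apply Rmult_le_compat_l; [apply pow_le, Cmod_ge_0|].
  rewrite <- (pow1 (m - n)). apply pow_incr. split; [apply Cmod_ge_0|lra].
Qed.

(** Even and odd indices have squares [4 n^2] and [4 (n^2 + n) + 1], which produces series in [q^4];
    the power of [v] depends only on the parity. *)
Lemma half_theta_even_odd (q v : C) : Cmod q < 1 -> (v * v)%C = RtoC 1 ->
  half_theta q v =
  (half_theta (q * q * (q * q)) 1 + q * v * half_theta (q * q * (q * q)) (q * q * (q * q)))%C.
Proof.
  intros Hq Hv.
  assert (Mv : Cmod v = 1).
  { apply (f_equal Cmod) in Hv. rewrite Cmod_mult, Cmod_1 in Hv. pose proof (Cmod_ge_0 v). nra. }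
  assert (Hv2 : forall n, (v ^ (2 * n))%C = RtoC 1).
  { intros n. rewrite Cpow_mult_r. simpl. rewrite Cmult_1_r, Hv. apply Cpow_1_l. }
  assert (B : forall n, Cmod (q ^ (n * n) * v ^ n)%C <= Cmod q ^ n).
  { intros n. rewrite Cmod_mult, (Cmod_pow v), Mv, pow1, Rmult_1_r. apply Cmod_pow_le; [exact Hq|nia]. }
  assert (Q4 : forall n, ((q * q * (q * q)) ^ n)%C = (q ^ (4 * n))%C).
  { intros n. rewrite Cpow_mult_r. f_equal. simpl. ring. }
  assert (Hq4 : Cmod (q * q * (q * q))%C < 1).
  { rewrite !Cmod_mult. pose proof (Cmod_ge_0 q). assert (Cmod q * Cmod q < 1) by nra. nra. }
  unfold half_theta at 1, PS. rewrite CSeries_even_odd.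
  - unfold half_theta, PS. apply f_equal2.
    + apply CSeries_ext. intros n. rewrite Hv2, Q4, Cpow_1_l. f_equal. f_equal. lia.
    + rewrite <- CSeries_scal by (now apply half_theta_summable). apply CSeries_ext. intros n.
      rewrite !Q4, (Cpow_add_r v), Hv2.
      replace ((2 * n + 1) * (2 * n + 1))%nat with (4 * (n * n) + 4 * n + 1)%nat by lia.
      rewrite !Cpow_add_r. simpl. ring.
  - apply (abs_summable_sub _ q Hq). intros n. eapply Rle_trans; [apply B|].
    rewrite <- Cmod_pow. apply Cmod_pow_le; [exact Hq|lia].
  - apply (abs_summable_sub _ q Hq). intros n. eapply Rle_trans; [apply B|].
    rewrite <- Cmod_pow. apply Cmod_pow_le; [exact Hq|lia].
Qed.

Lemma theta_split (q : C) : Cmod q < 1 ->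
  th00 q = (th00 (q * q * (q * q)) + q * th10 (q * q * (q * q)))%C /\
  th01 q = (th00 (q * q * (q * q)) - q * th10 (q * q * (q * q)))%C.
Proof.
  intros Hq. unfold th00, th01, th10.
  rewrite (half_theta_even_odd q 1), (half_theta_even_odd q (-1)); try assumption; try ring.
  split; ring.
Qed.

Lemma Cmod_sq_small (q : C) (r : R) : Cmod q <= r -> r <= 1 -> Cmod (q * q)%C <= r.
Proof. intros H1 H2. rewrite Cmod_sq. pose proof (Cmod_ge_0 q). nra. Qed.

Lemma nome_pos_Im (tau : C) : Cmod (nome tau) <= 1 / 12 -> 0 < Im tau.
Proof.
  intros H. rewrite Cmod_nome in H. apply Rnot_le_lt. intros Q. pose proof PI_RGT_0.
  assert (exp 0 <= exp (- (PI * Im tau))).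
  { destruct (Req_dec (- (PI * Im tau)) 0) as [->|N]; [lra|]. left. apply exp_increasing. nra. }
  rewrite exp_0 in *. lra.
Qed.

(** After duplication this is [(x + y)^2 = (x - y)^2 + 4 x y]; the unknown factor enters as [k^2]
    everywhere. *)
Lemma jacobi_quartic (tau : C) : Cmod (nome tau) <= 1 / 12 -> let q := nome tau in
  (th00 q ^ 4)%C = (th01 q ^ 4 + q * th10 q ^ 4)%C.
Proof.
  intros H q. pose proof (nome_pos_Im tau H) as Ht.
  destruct (theta_nz (q * q)%C (Cmod_sq_small q (1 / 12) H ltac:(lra))) as [N0 [_ N1]].
  destruct (theta_duplication tau Ht N0 N1) as [k [E1 [E2 E3]]]. fold q in E1, E2, E3.
  replace (th00 q ^ 4)%C with ((th00 q * th00 q) * (th00 q * th00 q))%C by ring.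
  replace (th01 q ^ 4)%C with ((th01 q * th01 q) * (th01 q * th01 q))%C by ring.
  replace (th10 q ^ 4)%C with ((th10 q * th10 q) * (th10 q * th10 q))%C by ring.
  rewrite E1, E2, E3. ring.
Qed.

Definition lam (q : C) : C := (q * th10 q ^ 4 / th00 q ^ 4)%C.

(** The quotient theta10^2 / theta00^2 at [2 tau], a square root of [lam (q * q)]. *)
Definition landen (q : C) : C := (q * (th10 (q * q) * th10 (q * q)) / (th00 (q * q) * th00 (q * q)))%C.

Lemma landen_bound (q : C) : Cmod q <= 1 / 12 -> Cmod (landen q) <= 8 * Cmod q.
Proof.
  intros H. assert (H2 := Cmod_sq_small q (1 / 12) H ltac:(lra)).
  destruct (theta_nz _ H2) as [N0 _]. destruct (theta_bounds _ H2) as [A1 [_ A3]].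
  unfold landen. rewrite Cmod_div by now apply Cmult_neq_0. rewrite !Cmod_mult.
  set (a := Cmod (th00 (q * q))) in *. set (d := Cmod (th10 (q * q))) in *.
  pose proof (Cmod_ge_0 q).
  apply Rmult_le_reg_r with (a * a); [nra|].
  unfold Rdiv. rewrite Rmult_assoc, Rinv_l, Rmult_1_r by nra.
  assert (d * d <= 8 * (a * a)) by nra. nra.
Qed.

Lemma lac_bounded_unit (a : nat -> C) (k : nat -> nat) :
  (forall n, Cmod (a n) = 1) -> lac_bounded a k 1.
Proof.
  intros Ha s Hs. exists 1. intros n. rewrite Ha, Rmult_1_l.
  rewrite <- (pow1 (k n)). apply pow_incr. lra.
Qed.

Lemma cderiv_th00 (q : C) : Cmod q < 1 -> exists l, cderiv th00 q l.
Proof.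
  intros Hq.
  destruct (lac_cderiv (fun _ => RtoC 1) (fun n => n * n)%nat 1 q) as [_ D]; auto.
  - apply lac_bounded_unit. intros _. apply Cmod_1.
  - intros n. nia.
  - eexists. unfold th00. apply cderiv_minus; [apply cderiv_scal|apply cderiv_const].
    eapply cderiv_ext; [|exact D]. intros w. apply CSeries_ext. intros n. rewrite Cpow_1_l. ring.
Qed.

Lemma cderiv_th01 (q : C) : Cmod q < 1 -> exists l, cderiv th01 q l.
Proof.
  intros Hq.
  destruct (lac_cderiv (fun n => RtoC (-1) ^ n)%C (fun n => n * n)%nat 1 q) as [_ D]; auto.
  - apply lac_bounded_unit. intros n. rewrite Cmod_pow, Cmod_R, Rabs_left by lra.
    replace (- -1) with 1 by ring. apply pow1.
  - intros n. nia.
  - eexists. unfold th01. apply cderiv_minus; [apply cderiv_scal|apply cderiv_const].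
    eapply cderiv_ext; [|exact D]. intros w. apply CSeries_ext. intros n. ring.
Qed.

Lemma cderiv_th10 (q : C) : Cmod q < 1 -> exists l, cderiv th10 q l.
Proof.
  intros Hq.
  destruct (lac_cderiv (fun _ => RtoC 1) (fun n => n * n + n)%nat 1 q) as [_ D]; auto.
  - apply lac_bounded_unit. intros _. apply Cmod_1.
  - intros n. nia.
  - eexists. unfold th10. apply cderiv_scal.
    eapply cderiv_ext; [|exact D]. intros w. apply CSeries_ext. intros n. rewrite Cpow_add_r. ring.
Qed.

Lemma th00_at_0 : th00 (RtoC 0) = RtoC 1.
Proof.
  unfold th00. rewrite half_theta_shift by (rewrite Cmod_0; lra). ring.
Qed.

Lemma cderiv_lam (q : C) : Cmod q < 1 -> th00 q <> RtoC 0 -> exists l, cderiv lam q l.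
Proof.
  intros Hq N. destruct (cderiv_th00 q Hq) as [l0 D0]. destruct (cderiv_th10 q Hq) as [l1 D1].
  eexists. unfold lam. apply cderiv_div.
  - apply cderiv_mult; [apply cderiv_id|]. apply cderiv_pow. exact D1.
  - apply cderiv_pow. exact D0.
  - now apply Cpow_nz.
Qed.

Lemma lam_bound (q : C) : Cmod q <= 1 / 12 -> Cmod (lam q) <= 60 * Cmod q.
Proof.
  intros H. destruct (theta_nz _ H) as [N0 _]. destruct (theta_bounds _ H) as [A1 [_ A3]].
  unfold lam. rewrite Cmod_div by now apply Cpow_nz. rewrite Cmod_mult, !Cmod_pow.
  set (a := Cmod (th00 q)) in *. set (d := Cmod (th10 q)) in *. pose proof (Cmod_ge_0 q).
  assert (A4 : (9 / 11) ^ 4 <= a ^ 4) by (apply pow_incr; lra).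
  assert (D4 : d ^ 4 <= (24 / 11) ^ 4) by (apply pow_incr; lra).
  assert (P : 0 < (9 / 11) ^ 4) by (apply pow_lt; lra).
  apply Rmult_le_reg_r with (a ^ 4); [lra|].
  unfold Rdiv. rewrite Rmult_assoc, Rinv_l, Rmult_1_r by lra.
  assert (d ^ 4 <= 60 * a ^ 4) by lra. nra.
Qed.

Definition period_ratio (q : C) : C := (hyp (1 / 2) (1 / 2) (lam q) / (th00 q * th00 q))%C.

Lemma Cmod_half_le : Cmod (1 / 2)%C <= 1.
Proof. rewrite Cmod_half. lra. Qed.

(** The factor [k] of the duplication formula is not evaluated here, so one doubling preserves the
    ratio only up to [k]. The last two equations are kept to show that the factors of two successive
    doublings cancel. *)
Lemma period_ratio_double : exists r, 0 < r <= 1 / 100 /\ forall tau : C, Cmod (nome tau) < r ->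
  let q := nome tau in
  exists k : C,
    period_ratio (q * q)%C = (k * period_ratio q)%C /\
    (th00 q * th00 q - th01 q * th01 q)%C = (2 * k * (q * (th10 (q * q) * th10 (q * q))))%C /\
    (th10 q * th10 q)%C = (2 * k * (th00 (q * q) * th10 (q * q)))%C.
Proof.
  assert (H21 : (2 * (1 / 2))%C = RtoC 1) by field.
  assert (H1 : Cmod (RtoC 1) <= 1) by (rewrite Cmod_1; lra).
  destruct (quadratic_transformation (1 / 2)%C Cmod_half_le) as [r [Hr HQ]].
  { rewrite H21. exact H1. }
  exists (r / 10). split; [lra|]. intros tau Hq0 q. fold q in Hq0.
  assert (Hq : Cmod q <= 1 / 12) by lra.
  pose proof (nome_pos_Im tau Hq) as Ht.
  destruct (theta_nz (q * q)%C (Cmod_sq_small q (1 / 12) Hq ltac:(lra))) as [N0 [_ N1]].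
  destruct (theta_nz q Hq) as [M0 [_ M1]].
  destruct (theta_duplication tau Ht N0 N1) as [k [E1 [E2 E3]]]. fold q in E1, E2, E3.
  assert (LB : Cmod (landen q) < r).
  { pose proof (landen_bound q Hq). pose proof (Cmod_ge_0 q). lra. }
  assert (L := HQ _ LB). rewrite H21 in L.
  assert (LB' : Cmod (- landen q)%C < 1) by (rewrite Cmod_opp; lra).
  assert (L1 := binomial_1 (- landen q)%C LB').
  set (a := th00 (q * q)) in *. set (d := th10 (q * q)) in *.
  set (a1 := th00 q) in *. set (d1 := th10 q) in *.
  assert (Kn : k <> RtoC 0).
  { intros Z. rewrite Z in E1. apply (Cmult_neq_0 _ _ M0 M0). fold a1. rewrite E1. ring. }
  assert (Sn : (a * a + q * (d * d))%C <> RtoC 0).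
  { intros Z. rewrite Z in E1. apply (Cmult_neq_0 _ _ M0 M0). fold a1. rewrite E1. ring. }
  assert (X1 : (landen q * landen q)%C = lam (q * q)%C).
  { unfold landen, lam. fold a d. field. exact N0. }
  assert (X2 : (1 + landen q)%C = ((a * a + q * (d * d)) / (a * a))%C).
  { unfold landen. fold a d. field. exact N0. }
  assert (X3 : (4 * landen q / ((1 + landen q) * (1 + landen q)))%C = lam q).
  { rewrite X2. unfold landen, lam. fold a d a1 d1.
    replace (d1 ^ 4)%C with ((d1 * d1) * (d1 * d1))%C by ring.
    replace (a1 ^ 4)%C with ((a1 * a1) * (a1 * a1))%C by ring. rewrite E1, E3.
    field. repeat split; assumption. }
  rewrite X1, X3 in L.
  exists k. split; [|split].
  - unfold period_ratio. fold a a1. rewrite L, E1.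
    assert (X4 : hyp 1 1 (- landen q)%C = (a * a / (a * a + q * (d * d)))%C).
    { replace (1 - - landen q)%C with (1 + landen q)%C in L1 by ring. rewrite X2 in L1.
      transitivity (a * a / (a * a + q * (d * d)) * ((a * a + q * (d * d)) / (a * a) * hyp 1 1 (- landen q)))%C.
      - field. now split.
      - rewrite L1. ring. }
    rewrite X4. field. repeat split; assumption.
  - rewrite E1, E2. ring.
  - exact E3.
Qed.

Lemma nome_quadruple (tau : C) :
  nome (4 * tau)%C = (nome tau * nome tau * (nome tau * nome tau))%C.
Proof.
  replace (4 * tau)%C with (2 * (2 * tau))%C by ring. now rewrite !nome_double.
Qed.

Lemma period_ratio_quadruple : exists r, 0 < r <= 1 / 100 /\ forall tau : C, Cmod (nome tau) < r ->
  period_ratio (nome (4 * tau)%C) = period_ratio (nome tau).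
Proof.
  destruct period_ratio_double as [r [Hr HD]]. exists r. split; [exact Hr|]. intros tau Hq.
  destruct (HD tau Hq) as [k [A1 [A2 A3]]].
  set (q := nome tau) in *.
  assert (Hq2 : Cmod (nome (2 * tau)%C) < r).
  { rewrite nome_double. fold q. rewrite Cmod_sq. pose proof (Cmod_ge_0 q). nra. }
  destruct (HD (2 * tau)%C Hq2) as [k2 [B1 [B2 B3]]].
  rewrite nome_double in B1, B2, B3, Hq2. fold q in B1, B2, B3, Hq2.
  rewrite nome_quadruple. fold q. rewrite B1, A1.
  assert (Hq1 : Cmod q < 1) by lra.
  destruct (theta_split q Hq1) as [S0 S1].
  assert (Hq4 : Cmod (q * q * (q * q))%C <= 1 / 12).
  { apply Cmod_sq_small; lra. }
  destruct (theta_nz _ Hq4) as [N0 [_ N1]].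
  rewrite S0, S1, B3 in A2.
  set (a := th00 (q * q * (q * q))) in *. set (d := th10 (q * q * (q * q))) in *.
  assert (Nq : q <> RtoC 0) by apply nome_nz.
  (* The difference of the squares of [th00 q] and [th01 q] is computed in two ways: by the parity
     split, without any factor, and by duplicating twice, with the factor [k * k2]. *)
  assert (K : (k * k2)%C = RtoC 1).
  { transitivity (2 * k * (q * (2 * k2 * (a * d))) / (4 * q * a * d))%C.
    - field. repeat split; assumption.
    - rewrite <- A2. field. repeat split; assumption. }
  transitivity ((k * k2) * period_ratio q)%C; [ring|]. rewrite K. ring.
Qed.

Lemma ccont_period_ratio_0 : ccont period_ratio (RtoC 0) /\ period_ratio (RtoC 0) = RtoC 1.
Proof.
  assert (Z : Cmod (RtoC 0) < 1) by (rewrite Cmod_0; lra).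
  assert (N : th00 (RtoC 0) <> RtoC 0) by (rewrite th00_at_0; apply RtoC_nz; lra).
  assert (L0 : lam (RtoC 0) = RtoC 0).
  { unfold lam. rewrite th00_at_0. field. }
  split.
  - destruct (cderiv_th00 _ Z) as [l D]. destruct (cderiv_lam _ Z N) as [m M].
    unfold period_ratio. apply ccont_mult.
    + apply (ccont_comp (hyp (1 / 2) (1 / 2)) lam); [eapply cderiv_ccont, M|].
      rewrite L0. eapply cderiv_ccont.
      apply (proj1 (cderiv_hyp (1 / 2) (1 / 2) (RtoC 0) Cmod_half_le Cmod_half_le Z)).
    + apply ccont_inv; [|now apply Cmult_neq_0].
      apply ccont_mult; eapply cderiv_ccont, D.
  - unfold period_ratio. rewrite L0, hyp_0, th00_at_0. field.
Qed.

Lemma hyp_lam : exists r, 0 < r <= 1 / 100 /\ forall tau : C, Cmod (nome tau) < r ->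
  hyp (1 / 2) (1 / 2) (lam (nome tau)) = (th00 (nome tau) * th00 (nome tau))%C.
Proof.
  destruct period_ratio_quadruple as [r [Hr HD]]. exists r. split; [exact Hr|]. intros tau Hq.
  set (q := nome tau) in *. pose proof (Cmod_ge_0 q) as Q0.
  assert (It : forall n : nat, exists tau', Cmod (nome tau') <= Cmod q * (1 / 2) ^ n /\
             period_ratio (nome tau') = period_ratio q).
  { intros n. induction n as [|n [t [T1 T2]]].
    - exists tau. split; [simpl; fold q; lra|reflexivity].
    - assert (H2 : (1 / 2) ^ n <= 1) by (apply Rle_trans with (1 ^ n); [apply pow_incr; lra|rewrite pow1; lra]).
      assert (H3 : 0 < (1 / 2) ^ n) by (apply pow_lt; lra).
      assert (T3 : Cmod (nome t) < r) by nra.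
      exists (4 * t)%C. split; [|rewrite HD; assumption].
      rewrite nome_quadruple, !Cmod_mult. simpl. pose proof (Cmod_ge_0 (nome t)).
      set (m := Cmod (nome t)) in *.
      assert (m * m <= m * (1 / 100)) by nra. assert (0 <= m * m) by nra.
      assert (m * m * (m * m) <= m * (1 / 2)) by nra. nra. }
  destruct ccont_period_ratio_0 as [C0 V0].
  assert (E : period_ratio q = RtoC 1).
  { apply Cminus_eq_0, Cmod_eq_0. apply Rle_antisym; [|apply Cmod_ge_0].
    apply le_epsilon. intros e He. rewrite Rplus_0_l.
    destruct (C0 e He) as [d [Hd K]].
    destruct (pow_lt_1_zero (1 / 2) ltac:(rewrite Rabs_pos_eq; lra) d Hd) as [N HN].
    destruct (It N) as [t [T1 T2]]. rewrite <- T2, <- V0. left. apply K.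
    replace (nome t - 0)%C with (nome t) by ring.
    specialize (HN N (le_n N)). rewrite Rabs_pos_eq in HN by (apply pow_le; lra). nra. }
  destruct (theta_nz q ltac:(lra)) as [Nq _].
  unfold period_ratio in E. transitivity ((hyp (1 / 2) (1 / 2) (lam q) / (th00 q * th00 q)) * (th00 q * th00 q))%C.
  - field. exact Nq.
  - rewrite E. ring.
Qed.

(** * Moduli of theta constants on the domain *)

Definition nome4 (tau : C) : C := Cexp (PI * Ci * tau / 4)%C.

Lemma nome4_pow (tau : C) : (nome4 tau ^ 4)%C = nome tau.
Proof.
  unfold nome4, nome. rewrite <- Cexp_mult_nat. apply f_equal.
  replace (INR 4) with 4 by (simpl; ring). field.
Qed.

Lemma Cmod_nome4 (tau : C) : Cmod (nome4 tau) = exp (- (PI * Im tau / 4)).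
Proof.
  unfold nome4. rewrite Cmod_Cexp. apply f_equal.
  replace (PI * Ci * tau / 4)%C with (RtoC (PI / 4) * Ci * tau)%C.
  - destruct tau as [x y]. simpl. field.
  - rewrite RtoC_div by lra. field.
Qed.

(* [G z = sum exp (- pi i (z + n)^2 / tau)] satisfies the same functional
   equations as [jacobi_theta (nome tau)], hence is proportional to it. *)
Lemma theta_inversion (tau : C) : Cmod (nome tau) <= 1 / 12 ->
  let tau' := (- (1) / tau)%C in
  0 < Im tau' /\
  exists c : C,
    (nome4 tau' * th10 (nome tau'))%C = (c * th01 (nome tau))%C /\
    th01 (nome tau') = (c * (nome4 tau * th10 (nome tau)))%C.
Proof.
  intros Hq tau'. pose proof (nome_pos_Im tau Hq) as Ht.
  assert (Nt : tau <> RtoC 0).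
  { intros Z. rewrite Z in Ht. simpl in Ht. lra. }
  assert (Ht' : 0 < Im tau').
  { unfold tau'. destruct tau as [x y]. simpl in *.
    replace ((- (1) * (- y / (x * (x * 1) + y * (y * 1))) + - 0 * (x / (x * (x * 1) + y * (y * 1)))))
      with (y / (x * (x * 1) + y * (y * 1))) by (field; nra).
    apply Rdiv_lt_0_compat; nra. }
  split; [exact Ht'|].
  pose proof (nome_lt_1 tau Ht) as Q1. pose proof (nome_lt_1 tau' Ht') as Q2.
  set (q := nome tau) in *. set (q' := nome tau') in *.
  assert (Nq : q <> RtoC 0) by apply nome_nz. assert (Nq' : q' <> RtoC 0) by apply nome_nz.
  pose (g := fun z => Cexp (- (PI * Ci) * (z * z) / tau)%C).
  pose (G := fun z => (g z * jacobi_theta q' (z / tau))%C).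
  assert (DG : entire G).
  { intros z. destruct (cderiv_jacobi_theta q' (z / tau)%C Q2) as [l L].
    eexists. unfold G. apply cderiv_mult.
    - unfold g. apply (cderiv_comp Cexp (fun z => - (PI * Ci) * (z * z) / tau)%C); [|apply cderiv_Cexp].
      apply cderiv_div; [|apply cderiv_const|exact Nt].
      apply cderiv_scal, cderiv_mult; apply cderiv_id.
    - apply (cderiv_comp (jacobi_theta q') (fun z => z / tau)%C); [|exact L].
      apply cderiv_div; [apply cderiv_id|apply cderiv_const|exact Nt]. }
  assert (DT : entire (jacobi_theta q)) by (intros z; now apply cderiv_jacobi_theta).
  assert (Inv : forall u, jacobi_theta q' (u - tau')%C = (/ q' * cis 1 u * jacobi_theta q' u)%C).
  { intros u. assert (A := jacobi_theta_quasi tau' (u - tau')%C Ht'). fold q' in A.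
    replace (u - tau' + tau')%C with u in A by ring. rewrite A.
    replace (cis (-1) (u - tau')) with (/ cis 1 u * (q' * q'))%C.
    - field. split; first [exact Nq' | apply cis_nz].
    - unfold q'. rewrite <- cis_1_tau. unfold Cminus. rewrite cis_plus_r, cis_opp, cis_m1. reflexivity. }
  assert (PG : forall z, G (z + 1)%C = G z).
  { intros z. unfold G.
    replace ((z + 1) / tau)%C with (z / tau - tau')%C by (unfold tau'; field; exact Nt).
    rewrite Inv.
    assert (E : g z = (g (z + 1) * (/ q' * cis 1 (z / tau)))%C).
    { unfold g, q', nome, cis. rewrite <- Cexp_opp, <- !Cexp_plus. apply f_equal.
      unfold tau'. field. exact Nt. }
    rewrite E. ring. }
  assert (QG : forall z, G (z + tau)%C = (/ q * cis (-1) z * G z)%C).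
  { intros z. unfold G. replace ((z + tau) / tau)%C with (z / tau + 1)%C by (field; exact Nt).
    rewrite jacobi_theta_period.
    assert (E : g (z + tau)%C = (/ q * cis (-1) z * g z)%C).
    { unfold g, q, nome, cis. rewrite <- Cexp_opp, <- !Cexp_plus. apply f_equal. field. exact Nt. }
    rewrite E. ring. }
  assert (Ki : (/ q)%C <> RtoC 0).
  { intros Z. apply Nq. rewrite <- (Cmult_1_r q), <- (Cinv_r q Nq), Z. ring. }
  assert (QT : forall z, jacobi_theta q (z + tau)%C = (/ q * cis (-1) z * jacobi_theta q z)%C).
  { intros z. now apply jacobi_theta_quasi. }
  destruct (theta_nz q Hq) as [N0 _].
  assert (C0 : fcoef (jacobi_theta q) 0 <> RtoC 0).
  { intros Z. apply N0. rewrite <- jacobi_theta_0.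
    apply (quasi_periodic_0_1 (jacobi_theta q) tau (/ q)%C Ht DT Ki (jacobi_theta_period q) QT Z 0 0).
    lra. }
  (* The value of this constant is never computed: evaluating at [1/2] and at [tau / 2] gives two
     relations from which it can be eliminated. *)
  set (c := (fcoef G 0 / fcoef (jacobi_theta q) 0)%C).
  assert (V : forall x y, 0 <= y -> (G (x, y) - c * jacobi_theta q (x, y))%C = RtoC 0).
  { apply (quasi_periodic_0_1 (fun z => G z - c * jacobi_theta q z)%C tau (/ q)%C Ht); auto.
    - now apply entire_minus_scal.
    - intros z. now rewrite PG, jacobi_theta_period.
    - intros z. rewrite QG, QT. ring.
    - rewrite fcoef_minus_scal by assumption. unfold c. field. exact C0. }
  assert (V' : forall z, 0 <= Im z -> G z = (c * jacobi_theta q z)%C).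
  { intros [x y] Hz. apply Cminus_eq_0. now apply V. }
  exists c. split.
  - rewrite <- jacobi_theta_half, <- V'.
    2:{ replace (1 / 2)%C with (RtoC (1 / 2)) by (rewrite RtoC_div by lra; reflexivity). simpl. lra. }
    unfold G. replace (1 / 2 / tau)%C with (- (tau' / 2))%C by (unfold tau'; field; exact Nt).
    rewrite jacobi_theta_even. unfold q'. rewrite jacobi_theta_half_tau by exact Ht'. fold q'.
    f_equal. unfold g, nome4. apply f_equal. unfold tau'. field. exact Nt.
  - rewrite Cmult_assoc, (Cmult_comm c), <- Cmult_assoc.
    assert (E : (c * th10 q)%C = (g (tau / 2)%C * th01 q')%C).
    { unfold q at 1. rewrite <- jacobi_theta_half_tau by exact Ht. fold q. rewrite <- V'.
      2:{ destruct tau as [x y]. simpl in *. lra. }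
      unfold G. replace (tau / 2 / tau)%C with (1 / 2)%C by (field; exact Nt).
      now rewrite jacobi_theta_half. }
    rewrite E, Cmult_assoc.
    replace (nome4 tau * g (tau / 2))%C with (RtoC 1); [ring|].
    unfold nome4, g. rewrite <- Cexp_plus, <- Cexp_0. apply f_equal. field. exact Nt.
Qed.

Lemma CSeries_conj (u : nat -> C) : CSeries (fun n => Cconj (u n)) = Cconj (CSeries u).
Proof.
  unfold CSeries, Cconj. simpl. f_equal. rewrite <- Series_opp. reflexivity.
Qed.

Lemma half_theta_conj (q v : C) : half_theta (Cconj q) (Cconj v) = Cconj (half_theta q v).
Proof.
  unfold half_theta, PS. rewrite <- CSeries_conj. apply CSeries_ext. intros n.
  now rewrite Cmult_conj, !Cpow_conj.
Qed.

Lemma Cconj_R (x : R) : Cconj (RtoC x) = RtoC x.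
Proof. unfold Cconj, RtoC. simpl. f_equal. ring. Qed.

Lemma Cmod_th01_conj (q : C) : Cmod (th01 (Cconj q)) = Cmod (th01 q).
Proof.
  rewrite <- (Cmod_conj (th01 q)). apply f_equal. unfold th01.
  rewrite Cminus_conj, Cmult_conj, <- half_theta_conj, !Cconj_R. reflexivity.
Qed.

Lemma Cmod_th10_conj (q : C) : Cmod (th10 (Cconj q)) = Cmod (th10 q).
Proof.
  rewrite <- (Cmod_conj (th10 q)). apply f_equal. unfold th10.
  rewrite Cmult_conj, <- half_theta_conj, !Cconj_R. reflexivity.
Qed.

Lemma nome_neg_conj (tau : C) : nome (- Cconj tau)%C = Cconj (nome tau).
Proof.
  unfold nome, Cexp. destruct tau as [x y].
  replace (PI * Ci * - Cconj (x, y))%C with (- (PI * y), - (PI * x))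
    by (apply injective_projections; simpl; ring).
  replace (PI * Ci * (x, y))%C with (- (PI * y), PI * x)
    by (apply injective_projections; simpl; ring).
  simpl. rewrite cos_neg, sin_neg. apply injective_projections; simpl; ring.
Qed.

(** On the unit circle [-1 / tau] is [- Cconj tau], whose nome is the conjugate of [nome tau]. The
    inversion formula therefore relates the two moduli to themselves. *)
Lemma unit_circle_moduli (tau : C) : Cmod tau = 1 -> Cmod (nome tau) <= 1 / 12 ->
  Cmod (nome4 tau) * Cmod (th10 (nome tau)) = Cmod (th01 (nome tau)).
Proof.
  intros H1 Hq. destruct (theta_inversion tau Hq) as [_ [c [E1 E2]]].
  assert (Nt : tau <> RtoC 0) by (apply Cmod_gt_0; lra).
  assert (Et : (- (1) / tau)%C = (- Cconj tau)%C).
  { assert (E := Cmod2_conj tau). rewrite H1 in E.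
    replace (RtoC (1 ^ 2)) with (RtoC 1) in E by (f_equal; ring).
    transitivity (- (tau * Cconj tau) / tau)%C; [rewrite <- E; reflexivity|]. field. exact Nt. }
  rewrite Et in E1, E2. rewrite nome_neg_conj in E1, E2.
  apply (f_equal Cmod) in E1. apply (f_equal Cmod) in E2.
  rewrite !Cmod_mult, Cmod_th10_conj in E1. rewrite !Cmod_mult, Cmod_th01_conj in E2.
  replace (Cmod (nome4 (- Cconj tau))) with (Cmod (nome4 tau)) in E1.
  2:{ rewrite !Cmod_nome4. destruct tau as [x y]. simpl. f_equal. lra. }
  destruct (theta_bounds _ Hq) as [_ [B1 B2]].
  set (x := Cmod (nome4 tau) * Cmod (th10 (nome tau))) in *.
  set (y := Cmod (th01 (nome tau))) in *. pose proof (Cmod_ge_0 c).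
  assert (X : 0 <= x) by (apply Rmult_le_pos; apply Cmod_ge_0).
  (* The relations read [x = |c| y] and [y = |c| x] with [y > 0], so [|c| = 1]. *)
  rewrite E1 in E2. assert (Q : (Cmod c * Cmod c - 1) * y = 0) by lra.
  apply Rmult_integral in Q. destruct Q as [Q|Q]; [|lra].
  assert (Cmod c = 1) by nra. rewrite E1. nra.
Qed.

(** * Decrease of the quotient of theta10 by theta01 along vertical lines *)

Lemma bernoulli_pow (t : R) (k : nat) : 0 <= t <= 1 -> 1 - t ^ k <= INR k * (1 - t).
Proof.
  intros Ht. induction k as [|k IH]; [simpl; lra|]. rewrite S_INR. simpl.
  assert (0 <= t ^ k) by (apply pow_le; lra).
  assert (t ^ k <= 1) by (apply Rle_trans with (1 ^ k); [apply pow_incr; lra|rewrite pow1; lra]).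
  nra.
Qed.

Lemma pow_shrink_bound (q : C) (t : R) (k : nat) : 0 <= t <= 1 ->
  Cmod ((t * q) ^ k - q ^ k)%C <= (1 - t) * (INR k * Cmod q ^ k).
Proof.
  intros Ht. rewrite Cpow_mult_l, <- RtoC_pow.
  replace (RtoC (t ^ k) * q ^ k - q ^ k)%C with (RtoC (t ^ k - 1) * q ^ k)%C
    by (rewrite RtoC_minus; ring).
  rewrite Cmod_mult, Cmod_R, Cmod_pow.
  assert (t ^ k <= 1) by (apply Rle_trans with (1 ^ k); [apply pow_incr; lra|rewrite pow1; lra]).
  rewrite Rabs_left1 by lra. rewrite <- Rmult_assoc.
  apply Rmult_le_compat_r; [apply pow_le, Cmod_ge_0|].
  pose proof (bernoulli_pow t k Ht). lra.
Qed.

(** The ratio of consecutive terms is at most [4 r^3 <= 4 / 1728 < 1 / 400]. *)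
Lemma square_term_bound (r : R) (n : nat) : 0 <= r <= 1 / 12 ->
  INR (S n * S n) * r ^ (S n * S n) <= 1 / 12 * (1 / 400) ^ n.
Proof.
  intros Hr. induction n as [|n IH]; [simpl; lra|].
  replace (S (S n) * S (S n))%nat with (S n * S n + (2 * n + 3))%nat by lia.
  rewrite pow_add, plus_INR.
  assert (B : INR (S n * S n) + INR (2 * n + 3) <= 4 * INR (S n * S n)).
  { rewrite <- plus_INR. replace 4 with (INR 4) by (simpl; ring). rewrite <- mult_INR. apply le_INR. nia. }
  assert (P : r ^ (2 * n + 3) <= 1 / 1728).
  { apply Rle_trans with (r ^ 3).
    - rewrite pow_add. rewrite <- (Rmult_1_l (r ^ 3)) at 2. apply Rmult_le_compat_r; [apply pow_le; lra|].
      apply Rle_trans with (1 ^ (2 * n)); [apply pow_incr; lra|rewrite pow1; lra].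
    - apply Rle_trans with ((1 / 12) ^ 3); [apply pow_incr; lra|lra]. }
  assert (R1 : 0 <= r ^ (S n * S n)) by (apply pow_le; lra).
  assert (R2 : 0 <= r ^ (2 * n + 3)) by (apply pow_le; lra).
  assert (R3 : 0 <= INR (S n * S n)) by apply pos_INR.
  apply Rle_trans with ((INR (S n * S n) * r ^ (S n * S n)) * (4 * (1 / 1728))).
  - replace ((INR (S n * S n) + INR (2 * n + 3)) * (r ^ (S n * S n) * r ^ (2 * n + 3)))
      with ((INR (S n * S n) + INR (2 * n + 3)) * r ^ (S n * S n) * r ^ (2 * n + 3)) by ring.
    replace ((INR (S n * S n) * r ^ (S n * S n)) * (4 * (1 / 1728)))
      with ((4 * INR (S n * S n)) * r ^ (S n * S n) * (1 / 1728)) by ring.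
    apply Rmult_le_compat; [|exact R2| |exact P].
    + apply Rmult_le_pos; [|exact R1]. pose proof (pos_INR (2 * n + 3)). lra.
    + apply Rmult_le_compat_r; [exact R1|exact B].
  - rewrite <- tech_pow_Rmult.
    assert (0 <= (1 / 400) ^ n) by (apply pow_le; lra). nra.
Qed.

(** The first term is at most [2 / 144], and the ratio of consecutive terms at most
    [3 r^4 <= 3 / 300]. *)
Lemma pronic_term_bound (r : R) (n : nat) : 0 <= r <= 1 / 12 ->
  INR (S n * S n + S n) * r ^ (S n * S n + S n) <= 1 / 72 * (1 / 100) ^ n.
Proof.
  intros Hr. induction n as [|n IH].
  - simpl. assert (r * r <= 1 / 144) by nra. nra.
  - replace (S (S n) * S (S n) + S (S n))%nat with (S n * S n + S n + (2 * n + 4))%nat by lia.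
    rewrite pow_add, plus_INR.
    set (m := (S n * S n + S n)%nat) in *.
    assert (B : INR m + INR (2 * n + 4) <= 3 * INR m).
    { rewrite <- plus_INR. replace 3 with (INR 3) by (simpl; ring). rewrite <- mult_INR.
      apply le_INR. unfold m. nia. }
    assert (P : r ^ (2 * n + 4) <= 1 / 300).
    { apply Rle_trans with (r ^ 4).
      - rewrite pow_add. rewrite <- (Rmult_1_l (r ^ 4)) at 2. apply Rmult_le_compat_r; [apply pow_le; lra|].
        apply Rle_trans with (1 ^ (2 * n)); [apply pow_incr; lra|rewrite pow1; lra].
      - apply Rle_trans with ((1 / 12) ^ 4); [apply pow_incr; lra|lra]. }
    assert (R1 : 0 <= r ^ m) by (apply pow_le; lra).
    assert (R2 : 0 <= r ^ (2 * n + 4)) by (apply pow_le; lra).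
    assert (R3 : 0 <= INR m) by apply pos_INR.
    apply Rle_trans with ((INR m * r ^ m) * (3 * (1 / 300))).
    + replace ((INR m + INR (2 * n + 4)) * (r ^ m * r ^ (2 * n + 4)))
        with ((INR m + INR (2 * n + 4)) * r ^ m * r ^ (2 * n + 4)) by ring.
      replace ((INR m * r ^ m) * (3 * (1 / 300))) with ((3 * INR m) * r ^ m * (1 / 300)) by ring.
      apply Rmult_le_compat; [|exact R2| |exact P].
      * apply Rmult_le_pos; [|exact R1]. pose proof (pos_INR (2 * n + 4)). lra.
      * apply Rmult_le_compat_r; [exact R1|exact B].
    + rewrite <- tech_pow_Rmult.
      assert (0 <= (1 / 100) ^ n) by (apply pow_le; lra). nra.
Qed.

Lemma shrink_series_bound (q : C) (t M s : R) (k : nat -> nat) (c : nat -> C) :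
  Cmod q < 1 -> 0 <= t <= 1 -> 0 <= s < 1 -> k 0%nat = 0%nat -> (forall n, (n <= k n)%nat) ->
  (forall n, Cmod (c n) = 1) ->
  (forall n, INR (k (S n)) * Cmod q ^ k (S n) <= M * s ^ n) ->
  Cmod (CSeries (fun n => c n * (t * q) ^ k n) - CSeries (fun n => c n * q ^ k n))%C
    <= (1 - t) * (M / (1 - s)).
Proof.
  intros Hq Ht Hs K0 Kn Hc HM.
  assert (Htq : Cmod (t * q)%C < 1).
  { rewrite Cmod_mult, Cmod_R, Rabs_pos_eq by lra. pose proof (Cmod_ge_0 q). nra. }
  assert (Sm : forall w, Cmod w < 1 -> abs_summable (fun n => c n * w ^ k n)%C).
  { intros w Hw. apply (lac_summable c k 1); [now apply lac_bounded_unit| |exact Hw].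
    intros n. specialize (Kn n). lia. }
  assert (Sd : abs_summable (fun n => c n * (t * q) ^ k n - c n * q ^ k n)%C).
  { apply abs_summable_ext with (fun n => c n * (t * q) ^ k n + RtoC (-1) * (c n * q ^ k n))%C;
      [intros; ring|]. apply abs_summable_plus; [now apply Sm|]. apply abs_summable_scal. now apply Sm. }
  rewrite <- CSeries_minus by now apply Sm. rewrite CSeries_incr by exact Sd.
  rewrite K0. replace (c 0%nat * (t * q) ^ 0 - c 0%nat * q ^ 0 + _)%C
    with (CSeries (fun n => c (S n) * (t * q) ^ k (S n) - c (S n) * q ^ k (S n))%C) by (simpl; ring).
  replace ((1 - t) * (M / (1 - s))) with (((1 - t) * M) / (1 - s)) by (field; lra).
  rewrite <- Series_geom_scal by lra.
  apply Cmod_CSeries_le; [|apply ex_series_geom_scal; lra].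
  intros n. replace (c (S n) * (t * q) ^ k (S n) - c (S n) * q ^ k (S n))%C
    with (c (S n) * ((t * q) ^ k (S n) - q ^ k (S n)))%C by ring.
  rewrite Cmod_mult, Hc, Rmult_1_l. eapply Rle_trans; [now apply pow_shrink_bound|].
  rewrite Rmult_assoc. apply Rmult_le_compat_l; [lra|apply HM].
Qed.

(** The constant comes from [2 * (1/12) / (1 - 1/400)], about 0.1671. In the same way [th10_shrink]
    uses [2 * (1/72) / (1 - 1/100)], about 0.0281. *)
Lemma th01_shrink (q : C) (t : R) : Cmod q <= 1 / 12 -> 0 <= t <= 1 ->
  Cmod (th01 (t * q) - th01 q)%C <= (1 - t) * (168 / 1000).
Proof.
  intros Hq Ht. pose proof (Cmod_ge_0 q) as Q0.
  assert (B := shrink_series_bound q t (1 / 12) (1 / 400) (fun n => n * n)%nat (fun n => RtoC (-1) ^ n)%C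
    ltac:(lra) Ht ltac:(lra) eq_refl ltac:(intros n; cbv beta; nia)).
  replace (th01 (t * q) - th01 q)%C
    with (2 * (CSeries (fun n => RtoC (-1) ^ n * (t * q) ^ (n * n))
             - CSeries (fun n => RtoC (-1) ^ n * q ^ (n * n))))%C.
  - rewrite Cmod_mult, Cmod_R, Rabs_pos_eq by lra.
    assert (B' := B ltac:(intros n; rewrite Cmod_pow, Cmod_R, Rabs_left by lra;
      replace (- -1) with 1 by ring; apply pow1) (fun n => square_term_bound (Cmod q) n (conj Q0 Hq))).
    simpl in B'. simpl. nra.
  - unfold th01, half_theta, PS.
    rewrite (CSeries_ext (fun n => RtoC (-1) ^ n * (t * q) ^ (n * n))%C (fun n => (t * q) ^ (n * n) * RtoC (-1) ^ n)%C)
      by (intros; ring).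
    rewrite (CSeries_ext (fun n => RtoC (-1) ^ n * q ^ (n * n))%C (fun n => q ^ (n * n) * RtoC (-1) ^ n)%C)
      by (intros; ring).
    ring.
Qed.

Lemma th10_shrink (q : C) (t : R) : Cmod q <= 1 / 12 -> 0 <= t <= 1 ->
  Cmod (th10 (t * q) - th10 q)%C <= (1 - t) * (29 / 1000).
Proof.
  intros Hq Ht. pose proof (Cmod_ge_0 q) as Q0.
  assert (B := shrink_series_bound q t (1 / 72) (1 / 100) (fun n => n * n + n)%nat (fun n => RtoC 1)
    ltac:(lra) Ht ltac:(lra) eq_refl ltac:(intros n; cbv beta; nia) (fun _ => Cmod_1)
    (fun n => pronic_term_bound (Cmod q) n (conj Q0 Hq))).
  replace (th10 (t * q) - th10 q)%C
    with (2 * (CSeries (fun n => RtoC 1 * (t * q) ^ (n * n + n))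
             - CSeries (fun n => RtoC 1 * q ^ (n * n + n))))%C.
  - rewrite Cmod_mult, Cmod_R, Rabs_pos_eq by lra. simpl in B. simpl. nra.
  - assert (K : forall w, half_theta w w = CSeries (fun n => RtoC 1 * w ^ (n * n + n))%C).
    { intros w. apply CSeries_ext. intros n. rewrite Cpow_add_r. ring. }
    unfold th10. rewrite !K. ring.
Qed.

(** Going up by [eta] replaces [q] by [t q] and multiplies [q^(1/4)] by [s = t^(1/4)]. The gain of
    [(1 - t) / 4] in this factor outweighs the relative changes of [th10] and [th01], which together
    cost at most [0.226 (1 - t)]. *)
Lemma quotient_decreasing (tau : C) (eta : R) : Cmod (nome tau) <= 1 / 12 -> 0 < eta ->
  let tau2 := (tau + eta * Ci)%C in
  Cmod (nome4 tau2) * Cmod (th10 (nome tau2)) * Cmod (th01 (nome tau)) <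
  Cmod (nome4 tau) * Cmod (th10 (nome tau)) * Cmod (th01 (nome tau2)).
Proof.
  intros Hq He tau2. pose proof PI_RGT_0 as PP.
  set (s := exp (- (PI * eta / 4))). set (t := s ^ 4).
  assert (S0 : 0 < s) by apply exp_pos.
  assert (S1 : s < 1) by (unfold s; rewrite <- exp_0; apply exp_increasing; nra).
  assert (T0 : 0 < t) by now apply pow_lt.
  assert (T1 : t < 1).
  { unfold t. assert (s * s < 1) by nra. simpl. nra. }
  assert (Im2 : Im tau2 = Im tau + eta).
  { unfold tau2. destruct tau as [x y]. simpl. ring. }
  assert (N4 : Cmod (nome4 tau2) = s * Cmod (nome4 tau)).
  { rewrite !Cmod_nome4, Im2. unfold s. rewrite <- exp_plus. f_equal. field. }
  assert (Ts : t = exp (- (PI * eta))).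
  { unfold t, s. replace (- (PI * eta)) with (4 * - (PI * eta / 4)) by field.
    simpl. rewrite !Rmult_1_r, <- !exp_plus. f_equal. field. }
  assert (Nq : nome tau2 = (t * nome tau)%C).
  { unfold nome, tau2. rewrite Ts.
    replace (RtoC (exp (- (PI * eta)))) with (Cexp (RtoC (- (PI * eta)))).
    - rewrite <- Cexp_plus. apply f_equal. rewrite RtoC_opp, RtoC_mult.
      replace (PI * Ci * (tau + eta * Ci))%C with (PI * Ci * tau + PI * eta * (Ci * Ci))%C by ring.
      replace (Ci * Ci)%C with (RtoC (-1)) by (apply injective_projections; simpl; ring). ring.
    - unfold Cexp. simpl. rewrite cos_0, sin_0. apply injective_projections; simpl; ring. }
  (* Bernoulli's inequality for [(1 - u)^4] with [u = (1 - t) / 4], since [s^4 = t]. *)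
  assert (Hs : s <= 1 - (1 - t) / 4).
  { apply Rnot_lt_le. intros Q.
    assert (B := bernoulli_pow s 4 ltac:(lra)). simpl INR in B. fold t in B.
    set (u := (1 - t) / 4) in *.
    assert (U : 0 < u < 1 / 4) by (unfold u; lra).
    assert (B2 := bernoulli_pow (1 - u) 4 ltac:(lra)). simpl INR in B2.
    assert (B3 : (1 - u) ^ 4 < s ^ 4).
    { assert (0 <= 1 - u) by lra. assert ((1 - u) ^ 2 < s ^ 2) by nra.
      replace ((1 - u) ^ 4) with ((1 - u) ^ 2 * (1 - u) ^ 2) by ring.
      replace (s ^ 4) with (s ^ 2 * s ^ 2) by ring.
      assert (0 <= (1 - u) ^ 2) by apply pow2_ge_0. nra. }
    fold t in B3. unfold u in *. lra. }
  rewrite N4, Nq.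
  assert (Hq2 : Cmod (t * nome tau)%C <= 1 / 12).
  { rewrite Cmod_mult, Cmod_R, Rabs_pos_eq by lra. pose proof (Cmod_ge_0 (nome tau)). nra. }
  assert (D1 := th01_shrink (nome tau) t Hq ltac:(lra)).
  assert (D2 := th10_shrink (nome tau) t Hq ltac:(lra)).
  destruct (theta_bounds _ Hq) as [_ [A1 A2]]. destruct (theta_bounds _ Hq2) as [_ [A3 A4]].
  assert (F0 : 0 < Cmod (nome4 tau)) by (rewrite Cmod_nome4; apply exp_pos).
  pose proof (Cmod_lip (th01 (t * nome tau)) (th01 (nome tau))) as L1.
  pose proof (Cmod_lip (th10 (t * nome tau)) (th10 (nome tau))) as L2.
  apply Rabs_le_between in L1. apply Rabs_le_between in L2.
  set (b1 := Cmod (th01 (nome tau))) in *. set (d1 := Cmod (th10 (nome tau))) in *.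
  set (b2 := Cmod (th01 (t * nome tau))) in *. set (d2 := Cmod (th10 (t * nome tau))) in *.
  set (u := 1 - t) in *.
  assert (U : 0 < u < 1) by (unfold u; lra).
  (* The shrinking bounds divided by the lower bounds [20/11] and [9/11]: [0.029 * 11/20 < 0.016]
     and [0.168 * 11/9 < 0.206]. *)
  assert (E1 : d2 <= d1 * (1 + u * (16 / 1000))) by nra.
  assert (E2 : b1 <= b2 * (1 + u * (206 / 1000))) by nra.
  assert (E3 : s * (1 + u * (16 / 1000)) * (1 + u * (206 / 1000)) < 1).
  { apply Rle_lt_trans with ((1 - u / 4) * (1 + u * (226 / 1000))).
    - rewrite Rmult_assoc. apply Rmult_le_compat; try lra; nra.
    - nra. }
  assert (E4 : d2 * b1 <= (d1 * (1 + u * (16 / 1000))) * (b2 * (1 + u * (206 / 1000)))).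
  { apply Rmult_le_compat; lra. }
  replace (s * Cmod (nome4 tau) * d2 * b1) with (Cmod (nome4 tau) * (s * (d2 * b1))) by ring.
  rewrite Rmult_assoc. apply Rmult_lt_compat_l; [exact F0|].
  apply Rle_lt_trans with ((s * (1 + u * (16 / 1000)) * (1 + u * (206 / 1000))) * (d1 * b2)).
  - apply Rle_trans with (s * ((d1 * (1 + u * (16 / 1000))) * (b2 * (1 + u * (206 / 1000))))).
    + apply Rmult_le_compat_l; lra.
    + right. ring.
  - assert (0 < d1 * b2) by nra. nra.
Qed.

(** * Comparison of theta01 with theta00 *)

Lemma Im_even_pow_bound (q : C) (k : nat) :
  Rabs (Im (q ^ (2 * k))%C) * Cmod q <= INR (2 * k) * Rabs (Re q) * Cmod q ^ (2 * k).
Proof.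
  pose proof (Cmod_ge_0 q) as Q0.
  induction k as [|k IH].
  - simpl. rewrite Rabs_R0. lra.
  - replace (2 * S k)%nat with (2 * k + 2)%nat by lia.
    rewrite Cpow_add_r, plus_INR, pow_add. simpl INR at 2.
    set (z := (q ^ (2 * k))%C) in *. set (n := INR (2 * k)) in *.
    assert (Mz : Cmod z = Cmod q ^ (2 * k)) by apply Cmod_pow. rewrite <- Mz in *.
    set (x := Rabs (Re q)) in *. assert (X0 : 0 <= x) by apply Rabs_pos.
    assert (N0 : 0 <= n) by apply pos_INR. pose proof (Cmod_ge_0 z) as Z0.
    assert (E : Im (z * q ^ 2)%C = Im z * Re (q ^ 2)%C + Re z * Im (q ^ 2)%C).
    { change (Re z * Im (q ^ 2)%C + Im z * Re (q ^ 2)%C = Im z * Re (q ^ 2)%C + Re z * Im (q ^ 2)%C). ring. }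
    (* [Im (q^2) = 2 Re q Im q] brings in the factor [Re q], and each further multiplication by
       [q^2] adds one such contribution. *)
    assert (I2 : Rabs (Im (q ^ 2)%C) <= 2 * x * Cmod q).
    { replace (Im (q ^ 2)%C) with (2 * Re q * Im q) by (destruct q as [a b]; simpl; ring).
      rewrite !Rabs_mult, (Rabs_pos_eq 2) by lra. fold x.
      apply Rmult_le_compat_l; [lra|apply im_le_Cmod]. }
    assert (R2 : Rabs (Re (q ^ 2)%C) <= Cmod q ^ 2).
    { rewrite <- Cmod_pow. apply re_le_Cmod. }
    pose proof (re_le_Cmod z) as Rz.
    rewrite E.
    assert (T : Rabs (Im z * Re (q ^ 2)%C + Re z * Im (q ^ 2)%C) <=
                Rabs (Im z) * Cmod q ^ 2 + Cmod z * (2 * x * Cmod q)).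
    { eapply Rle_trans; [apply Rabs_triang|]. rewrite !Rabs_mult.
      apply Rplus_le_compat; apply Rmult_le_compat; try apply Rabs_pos; try lra. }
    apply Rle_trans with ((Rabs (Im z) * Cmod q) * Cmod q ^ 2 + Cmod z * (2 * x * Cmod q ^ 2)).
    + apply Rle_trans with ((Rabs (Im z) * Cmod q ^ 2 + Cmod z * (2 * x * Cmod q)) * Cmod q).
      * apply Rmult_le_compat_r; assumption.
      * right. ring.
    + assert (P2 : 0 <= Cmod q ^ 2) by apply pow2_ge_0.
      assert (IH2 := Rmult_le_compat_r _ _ _ P2 IH).
      replace ((n + (1 + 1)) * x * (Cmod z * Cmod q ^ 2))
        with (n * x * Cmod z * Cmod q ^ 2 + Cmod z * (2 * x * Cmod q ^ 2)) by ring.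
      lra.
Qed.

Lemma nat_le_pow2 (k : nat) : INR (S k) <= 2 ^ k.
Proof.
  induction k as [|k IH]; [simpl; lra|]. rewrite S_INR, <- tech_pow_Rmult.
  assert (1 <= 2 ^ k) by (apply pow_R1_Rle; lra). lra.
Qed.

(** For the exponent [m = 4 k + 4] one has [m r^(m-1) <= (2 r)^(m-1) <= (1/6)^(m-1)], and [1 / 216]
    is [(1/6)^3]. *)
Lemma Im_quartic_pow_bound (q : C) (k n : nat) : Cmod q <= 1 / 12 -> (n <= k)%nat ->
  Rabs (Im ((q * q * (q * q)) ^ S k)%C) <= Rabs (Re q) / 216 * (1 / 6) ^ n.
Proof.
  intros Hq Hn. replace ((q * q * (q * q)) ^ S k)%C with (q ^ (2 * (2 * S k)))%C.
  2:{ replace (2 * (2 * S k))%nat with (4 * S k)%nat by lia. rewrite Cpow_mult_r. f_equal. simpl. ring. }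
  assert (B := Im_even_pow_bound q (2 * S k)).
  (* [Im_even_pow_bound] carries an extra factor [Cmod q], which has to be cancelled. *)
  destruct (Req_dec (Cmod q) 0) as [Z|NZ].
  - apply Cmod_eq_0 in Z. rewrite Z.
    replace (2 * (2 * S k))%nat with (S (2 * (2 * k + 1) + 1))%nat by lia.
    rewrite Cpow_S. replace (0 * 0 ^ _)%C with (RtoC 0) by ring. simpl. rewrite !Rabs_R0. lra.
  - pose proof (Cmod_ge_0 q) as Q0. assert (Q1 : 0 < Cmod q) by lra.
    set (r := Cmod q) in *. set (m := (2 * (2 * S k))%nat) in *.
    assert (Em : m = S (4 * k + 3)) by (unfold m; lia).
    rewrite Em in B at 2 3. rewrite <- tech_pow_Rmult in B.
    assert (B1 : Rabs (Im (q ^ m)%C) <= INR (S (4 * k + 3)) * Rabs (Re q) * r ^ (4 * k + 3)).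
    { apply Rmult_le_reg_r with r; [exact Q1|]. lra. }
    eapply Rle_trans; [exact B1|].
    pose proof (Rabs_pos (Re q)) as X0. set (x := Rabs (Re q)) in *.
    assert (R0 : 0 <= r ^ (4 * k + 3)) by (apply pow_le; lra).
    assert (C1 : INR (S (4 * k + 3)) * r ^ (4 * k + 3) <= (1 / 6) ^ (4 * k + 3)).
    { apply Rle_trans with (2 ^ (4 * k + 3) * r ^ (4 * k + 3)).
      - apply Rmult_le_compat_r; [exact R0|apply nat_le_pow2].
      - rewrite <- Rpow_mult_distr. apply pow_incr. lra. }
    assert (C2 : (1 / 6) ^ (4 * k + 3) <= 1 / 216 * (1 / 6) ^ n).
    { replace (4 * k + 3)%nat with (3 + (n + (4 * k - n)))%nat by lia. rewrite !pow_add.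
      replace ((1 / 6) ^ 3) with (1 / 216) by (simpl; field).
      apply Rmult_le_compat_l; [lra|]. rewrite <- (Rmult_1_r ((1 / 6) ^ n)) at 2.
      apply Rmult_le_compat_l; [apply pow_le; lra|].
      apply Rle_trans with (1 ^ (4 * k - n)); [apply pow_incr; lra|rewrite pow1; lra]. }
    apply Rle_trans with (x * (INR (S (4 * k + 3)) * r ^ (4 * k + 3))); [right; ring|].
    replace (x / 216 * (1 / 6) ^ n) with (x * (1 / 216 * (1 / 6) ^ n)) by field.
    apply Rmult_le_compat_l; [exact X0|lra].
Qed.

(** The constant term is real, and the others sum to at most [(1 / 216) / (1 - 1/6) = 1 / 180] times
    [|Re q|]. *)
Lemma Im_lacunary_bound (q : C) (k : nat -> nat) : Cmod q <= 1 / 12 ->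
  k 0%nat = 0%nat -> (forall n, (S n <= k (S n))%nat) ->
  Rabs (Im (CSeries (fun n => RtoC 1 * (q * q * (q * q)) ^ k n)%C)) <= Rabs (Re q) / 180.
Proof.
  intros Hq K0 Kn.
  assert (Hq4 : Cmod (q * q * (q * q))%C <= 1 / 12) by (apply Cmod_sq_small; [apply Cmod_sq_small|]; lra).
  set (w := (q * q * (q * q))%C) in *.
  assert (Sm : abs_summable (fun n => RtoC 1 * w ^ k n)%C).
  { apply (lac_summable (fun _ => RtoC 1) k 1).
    - apply lac_bounded_unit. intros _. apply Cmod_1.
    - intros [|n]; [lia|]. specialize (Kn n). lia.
    - lra. }
  rewrite CSeries_incr by exact Sm. rewrite K0.
  change (Im (RtoC 1 * w ^ 0 + CSeries (fun n => RtoC 1 * w ^ k (S n)))%C)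
    with (Im (RtoC 1 * w ^ 0)%C + Series (fun n => Im (RtoC 1 * w ^ k (S n))%C)).
  replace (Im (RtoC 1 * w ^ 0)%C) with 0 by (simpl; ring). rewrite Rplus_0_l.
  assert (T : forall n, Rabs (Im (RtoC 1 * w ^ k (S n))%C) <= Rabs (Re q) / 216 * (1 / 6) ^ n).
  { intros n. rewrite Cmult_1_l. specialize (Kn n).
    destruct (k (S n)) as [|m]; [lia|]. apply Im_quartic_pow_bound; [exact Hq|lia]. }
  assert (Ge : ex_series (fun n => Rabs (Re q) / 216 * (1 / 6) ^ n)) by (apply ex_series_geom_scal; lra).
  assert (Ab : ex_series (fun n => Rabs (Im (RtoC 1 * w ^ k (S n))%C))).
  { apply (ex_series_le (fun n => Rabs (Im (RtoC 1 * w ^ k (S n))%C)) (fun n => Rabs (Re q) / 216 * (1 / 6) ^ n)); [|exact Ge].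
    intros n. change (Rabs (Rabs (Im (RtoC 1 * w ^ k (S n))%C)) <= Rabs (Re q) / 216 * (1 / 6) ^ n).
    rewrite Rabs_Rabsolu. apply T. }
  eapply Rle_trans; [apply Series_Rabs; exact Ab|].
  apply Rle_trans with (Series (fun n => Rabs (Re q) / 216 * (1 / 6) ^ n)).
  - apply Series_le; [|exact Ge]. intros n. split; [apply Rabs_pos|apply T].
  - rewrite Series_geom_scal by lra. right. field.
Qed.

(* With [A + q D] and [A - q D] the two theta values, the claim is
   [Re (conj A q D) > 0]; all terms of [A], [D] are even powers of [q], whose
   imaginary parts are divisible by [Re q]. *)
Lemma th01_lt_th00 (q : C) : Cmod q <= 1 / 12 -> 0 < Re q -> Cmod (th01 q) < Cmod (th00 q).
Proof.
  intros Hq Hx. destruct (theta_split q ltac:(lra)) as [S0 S1].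
  set (w := (q * q * (q * q))%C) in *.
  assert (Hw : Cmod w <= 1 / 12) by (apply Cmod_sq_small; [apply Cmod_sq_small|]; lra).
  assert (KA : half_theta w 1 = CSeries (fun n => RtoC 1 * w ^ (n * n))%C).
  { apply CSeries_ext. intros n. rewrite Cpow_1_l. ring. }
  assert (KD : half_theta w w = CSeries (fun n => RtoC 1 * w ^ (n * n + n))%C).
  { apply CSeries_ext. intros n. rewrite Cpow_add_r. ring. }
  assert (IA := Im_lacunary_bound q (fun n => n * n)%nat Hq eq_refl ltac:(intros n; cbv beta; nia)).
  assert (ID := Im_lacunary_bound q (fun n => n * n + n)%nat Hq eq_refl ltac:(intros n; cbv beta; nia)).
  cbv beta in IA, ID. fold w in IA, ID. rewrite <- KA in IA. rewrite <- KD in ID.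
  assert (BA := half_theta_bounds w 1 Hw ltac:(rewrite Cmod_1; lra)).
  assert (BD := half_theta_bounds w w Hw ltac:(lra)).
  rewrite (Rabs_pos_eq (Re q)) in IA, ID by lra.
  pose proof (im_le_Cmod q) as Iq.
  assert (RA := Rle_trans _ _ _ (re_le_Cmod _) BA). assert (RD := Rle_trans _ _ _ (re_le_Cmod _) BD).
  apply sqrt_lt_1_alt. split; [apply Rplus_le_le_0_compat; apply pow2_ge_0|].
  rewrite S0, S1. unfold th00, th10.
  destruct (half_theta w 1) as [a1 a2]. destruct (half_theta w w) as [d1 d2].
  destruct q as [x y]. simpl in *.
  apply Rabs_le_between in IA. apply Rabs_le_between in ID.
  apply Rabs_le_between in RA. apply Rabs_le_between in RD.
  assert (Iq' : Rabs y <= 1 / 12) by lra. apply Rabs_le_between in Iq'.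
  set (A1 := 2 * a1 - 1). set (A2 := 2 * a2).
  set (D1 := 2 * d1). set (D2 := 2 * d2).
  (* The main term [x A1 D1] is at least [x * 180 / 121]. In all other terms [A2] or [D2]
     contributes a factor [x / 90], so they cannot change the sign however small [x] is. *)
  assert (P : 0 < x * (A1 * D1 + A2 * D2) - y * (A1 * D2 - A2 * D1)).
  { assert (Q1 : 9 / 11 <= A1 <= 13 / 11) by (unfold A1; lra).
    assert (Q2 : 20 / 11 <= D1 <= 24 / 11) by (unfold D1; lra).
    assert (Q3 : - (x / 90) <= A2 <= x / 90) by (unfold A2; lra).
    assert (Q4 : - (x / 90) <= D2 <= x / 90) by (unfold D2; lra).
    assert (X1 : x <= 1 / 12).
    { pose proof (re_le_Cmod (x, y)) as R. simpl in R. rewrite Rabs_pos_eq in R; lra. }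
    assert (Pr : forall a b m n, - m <= a <= m -> - n <= b <= n -> - (m * n) <= a * b <= m * n).
    { intros a b m n Ha Hb. apply Rabs_le_between. rewrite Rabs_mult.
      apply Rmult_le_compat; try apply Rabs_pos; now apply Rabs_le. }
    assert (U1 : 9 / 11 * (20 / 11) <= A1 * D1) by (apply Rmult_le_compat; lra).
    assert (U2 := Pr A2 D2 _ _ Q3 Q4).
    assert (U3 := Pr A1 D2 (13 / 11) (x / 90) ltac:(lra) Q4).
    assert (U4 := Pr A2 D1 (x / 90) (24 / 11) Q3 ltac:(lra)).
    assert (U5 := Pr y (A1 * D2 - A2 * D1) (1 / 12) (x / 10) ltac:(lra) ltac:(lra)).
    assert (U6 : x / 90 * (x / 90) <= 1 / 10) by nra.
    assert (U7 : x * 1 <= x * (A1 * D1 + A2 * D2)) by (apply Rmult_le_compat_l; lra).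
    lra. }
  unfold A1, A2, D1, D2 in *. clear -P. lra.
Qed.

(** * The theta constants of the statement in terms of the nome *)

Lemma half_theta_incr (q v : C) : Cmod q < 1 ->
  half_theta q v = (1 + CSeries (fun n => q ^ (S n * S n) * v ^ S n)%C)%C.
Proof.
  intros H. unfold half_theta, PS. rewrite CSeries_incr by now apply half_theta_summable.
  apply f_equal2; [simpl; ring|reflexivity].
Qed.

Lemma nome_pow (tau : C) (n : nat) : (nome tau ^ n)%C = Cexp (INR n * (PI * Ci * tau))%C.
Proof. unfold nome. now rewrite Cexp_mult_nat. Qed.

Lemma IZR_neg_index (k : nat) : IZR (-1 - Z.of_nat k) = - INR (S k).
Proof. rewrite minus_IZR, <- INR_IZR_INZ, S_INR. ring. Qed.

Lemma theta_00_eq (tau : C) : 0 < Im tau -> theta 0 0 tau = th00 (nome tau).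
Proof.
  intros H. pose proof (nome_lt_1 tau H) as Hq. unfold theta, ZSeries, th00.
  transitivity (half_theta (nome tau) 1 + CSeries (fun n => nome tau ^ (S n * S n) * RtoC 1 ^ S n)%C)%C.
  - apply f_equal2; apply CSeries_ext; intros n; rewrite Cpow_1_l, Cmult_1_r, nome_pow; apply f_equal.
    + rewrite <- INR_IZR_INZ, mult_INR. simpl (INR 0).
      rewrite !RtoC_div, RtoC_plus, RtoC_mult, RtoC_div by lra. field.
    + rewrite IZR_neg_index, mult_INR. simpl (INR 0).
      rewrite !RtoC_div, RtoC_plus, RtoC_opp, RtoC_mult, RtoC_div by lra. field.
  - rewrite half_theta_incr by exact Hq. ring.
Qed.

Lemma Cexp_pi_i : Cexp (PI * Ci)%C = RtoC (-1).
Proof.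
  unfold Cexp. replace (PI * Ci)%C with (0, PI) by (apply injective_projections; simpl; ring).
  simpl. rewrite exp_0, cos_PI, sin_PI. apply injective_projections; simpl; ring.
Qed.

Lemma theta_01_eq (tau : C) : 0 < Im tau -> theta 0 1 tau = th01 (nome tau).
Proof.
  intros H. pose proof (nome_lt_1 tau H) as Hq. unfold theta, ZSeries, th01.
  transitivity (half_theta (nome tau) (-1) + CSeries (fun n => nome tau ^ (S n * S n) * RtoC (-1) ^ S n)%C)%C.
  - apply f_equal2; apply CSeries_ext; intros n.
    + rewrite <- Cexp_pi_i, <- Cexp_mult_nat, nome_pow, <- Cexp_plus. apply f_equal.
      rewrite <- INR_IZR_INZ, mult_INR. simpl (INR 0). simpl (INR 1).
      rewrite !RtoC_div, RtoC_plus, RtoC_mult, RtoC_div by lra. field.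
    + replace (RtoC (-1) ^ S n)%C with (Cexp (INR (S n) * (- (PI * Ci)))%C).
      * rewrite nome_pow, <- Cexp_plus. apply f_equal.
        rewrite IZR_neg_index, mult_INR. simpl (INR 0). simpl (INR 1).
        rewrite !RtoC_div, RtoC_plus, RtoC_opp, RtoC_mult, RtoC_div by lra. field.
      * rewrite Cexp_mult_nat, Cexp_opp, Cexp_pi_i. f_equal. field.
  - rewrite half_theta_incr by exact Hq. ring.
Qed.

(** The indices [n] and [-1 - n] have opposite values of [n + 1/2], so both halves of the series
    agree; [(n + 1/2)^2 = n^2 + n + 1/4] leaves [q^(1/4)] in front. *)
Lemma theta_10_eq (tau : C) : 0 < Im tau -> theta 1 0 tau = (nome4 tau * th10 (nome tau))%C.
Proof.
  intros H. pose proof (nome_lt_1 tau H) as Hq. unfold theta, ZSeries, th10.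
  transitivity (nome4 tau * half_theta (nome tau) (nome tau) + nome4 tau * half_theta (nome tau) (nome tau))%C;
    [|ring].
  unfold half_theta, PS. rewrite <- CSeries_scal by now apply half_theta_summable.
  apply f_equal2; apply CSeries_ext; intros n;
    rewrite !nome_pow; unfold nome4; rewrite <- !Cexp_plus; apply f_equal.
  - rewrite <- INR_IZR_INZ, mult_INR. simpl (INR 0). simpl (INR 1).
    rewrite !RtoC_div, RtoC_plus, RtoC_mult, RtoC_div by lra. field.
  - rewrite IZR_neg_index, mult_INR, S_INR. simpl (INR 0). simpl (INR 1).
    rewrite !RtoC_div, RtoC_plus, RtoC_opp, RtoC_plus, RtoC_mult, RtoC_div by lra. field.
Qed.

Lemma nome_small (tau : C) : sqrt 3 / 2 <= Im tau -> Cmod (nome tau) <= 1 / 12.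
Proof.
  intros H. rewrite Cmod_nome, exp_Ropp.
  assert (S3 : 173 / 100 <= sqrt 3).
  { pose proof sqrt3_sq. pose proof (sqrt_pos 3). nra. }
  assert (P3 : 3 <= PI) by (pose proof PI2_3_2; lra).
  set (x := PI * Im tau). assert (X : 2595 / 1000 <= x) by (unfold x; nra).
  (* Six squarings of [1 + x / 64 <= exp (x / 64)], rounded down each time. As [exp 2.595] is about
     13.4, the losses leave more than 12. *)
  assert (E : 12 <= exp x).
  { replace x with (x / 64 + x / 64 + (x / 64 + x / 64) + (x / 64 + x / 64 + (x / 64 + x / 64))
      + (x / 64 + x / 64 + (x / 64 + x / 64) + (x / 64 + x / 64 + (x / 64 + x / 64)))
      + (x / 64 + x / 64 + (x / 64 + x / 64) + (x / 64 + x / 64 + (x / 64 + x / 64))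
      + (x / 64 + x / 64 + (x / 64 + x / 64) + (x / 64 + x / 64 + (x / 64 + x / 64)))) + x / 2) by field.
    replace (x / 2) with (x / 64 * 32) by field.
    set (y := x / 64). assert (Y : 405 / 10000 <= y) by (unfold y; lra).
    assert (E1 : 1 + 405 / 10000 <= exp y) by (pose proof (exp_ineq1_le y); lra).
    assert (Sq : forall a b c, 0 <= a -> a <= exp b -> c <= a * a -> c <= exp (b + b)).
    { intros a b c Ha Hb Hc. rewrite exp_plus. nra. }
    assert (E2 : 10826 / 10000 <= exp (y + y)) by (apply (Sq (1 + 405 / 10000)); lra).
    assert (E3 : 1172 / 1000 <= exp (y + y + (y + y))) by (apply (Sq (10826 / 10000)); lra).
    assert (E4 : 13735 / 10000 <= exp (y + y + (y + y) + (y + y + (y + y)))) by (apply (Sq (1172 / 1000)); lra).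
    set (z := y + y + (y + y) + (y + y + (y + y))) in *.
    assert (E5 : 1886 / 1000 <= exp (z + z)) by (apply (Sq (13735 / 10000)); lra).
    assert (E6 : 3556 / 1000 <= exp (z + z + (z + z))) by (apply (Sq (1886 / 1000)); lra).
    replace (y * 32) with (z + z + (z + z)) by (unfold z; ring).
    apply (Sq (3556 / 1000)); lra. }
  apply Rle_trans with (/ 12); [|lra]. apply Rinv_le_contravar; lra.
Qed.

Lemma upper_lt (tau : C) : 0 < Im tau -> 1 < Cmod tau -> Rabs (Re tau) <= 1 / 2 ->
  Cmod (nome tau) <= 1 / 12 /\
  Cmod (nome4 tau) * Cmod (th10 (nome tau)) < Cmod (th01 (nome tau)).
Proof.
  intros Hi Hm Hr. destruct tau as [x y]. simpl in Hi, Hr. apply Rabs_le_between in Hr.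
  assert (M2 := Cmod2_alt (x, y)). simpl in M2.
  assert (Nn : 0 <= 1 - x * x) by nra.
  (* The point of the unit circle below [tau], where the two moduli agree; [|x| <= 1/2] places it at
     height at least [sqrt 3 / 2]. *)
  set (y0 := sqrt (1 - x * x)). assert (Y0 : y0 * y0 = 1 - x * x) by now apply sqrt_sqrt.
  assert (Y0p : 0 <= y0) by apply sqrt_pos.
  assert (Yl : y0 < y).
  { apply Rnot_le_lt. intros Q. assert (y * y <= y0 * y0) by nra. nra. }
  pose proof sqrt3_sq as S3. pose proof (sqrt_pos 3) as S3p.
  assert (Y1 : sqrt 3 / 2 <= y0).
  { apply Rnot_lt_le. intros Q. assert (y0 * y0 < sqrt 3 / 2 * (sqrt 3 / 2)) by nra. nra. }
  assert (H0 : Cmod (nome (x, y0)) <= 1 / 12) by (apply nome_small; exact Y1).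
  assert (C1 : Cmod (x, y0) = 1).
  { unfold Cmod. transitivity (sqrt 1); [apply f_equal; simpl; lra|apply sqrt_1]. }
  assert (U := unit_circle_moduli (x, y0) C1 H0).
  assert (D := quotient_decreasing (x, y0) (y - y0) H0 ltac:(lra)). cbv zeta in D.
  replace ((x, y0) + (y - y0)%R * Ci)%C with (x, y) in D by (apply injective_projections; simpl; ring).
  rewrite U in D.
  split; [apply nome_small; simpl; lra|].
  destruct (theta_bounds _ H0) as [_ [B _]].
  rewrite (Rmult_comm (Cmod (th01 (nome (x, y0))))) in D. apply Rmult_lt_reg_r in D; [exact D|lra].
Qed.

(** * Translation by 1 and the modulus inequalities on the domain *)

Lemma nome_succ (tau : C) : nome (tau + 1)%C = (- nome tau)%C.
Proof.
  unfold nome. replace (PI * Ci * (tau + 1))%C with (PI * Ci * tau + PI * Ci)%C by ring.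
  rewrite Cexp_plus, Cexp_pi_i. ring.
Qed.

Lemma half_theta_opp (q v : C) : half_theta (- q)%C v = half_theta q (- v)%C.
Proof.
  apply CSeries_ext. intros n.
  replace (- q)%C with (RtoC (-1) * q)%C by ring. replace (- v)%C with (RtoC (-1) * v)%C by ring.
  rewrite !Cpow_mult_l.
  assert (E : (RtoC (-1) ^ (n * n))%C = (RtoC (-1) ^ n)%C).
  { assert (S2 : forall m, (RtoC (-1) ^ (2 * m))%C = RtoC 1).
    { intros m. rewrite Cpow_mult_r. replace (RtoC (-1) ^ 2)%C with (RtoC 1) by (simpl; ring). apply Cpow_1_l. }
    destruct (Nat.Even_or_Odd n) as [[m ->]|[m ->]].
    - replace (2 * m * (2 * m))%nat with (2 * (m * (2 * m)))%nat by lia. now rewrite !S2.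
    - replace ((2 * m + 1) * (2 * m + 1))%nat with (2 * (2 * (m * m) + 2 * m) + 1)%nat by lia.
      now rewrite !Cpow_add_r, !S2. }
  rewrite E. ring.
Qed.

Lemma th01_opp (q : C) : th01 (- q)%C = th00 q.
Proof. unfold th01, th00. rewrite half_theta_opp. replace (- RtoC (-1))%C with (RtoC 1) by ring. reflexivity. Qed.

Lemma th00_opp (q : C) : th00 (- q)%C = th01 q.
Proof. rewrite <- th01_opp. f_equal. ring. Qed.

Lemma th10_opp (q : C) : th10 (- q)%C = th10 q.
Proof. unfold th10. rewrite half_theta_opp. replace (- - q)%C with q by ring. reflexivity. Qed.

Lemma Cmod_nome4_succ (tau : C) : Cmod (nome4 (tau + 1)%C) = Cmod (nome4 tau).
Proof. rewrite !Cmod_nome4. destruct tau as [x y]. simpl. f_equal. lra. Qed.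

Lemma Re_nome_pos (tau : C) : - (1 / 2) < Re tau < 1 / 2 -> 0 < Re (nome tau).
Proof.
  intros H. unfold nome, Cexp. destruct tau as [x y]. simpl in H.
  replace (PI * Ci * (x, y))%C with (- (PI * y), PI * x) by (apply injective_projections; simpl; ring).
  simpl. pose proof PI_RGT_0.
  assert (0 < cos (PI * x)) by (apply cos_gt_0; nra).
  pose proof (exp_pos (- (PI * y))). nra.
Qed.

Definition strict_domain (tau : C) : Prop :=
  0 < Im tau /\ - (3 / 2) < Re tau < 1 / 2 /\ 1 < Cmod tau /\ 1 < Cmod (tau + 1)%C.

(** For [Re tau > -1/2], [upper_lt] compares theta10 with theta01, and [Re q > 0] makes theta01
    smaller than theta00. For [Re tau < -1/2] the same is applied to [tau + 1], where theta00 and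
    theta01 have changed places. *)
Lemma strict_domain_moduli (tau : C) : strict_domain tau ->
  Cmod (nome tau) <= 1 / 12 /\
  Cmod (nome4 tau) * Cmod (th10 (nome tau)) < Cmod (th01 (nome tau)) /\
  Cmod (nome4 tau) * Cmod (th10 (nome tau)) < Cmod (th00 (nome tau)).
Proof.
  intros [Hi [Hr [H1 H2]]].
  assert (Sh : Rabs (Re (tau + 1)%C) <= 1 / 2 ->
    Cmod (nome tau) <= 1 / 12 /\ Cmod (nome4 tau) * Cmod (th10 (nome tau)) < Cmod (th00 (nome tau))).
  { intros Ha. assert (Hi' : 0 < Im (tau + 1)%C) by (destruct tau; simpl in *; lra).
    destruct (upper_lt (tau + 1)%C Hi' H2 Ha) as [Q1 Q2].
    rewrite nome_succ, Cmod_opp in Q1. rewrite nome_succ, th10_opp, th01_opp, Cmod_nome4_succ in Q2.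
    now split. }
  assert (Re1 : Re (tau + 1)%C = Re tau + 1) by reflexivity.
  destruct (Rle_lt_dec (- (1 / 2)) (Re tau)) as [L|L].
  - destruct (upper_lt tau Hi H1 ltac:(apply Rabs_le; lra)) as [Q1 Q2].
    split; [exact Q1|split; [exact Q2|]].
    (* On the middle line [q] is purely imaginary and [th01_lt_th00] does not apply, but there
       [upper_lt] is available for both [tau] and [tau + 1]. *)
    destruct (Req_dec (Re tau) (- (1 / 2))) as [E|E].
    + apply Sh. apply Rabs_le. lra.
    + assert (P := th01_lt_th00 (nome tau) Q1 (Re_nome_pos tau ltac:(lra))). lra.
  - destruct Sh as [Q1 Q2]; [apply Rabs_le; lra|].
    split; [exact Q1|split; [|exact Q2]].
    assert (P := th01_lt_th00 (- nome tau)%C). rewrite Cmod_opp, th01_opp, th00_opp in P.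
    specialize (P Q1). rewrite <- nome_succ in P. specialize (P (Re_nome_pos (tau + 1)%C ltac:(lra))). lra.
Qed.

(** * Proof of the theorem *)

(* [1 - nu = mu^3] with [mu = (1 + omega^2 l) / (1 + omega l)], and the two
   hypotheses say that [mu] lies in the sector [|arg mu| < pi / 3]. *)
Lemma nu_lambda_cut_plane (l : C) : Cmod l < 1 -> Cmod l < Cmod (1 - l)%C ->
  (1 + omega * l)%C <> RtoC 0 /\ cut_plane (nu_lambda l).
Proof.
  intros H1 H2.
  assert (N : (1 + omega * l)%C <> RtoC 0).
  { apply Cmod_1_plus_nz. rewrite Cmod_mult, Cmod_omega. lra. }
  split; [exact N|].
  set (m := (1 + omega * l)%C) in *. set (k := Cmod m ^ 2).
  assert (K0 : 0 < k) by (apply pow_lt; now apply Cmod_gt_0).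
  (* A positive multiple of [mu], namely [k * mu], with no division left. *)
  pose (p := ((1 + omega * omega * l) * Cconj m)%C).
  assert (Nc : Cconj m <> RtoC 0).
  { apply Cmod_gt_0. rewrite Cmod_conj. now apply Cmod_gt_0. }
  assert (E : ((1 - nu_lambda l) * RtoC (k * k * k))%C = (p * p * p)%C).
  { rewrite one_minus_nu_lambda by exact N. fold m. unfold p, k.
    rewrite !RtoC_mult, Cmod2_conj. field. exact N. }
  assert (Lo := Cmod2_alt l). assert (L1 := Cmod2_alt (1 - l)%C).
  pose proof (Cmod_ge_0 l) as C0. pose proof (Cmod_ge_0 (1 - l)%C) as C1.
  assert (P : p = (1 - Re l - Cmod l ^ 2 / 2, sqrt 3 / 2 * (Cmod l ^ 2 - 2 * Re l))).
  { unfold p, m. rewrite omega_sq, Lo, omega_eq. pose proof sqrt3_sq as S3.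
    destruct l as [x y]. apply injective_projections; simpl; nra. }
  set (s := Cmod l ^ 2) in *.
  assert (S1 : s < 1) by (unfold s; simpl; nra).
  assert (X1 : Re l < 1 / 2).
  { assert (Cmod l ^ 2 < Cmod (1 - l)%C ^ 2) by (simpl; nra). rewrite L1 in H. fold s in H. rewrite Lo in H.
    destruct l as [x y]. simpl in *. nra. }
  set (a := 1 - Re l - s / 2) in *. set (b := sqrt 3 / 2 * (s - 2 * Re l)) in *.
  assert (A0 : 0 < a) by (unfold a; lra).
  assert (B2 : b * b < 3 * (a * a)).
  { pose proof sqrt3_sq as S3.
    replace (b * b) with (3 * ((s - 2 * Re l) / 2 * ((s - 2 * Re l) / 2)))
      by (unfold b; rewrite <- S3 at 1; field).
    (* The upper bound amounts to [s < 1] and the lower one to [Re l < 1/2]: the two hypotheses are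
       the two sides of the sector. *)
    assert (- a < (s - 2 * Re l) / 2 < a) by (unfold a; lra). nra. }
  rewrite P in E. intros [I0 R1].
  destruct (nu_lambda l) as [u v]. simpl in I0, R1. subst v.
  assert (E1 := f_equal fst E). assert (E2 := f_equal snd E). simpl in E1, E2.
  (* If [nu] is real, the imaginary part of [p^3] vanishes; inside the sector this forces [b = 0],
     and then [1 - nu] is positive. *)
  assert (Z : b * (3 * (a * a) - b * b) = 0) by lra.
  apply Rmult_integral in Z. destruct Z as [Z|Z]; [|lra].
  rewrite Z in E1. assert (0 < a * a * a) by (repeat apply Rmult_lt_0_compat; lra).
  assert (K3 : 0 < k * k * k) by (apply Rmult_lt_0_compat; [apply Rmult_lt_0_compat|]; exact K0).
  assert (E3 : (1 - u) * (k * k * k) = a * a * a) by lra.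
  assert ((1 - u) * (k * k * k) <= 0 * (k * k * k)) by (apply Rmult_le_compat_r; lra). lra.
Qed.

Lemma theta_as_nome (tau : C) : 0 < Im tau ->
  weight2 tau = (th00 (nome tau) ^ 4 + omega * (nome tau * th10 (nome tau) ^ 4))%C.
Proof.
  intros H. unfold weight2. rewrite theta_00_eq, theta_10_eq, Cpow_mult_l, nome4_pow by exact H. reflexivity.
Qed.

Lemma weight2_lam (tau : C) : Cmod (nome tau) <= 1 / 12 ->
  weight2 tau = (th00 (nome tau) ^ 4 * (1 + omega * lam (nome tau)))%C.
Proof.
  intros H. rewrite theta_as_nome by now apply nome_pos_Im.
  destruct (theta_nz _ H) as [N _]. unfold lam. field. exact N.
Qed.

Lemma one_minus_lam (tau : C) : Cmod (nome tau) <= 1 / 12 ->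
  (1 - lam (nome tau))%C = (th01 (nome tau) ^ 4 / th00 (nome tau) ^ 4)%C.
Proof.
  intros H. destruct (theta_nz _ H) as [N _]. assert (J := jacobi_quartic tau H). cbv zeta in J.
  unfold lam.
  transitivity ((th00 (nome tau) ^ 4 - nome tau * th10 (nome tau) ^ 4) / th00 (nome tau) ^ 4)%C.
  - field. exact N.
  - rewrite J at 1. f_equal. ring.
Qed.

Lemma nu_lam (tau : C) : Cmod (nome tau) <= 1 / 12 -> (1 + omega * lam (nome tau))%C <> RtoC 0 ->
  nu tau = nu_lambda (lam (nome tau)).
Proof.
  intros H N. unfold nu, nu_lambda. rewrite weight2_lam by exact H.
  pose proof (nome_pos_Im tau H) as Hi.
  rewrite theta_00_eq, theta_01_eq, theta_10_eq, (Cpow_mult_l (nome4 tau)), nome4_pow by exact Hi.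
  rewrite one_minus_lam by exact H.
  replace (nome tau * th10 (nome tau) ^ 4)%C with (lam (nome tau) * th00 (nome tau) ^ 4)%C.
  - destruct (theta_nz _ H) as [N0 _]. field. now split.
  - destruct (theta_nz _ H) as [N0 _]. unfold lam. field. exact N0.
Qed.

Lemma strict_domain_nu (tau : C) : strict_domain tau ->
  weight2 tau <> RtoC 0 /\ cut_plane (nu tau).
Proof.
  intros H. destruct (strict_domain_moduli tau H) as [Hq [M1 M2]].
  destruct (theta_nz _ Hq) as [N0 [N1 _]].
  set (x := Cmod (nome4 tau) * Cmod (th10 (nome tau))) in *.
  assert (X0 : 0 <= x) by (apply Rmult_le_pos; apply Cmod_ge_0).
  assert (P4 : forall a b, 0 <= a -> a < b -> a ^ 4 < b ^ 4).
  { intros a b Ha Hb. assert (a * a < b * b) by nra.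
    replace (a ^ 4) with ((a * a) * (a * a)) by ring. replace (b ^ 4) with ((b * b) * (b * b)) by ring. nra. }
  assert (Ml : Cmod (lam (nome tau)) = x ^ 4 / Cmod (th00 (nome tau)) ^ 4).
  { unfold lam. rewrite Cmod_div by now apply Cpow_nz. rewrite Cmod_mult, !Cmod_pow.
    rewrite <- nome4_pow at 1. rewrite Cmod_pow. unfold x. now rewrite Rpow_mult_distr. }
  assert (A0 : 0 < Cmod (th00 (nome tau)) ^ 4) by (apply pow_lt; now apply Cmod_gt_0).
  destruct (nu_lambda_cut_plane (lam (nome tau))) as [C1 C2].
  - rewrite Ml. apply Rmult_lt_reg_r with (Cmod (th00 (nome tau)) ^ 4); [exact A0|].
    unfold Rdiv. rewrite Rmult_assoc, Rinv_l, Rmult_1_l, Rmult_1_r by lra. now apply P4.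
  - rewrite Ml, one_minus_lam, Cmod_div, !Cmod_pow by (try apply Cpow_nz; assumption).
    apply Rmult_lt_compat_r; [now apply Rinv_0_lt_compat|]. now apply P4.
  - rewrite nu_lam by assumption. split; [|exact C2].
    rewrite weight2_lam by exact Hq. apply Cmult_neq_0; [now apply Cpow_nz|exact C1].
Qed.

(** * Holomorphy in [tau], the identity near the cusp, and its continuation *)

Lemma cderiv_nome (tau : C) : exists l, cderiv nome tau l.
Proof.
  eexists. apply (cderiv_comp Cexp (fun tau => PI * Ci * tau)%C); [apply cderiv_scal, cderiv_id|apply cderiv_Cexp].
Qed.

Lemma upper_half_plane_ball (tau w : C) : Cmod (w - tau)%C < Im tau -> 0 < Im w.
Proof.
  intros H. pose proof (Im_lip w tau) as L. apply Rabs_le_between in L. lra.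
Qed.

Lemma cderiv_theta (p q : nat) (f : C -> C) (tau : C) : 0 < Im tau ->
  (forall t, 0 < Im t -> theta p q t = f t) -> (exists l, cderiv f tau l) ->
  exists l, cderiv (theta p q) tau l.
Proof.
  intros Hi E [l L]. exists l. apply (cderiv_ext_loc f _ tau l (Im tau) Hi); [|exact L].
  intros w Hw. symmetry. apply E. now apply upper_half_plane_ball with tau.
Qed.

Lemma cderiv_theta_00 (tau : C) : 0 < Im tau -> exists l, cderiv (theta 0 0) tau l.
Proof.
  intros Hi. apply (cderiv_theta 0 0 (fun t => th00 (nome t)) tau Hi theta_00_eq).
  destruct (cderiv_nome tau) as [l L]. destruct (cderiv_th00 (nome tau) (nome_lt_1 tau Hi)) as [m M].
  eexists. apply (cderiv_comp th00 nome); eassumption.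
Qed.

Lemma cderiv_theta_01 (tau : C) : 0 < Im tau -> exists l, cderiv (theta 0 1) tau l.
Proof.
  intros Hi. apply (cderiv_theta 0 1 (fun t => th01 (nome t)) tau Hi theta_01_eq).
  destruct (cderiv_nome tau) as [l L]. destruct (cderiv_th01 (nome tau) (nome_lt_1 tau Hi)) as [m M].
  eexists. apply (cderiv_comp th01 nome); eassumption.
Qed.

Lemma cderiv_theta_10 (tau : C) : 0 < Im tau -> exists l, cderiv (theta 1 0) tau l.
Proof.
  intros Hi. apply (cderiv_theta 1 0 (fun t => nome4 t * th10 (nome t))%C tau Hi theta_10_eq).
  destruct (cderiv_nome tau) as [l L]. destruct (cderiv_th10 (nome tau) (nome_lt_1 tau Hi)) as [m M].
  eexists. apply cderiv_mult.
  - apply (cderiv_comp Cexp (fun tau => PI * Ci * tau / 4)%C); [|apply cderiv_Cexp].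
    apply cderiv_div; [apply cderiv_scal, cderiv_id|apply cderiv_const|apply RtoC_nz; lra].
  - apply (cderiv_comp th10 nome); eassumption.
Qed.

Lemma cderiv_weight2 (tau : C) : 0 < Im tau -> exists l, cderiv weight2 tau l.
Proof.
  intros Hi. destruct (cderiv_theta_00 tau Hi) as [l L]. destruct (cderiv_theta_10 tau Hi) as [m M].
  eexists. unfold weight2. apply cderiv_plus; [apply cderiv_pow, L|].
  apply cderiv_scal, cderiv_pow, M.
Qed.

Lemma cderiv_nu (tau : C) : 0 < Im tau -> weight2 tau <> RtoC 0 -> exists l, cderiv nu tau l.
Proof.
  intros Hi N. destruct (cderiv_theta_00 tau Hi) as [l0 L0]. destruct (cderiv_theta_01 tau Hi) as [l1 L1].
  destruct (cderiv_theta_10 tau Hi) as [l2 L2]. destruct (cderiv_weight2 tau Hi) as [m M].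
  eexists. unfold nu. apply cderiv_div; [|apply cderiv_pow, M|now apply Cpow_nz].
  apply cderiv_scal, cderiv_mult; [apply cderiv_mult|]; apply cderiv_pow; eassumption.
Qed.

Lemma Cmod_sixth_le : Cmod (1 / 6)%C <= 1 / 2.
Proof. rewrite Cmod_sixth. lra. Qed.

(** The prefactor [(1 + omega l)^(-1/2)] of the cubic transformation, once squared, cancels the
    factor [1 + omega l] of [weight2]. *)
Lemma weight2_near_cusp : exists r, 0 < r /\ forall tau : C, Cmod (nome tau) < r ->
  weight2 tau = (hypergeom (1 / 6)%C (1 / 2)%C (RtoC 1) (nu tau) ^ 2)%C.
Proof.
  destruct hyp_lam as [r1 [R1 H1]]. destruct cubic_transformation as [r2 [R2 H2]].
  (* Since [|lam q| <= 60 |q|], the bound [r2 / 100] on the nome puts [lam q] inside the disc of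
     radius [r2]. *)
  exists (Rmin r1 (r2 / 100)). split; [apply Rmin_pos; lra|]. intros tau Hq.
  assert (Q1 : Cmod (nome tau) < r1) by (eapply Rlt_le_trans; [exact Hq|apply Rmin_l]).
  assert (Q2 : Cmod (nome tau) < r2 / 100) by (eapply Rlt_le_trans; [exact Hq|apply Rmin_r]).
  assert (Q3 : Cmod (nome tau) <= 1 / 12) by lra.
  pose proof (lam_bound _ Q3) as Bl. pose proof (Cmod_ge_0 (nome tau)) as Q0.
  specialize (H1 tau Q1). specialize (H2 (lam (nome tau)) ltac:(lra)).
  assert (Wl : Cmod (omega * lam (nome tau))%C < 1) by (rewrite Cmod_mult, Cmod_omega; lra).
  rewrite weight2_lam, nu_lam by (try apply Cmod_1_plus_nz; assumption).
  rewrite (proj2 (hypergeom_spec (1 / 6) Cmod_sixth_le)) by (apply nu_lambda_bound; lra).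
  set (l := lam (nome tau)) in *. set (X := hyp (1 / 6) (1 / 2) (nu_lambda l)) in *.
  assert (Bs := binomial_half_sq (- (omega * l))%C). rewrite Cmod_opp in Bs. specialize (Bs Wl).
  set (B := hyp (1 / 2) 1 (- (omega * l))%C) in *.
  replace (th00 (nome tau) ^ 4)%C with ((th00 (nome tau) * th00 (nome tau)) * (th00 (nome tau) * th00 (nome tau)))%C by ring.
  rewrite <- H1, H2.
  transitivity ((1 - - (omega * l)) * (B * B) * (X * X))%C; [ring|]. rewrite Bs. ring.
Qed.

Lemma Cmod_gt_open (a : C) (z : C) : 1 < Cmod (z + a)%C ->
  forall w, Cmod (w - z)%C < Cmod (z + a)%C - 1 -> 1 < Cmod (w + a)%C.
Proof.
  intros H w Hw. pose proof (Cmod_lip (w + a)%C (z + a)%C) as L.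
  replace (w + a - (z + a))%C with (w - z)%C in L by ring. apply Rabs_le_between in L. lra.
Qed.

Lemma strict_domain_open (z : C) : strict_domain z ->
  exists r, 0 < r /\ forall w, Cmod (w - z)%C < r -> strict_domain w.
Proof.
  intros [H1 [H2 [H3 H4]]].
  set (r := Rmin (Rmin (Im z) (Rmin (Re z + 3 / 2) (1 / 2 - Re z))) (Rmin (Cmod z - 1) (Cmod (z + 1)%C - 1))).
  exists r. split; [repeat apply Rmin_pos; lra|]. intros w Hw.
  assert (L1 : r <= Im z) by (eapply Rle_trans; [apply Rmin_l|apply Rmin_l]).
  assert (L2 : r <= Re z + 3 / 2) by (eapply Rle_trans; [apply Rmin_l|eapply Rle_trans; [apply Rmin_r|apply Rmin_l]]).
  assert (L3 : r <= 1 / 2 - Re z) by (eapply Rle_trans; [apply Rmin_l|eapply Rle_trans; [apply Rmin_r|apply Rmin_r]]).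
  assert (L4 : r <= Cmod z - 1) by (eapply Rle_trans; [apply Rmin_r|apply Rmin_l]).
  assert (L5 : r <= Cmod (z + 1)%C - 1) by (eapply Rle_trans; [apply Rmin_r|apply Rmin_r]).
  pose proof (Re_lip w z) as A. pose proof (Im_lip w z) as B. pose proof (Cmod_lip w z) as D.
  apply Rabs_le_between in A. apply Rabs_le_between in B. apply Rabs_le_between in D.
  repeat split; try lra. apply (Cmod_gt_open 1 z H4). lra.
Qed.

(** [locally] refers to the product structure, whose balls are squares; halving the radius fits such
    a square into the disc. *)
Lemma Cinterior_ball (D : C -> Prop) (z : C) :
  Cinterior D z <-> exists r, 0 < r /\ forall w, Cmod (w - z)%C < r -> D w.
Proof.
  split.
  - intros [e He]. exists e. split; [apply cond_pos|]. intros w Hw.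
    apply He. apply (C_NormedModule_mixin_compat1 z w e). exact Hw.
  - intros [r [Hr H]]. exists (mkposreal (r / 2) ltac:(lra)). intros w [Hw1 Hw2].
    apply H. eapply Rle_lt_trans; [apply Cmod_le_abs|].
    change (Rabs (fst w - fst z) < r / 2) in Hw1. change (Rabs (snd w - snd z) < r / 2) in Hw2.
    change (Rabs (fst w - fst z) + Rabs (snd w - snd z) < r). lra.
Qed.

Lemma Cinterior_Dtilde (tau : C) : Cinterior Dtilde tau <-> strict_domain tau.
Proof.
  rewrite Cinterior_ball. split.
  - intros [r [Hr H]].
    assert (Z : Cmod (tau - tau)%C < r) by (rewrite Cminus_diag, Cmod_0; exact Hr).
    destruct (H tau Z) as [H1 [[H2 H2'] [H3 H4]]].
    split; [exact H1|]. split; [split; [exact H2|]|split; [|exact H4]].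
    (* A small shift to the right stays in [Dtilde], so the bound on [Re tau] is strict. *)
    + assert (Q : Cmod (tau + RtoC (r / 2) - tau)%C < r).
      { replace (tau + RtoC (r / 2) - tau)%C with (RtoC (r / 2)) by ring.
        rewrite Cmod_R, Rabs_pos_eq; lra. }
      destruct (H _ Q) as [_ [[_ A] _]]. change (Re tau + r / 2 <= 1 / 2) in A. lra.
    (* A point of the unit circle leaves [Dtilde] when it is contracted towards 0; [d <= 1/2] keeps
       the factor [1 - d] positive. *)
    + apply Rnot_le_lt. intros Q. assert (M : Cmod tau = 1) by lra.
      set (d := Rmin (r / 2) (1 / 2)).
      assert (D0 : 0 < d) by (apply Rmin_pos; lra).
      assert (D1 : d <= r / 2) by apply Rmin_l. assert (D2 : d <= 1 / 2) by apply Rmin_r.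
      assert (Q' : Cmod (RtoC (1 - d) * tau - tau)%C < r).
      { replace (RtoC (1 - d) * tau - tau)%C with (RtoC (- d) * tau)%C.
        - rewrite Cmod_mult, Cmod_R, M, Rabs_Ropp, Rabs_pos_eq; lra.
        - rewrite RtoC_opp, RtoC_minus. ring. }
      destruct (H _ Q') as [_ [_ [A _]]].
      rewrite Cmod_mult, Cmod_R, M, Rabs_pos_eq in A; lra.
  - intros Hs. destruct (strict_domain_open tau Hs) as [r [Hr H]]. exists r. split; [exact Hr|].
    intros w Hw. destruct (H w Hw) as [A [B [D E]]]. repeat split; try lra. exact A.
Qed.

Lemma strict_domain_up (tau : C) (t : R) : strict_domain tau -> 0 <= t ->
  strict_domain (tau + RtoC t * Ci)%C.
Proof.
  intros [H1 [H2 [H3 H4]]] Ht.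
  assert (Up : forall z : C, 0 < Im z -> Cmod z <= Cmod (z + RtoC t * Ci)%C).
  { intros [x y] Hz. simpl in Hz. apply sqrt_le_1_alt. simpl. nra. }
  assert (Er : Re (tau + RtoC t * Ci)%C = Re tau) by (destruct tau; simpl; ring).
  assert (Ei : Im (tau + RtoC t * Ci)%C = Im tau + t) by (destruct tau; simpl; ring).
  assert (U1 := Up tau H1).
  assert (U2 : Cmod (tau + 1)%C <= Cmod (tau + 1 + RtoC t * Ci)%C).
  { apply Up. destruct tau; simpl in *; lra. }
  replace (tau + 1 + RtoC t * Ci)%C with (tau + RtoC t * Ci + 1)%C in U2 by ring.
  unfold strict_domain. rewrite Er, Ei. repeat split; lra.
Qed.

Lemma weight2_hypergeom (tau : C) : strict_domain tau ->
  weight2 tau = (hypergeom (1 / 6)%C (1 / 2)%C (RtoC 1) (nu tau) ^ 2)%C.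
Proof.
  intros Hs. destruct weight2_near_cusp as [r [Hr Hcusp]].
  apply Cminus_eq_0.
  pose (f := fun t => (weight2 t - hypergeom (1 / 6)%C (1 / 2)%C (RtoC 1) (nu t) ^ 2)%C).
  change (f tau = RtoC 0).
  assert (Pi3 : 3 <= PI) by (pose proof PI2_3_2; lra).
  (* The disc of radius 1 about [a] then lies above height [1 / r], where [|q| = exp(- pi Im z) < r]
     because [exp(pi Im z) >= 1 + pi Im z]. *)
  set (T := 1 + / r).
  assert (Ir : 0 < / r) by now apply Rinv_0_lt_compat.
  set (a := (tau + RtoC T * Ci)%C).
  apply (segment_identity f strict_domain a tau 1).
  - apply strict_domain_open.
  - intros z Hz. destruct (strict_domain_nu z Hz) as [N Cz].
    destruct Hz as [Hi _]. destruct (cderiv_weight2 z Hi) as [l L]. destruct (cderiv_nu z Hi N) as [m M].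
    destruct (proj1 (holomorphic_onE _ _) (proj1 (hypergeom_spec (1 / 6) Cmod_sixth_le)) (nu z) Cz) as [h Hh].
    eexists. unfold f. apply cderiv_minus; [exact L|]. apply cderiv_pow.
    apply (cderiv_comp _ nu); eassumption.
  - intros t Ht. replace (a + t * (tau - a))%C with (tau + RtoC ((1 - t) * T) * Ci)%C.
    + apply strict_domain_up; [exact Hs|]. apply Rmult_le_pos; unfold T; lra.
    + unfold a. rewrite RtoC_mult, RtoC_minus. ring.
  - lra.
  - intros z Hz. unfold f. rewrite Hcusp; [ring|].
    rewrite Cmod_nome, exp_Ropp.
    pose proof (Im_lip z a) as L. apply Rabs_le_between in L.
    assert (Ea : Im a = Im tau + T) by (unfold a; destruct tau; simpl; ring).
    destruct Hs as [Hi _].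
    assert (Iz : / r < Im z) by (unfold T in Ea; lra).
    assert (X : / r < exp (PI * Im z)).
    { pose proof (exp_ineq1_le (PI * Im z)). nra. }
    rewrite <- (Rinv_inv r). apply Rinv_lt_contravar; [|exact X].
    apply Rmult_lt_0_compat; [exact Ir|apply exp_pos].
Qed.

Lemma strict_domain_point : strict_domain (- (1 / 2), 2).
Proof.
  repeat split; simpl; try lra.
  - pose proof (im_le_Cmod (- (1 / 2), 2)) as H. simpl in H. rewrite Rabs_pos_eq in H; lra.
  - pose proof (im_le_Cmod (Cplus (- (1 / 2), 2) (RtoC 1))) as H. simpl in H. rewrite Rabs_pos_eq in H; lra.
Qed.

Theorem theorem5p6 :
  (forall tau : C, Cinterior Dtilde tau ->
     (theta 0 0 tau ^ 4 + omega * theta 1 0 tau ^ 4)%C =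
     (hypergeom (1 / 6)%C (1 / 2)%C (RtoC 1) (nu tau) ^ 2)%C)
  /\
  (exists G : C -> C,
     analytic_continuation (Cinterior Dtilde) upper_half_plane
       (fun tau => (hypergeom (1 / 6)%C (1 / 2)%C (RtoC 1) (nu tau) ^ 2)%C) G)
  /\
  (forall G : C -> C,
     analytic_continuation (Cinterior Dtilde) upper_half_plane
       (fun tau => (hypergeom (1 / 6)%C (1 / 2)%C (RtoC 1) (nu tau) ^ 2)%C) G ->
     forall tau : C, upper_half_plane tau ->
       (theta 0 0 tau ^ 4 + omega * theta 1 0 tau ^ 4)%C = G tau).
Proof.
  assert (Main : forall tau, Cinterior Dtilde tau ->
    weight2 tau = (hypergeom (1 / 6)%C (1 / 2)%C (RtoC 1) (nu tau) ^ 2)%C).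
  { intros tau H. apply weight2_hypergeom. now apply Cinterior_Dtilde. }
  split; [exact Main|split].
  (* The left-hand side is holomorphic on the whole half-plane and so is itself the continuation. *)
  - exists weight2. split; [|split; [|exact Main]].
    + intros z Hz. apply Cinterior_Dtilde in Hz. apply Hz.
    + apply holomorphic_onE. exact cderiv_weight2.
  - intros G [_ [HG EG]] tau Ht. change (weight2 tau = G tau). apply Cminus_eq_0.
    rewrite holomorphic_onE in HG.
    pose proof strict_domain_point as Hp. set (a := (- (1 / 2), 2)) in *.
    destruct (strict_domain_open a Hp) as [r [Hr HB]].
    (* Uniqueness: the half-plane is convex, so every [tau] is joined by a segment to the point [a]
       of the domain, near which both functions agree. *)
    apply (segment_identity (fun t => weight2 t - G t)%C upper_half_plane a tau r).
    + intros z Hz. exists (Im z). split; [exact Hz|]. intros w Hw. now apply upper_half_plane_ball with z.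
    + intros z Hz. destruct (cderiv_weight2 z Hz) as [l L]. destruct (HG z Hz) as [m M].
      eexists. apply cderiv_minus; eassumption.
    + intros t Hti. unfold upper_half_plane in *.
      assert (E : Im (a + t * (tau - a))%C = (1 - t) * 2 + t * Im tau).
      { unfold a. destruct tau as [x y]. simpl. ring. }
      rewrite E. destruct (Req_dec t 0) as [->|Nt]; [lra|].
      assert (0 < t * Im tau) by (apply Rmult_lt_0_compat; lra). lra.
    + exact Hr.
    + intros z Hz. rewrite EG.
      * cbv beta. rewrite Main; [ring|]. apply Cinterior_Dtilde. now apply HB.
      * apply Cinterior_Dtilde. now apply HB.
Qed.
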